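(* Let $f\colon D^*\to H^3$ be a regular WCF-end of a flat front with multiplicity $m$, ratio of Gauss maps $\alpha$, and top-term coefficient $q_{-2}$ of the Hopf differential. Then the eigenvalues of the flux matrix $\Phi_f$ are \[\pm\frac{2m\alpha}{(1-\alpha)^2}\quad\Big(=\mp\frac{2q_{-2}}{m}\Big).\] In particular, if $\alpha\neq0$ (that is, $f$ is not horospherical), then $\Phi_f$ is diagonalizable.
   Context: $H^3=\{uu^*:u\in SL(2,\mathbb{C})\}\subset\mathrm{Herm}(2)$, points regarded as matrices. Flat front on $D^*=\{0<|z|<1\}$: $f=\mathcal{E}\mathcal{E}^*$ with $\mathcal{E}=(E_{ij})$ a holomorphic immersion of the universal cover into $SL(2,\mathbb{C})$, $\mathcal{E}^{-1}d\mathcal{E}=\begin{pmatrix}0&\theta\\ \omega&0\end{pmatrix}$, $z$ compatible with $ds^2_{1,1}=|\omega|^2+|\theta|^2$. $G=E_{11}/E_{21}$, $G_*=E_{12}/E_{22}$ (hyperbolic Gauss maps), $Q=\omega\theta$ (Hopf differential). WCF-end: $ds^2_{1,1}$ complete at $0$ with finite total curvature near $0$; regular: $G,G_*$ have at most poles at $0$ (then $G(0)=G_*(0)$). For a regular WCF-end, $Q=z^{-2}(q_{-2}+o(1))dz^2$; horospherical means $q_{-2}=0$. Multiplicity $m$: with $G(0)\ne\infty$ (after an isometry), $m=\min\{\mathrm{ord}_0G',\mathrm{ord}_0G_*'\}+1$ (or ramification order of the nonconstant one if one is constant). $\alpha=(dG_*/dG)(0)$ if $|(dG_*/dG)(0)|\le1$,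 else $(dG/dG_* )(0)$; $\alpha\in[-1,1)$. Flux matrix: $\Phi_f=\frac{\mathrm{i}}{2\pi}\oint_\gamma(\partial f)f^{-1}$, $\gamma$ a loop around $0$ counterclockwise, $\partial f$ the $(1,0)$-part of $df$. *)

(* Defs.v *)
From Stdlib Require Import Reals.
From Coquelicot Require Import Coquelicot.

Local Open Scope R_scope.

Notation CC := Complex.C.

Definition cexp (w : CC) : CC :=
  (exp (Re w) * cos (Im w), exp (Re w) * sin (Im w))%R.

Definition cderiv_at (h : CC -> CC) (z l : CC) : Prop :=
  @is_derive C_AbsRing C_NormedModule h z l.

Definition disk (r : R) (z : CC) : Prop := (Cmod z < r)%R.

Definition holo_disk (r : R) (h : CC -> CC) : Prop :=
  forall z, disk r z -> exists l, cderiv_at h z l.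

Definition rderC (h : R -> CC) (t : R) : CC :=
  (Derive (fun s => Re (h s)) t, Derive (fun s => Im (h s)) t).

Definition RIntC (h : R -> CC) (a b : R) : CC :=
  (RInt (fun s => Re (h s)) a b, RInt (fun s => Im (h s)) a b).

Record M2 := mkM2 { e11 : CC; e12 : CC; e21 : CC; e22 : CC }.

Definition mmul (A B : M2) : M2 :=
  mkM2 (e11 A * e11 B + e12 A * e21 B)%C (e11 A * e12 B + e12 A * e22 B)%C
       (e21 A * e11 B + e22 A * e21 B)%C (e21 A * e12 B + e22 A * e22 B)%C.

Definition mdet (A : M2) : CC := (e11 A * e22 A - e12 A * e21 A)%C.

Definition madj (A : M2) : M2 :=
  mkM2 (Cconj (e11 A)) (Cconj (e21 A)) (Cconj (e12 A)) (Cconj (e22 A)).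

Definition minv (A : M2) : M2 :=
  let d := mdet A in
  mkM2 (e22 A / d)%C (- e12 A / d)%C (- e21 A / d)%C (e11 A / d)%C.

Definition mscal (c : CC) (A : M2) : M2 :=
  mkM2 (c * e11 A)%C (c * e12 A)%C (c * e21 A)%C (c * e22 A)%C.

Definition msub (A B : M2) : M2 :=
  mkM2 (e11 A - e11 B)%C (e12 A - e12 B)%C (e21 A - e21 B)%C (e22 A - e22 B)%C.

Definition mdiag (a b : CC) : M2 := mkM2 a 0%C 0%C b.

Definition is_eigenvalue (A : M2) (mu : CC) : Prop :=
  exists v1 v2 : CC, (v1 <> 0%C \/ v2 <> 0%C) /\
    (e11 A * v1 + e12 A * v2 = mu * v1)%C /\
    (e21 A * v1 + e22 A * v2 = mu * v2)%C.

Definition diagonalizable (A : M2) : Prop :=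
  exists (P : M2) (d1 d2 : CC),
    mdet P <> 0%C /\ mmul A P = mmul P (mdiag d1 d2).

Definition mrder (F : R -> M2) (t : R) : M2 :=
  mkM2 (rderC (fun s => e11 (F s)) t) (rderC (fun s => e12 (F s)) t)
       (rderC (fun s => e21 (F s)) t) (rderC (fun s => e22 (F s)) t).

Definition mRInt (F : R -> M2) (a b : R) : M2 :=
  mkM2 (RIntC (fun s => e11 (F s)) a b) (RIntC (fun s => e12 (F s)) a b)
       (RIntC (fun s => e21 (F s)) a b) (RIntC (fun s => e22 (F s)) a b).

(* The universal cover of D^* is the left half plane {Re w < 0}, with   *)
(* covering map z = exp w.  All data below are functions of w.          *)

(* the point of H^3 (a hermitian matrix) f = E E^* *)
Definition front (E : CC -> M2) (w : CC) : M2 := mmul (E w) (madj (E w)).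

(* E : universal cover -> SL(2,C) is a holomorphic immersion with
   E^{-1} dE = [[0, th],[om, 0]] dw, and f = E E^* is well defined on D^*
   (invariant under the deck transformation w |-> w + 2 pi i). *)
Definition flat_front_data (E : CC -> M2) (om th : CC -> CC) : Prop :=
  (forall w : CC, (Re w < 0)%R ->
     cderiv_at (fun u => e11 (E u)) w (e11 (mmul (E w) (mkM2 0%C (th w) (om w) 0%C))) /\
     cderiv_at (fun u => e12 (E u)) w (e12 (mmul (E w) (mkM2 0%C (th w) (om w) 0%C))) /\
     cderiv_at (fun u => e21 (E u)) w (e21 (mmul (E w) (mkM2 0%C (th w) (om w) 0%C))) /\
     cderiv_at (fun u => e22 (E u)) w (e22 (mmul (E w) (mkM2 0%C (th w) (om w) 0%C))) /\
     mdet (E w) = 1%C /\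
     (om w <> 0%C \/ th w <> 0%C)) /\
  (forall w : CC, (Re w < 0)%R ->
     front E (w + ((0%R, (2 * PI)%R) : CC))%C = front E w).

(* density of ds^2_{1,1} = |om|^2 + |th|^2 in the coordinate w:
   ds^2_{1,1} = lam(w) |dw|^2 *)
Definition lam (om th : CC -> CC) (x y : R) : R :=
  (Cmod (om (x, y)) ^ 2 + Cmod (th (x, y)) ^ 2)%R.

Definition laplacian (L : R -> R -> R) (x y : R) : R :=
  (Derive (fun s => Derive (fun t => L t y) s) x +
   Derive (fun s => Derive (fun t => L x t) s) y)%R.

Definition gauss_curv (om th : CC -> CC) (x y : R) : R :=
  (- laplacian (fun a b => ln (lam om th a b)) x y / (2 * lam om th x y))%R.

(* ds^2_{1,1} is complete at z = 0: every C^1 path in the universal cover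
   which tends to the end (Re w -> -oo, i.e. z -> 0) has infinite length. *)
Definition complete_at_0 (om th : CC -> CC) : Prop :=
  forall g1 g2 : R -> R,
    (forall t, (0 <= t < 1)%R ->
       (g1 t < 0)%R /\ ex_derive g1 t /\ ex_derive g2 t /\
       continuous (Derive g1) t /\ continuous (Derive g2) t) ->
    filterlim g1 (at_left 1) (Rbar_locally m_infty) ->
    filterlim
      (fun s => RInt (fun t => sqrt (lam om th (g1 t) (g2 t)) *
                               sqrt (Derive g1 t ^ 2 + Derive g2 t ^ 2)) 0 s)
      (at_left 1) (Rbar_locally p_infty).

(* finite total curvature near z = 0:  the integral of |K| dA over a
   punctured neighbourhood {0 < |z| < exp x0} is finite.  In the coordinate
   w = x + i y a fundamental domain is {x < x0, 0 <= y <= 2 pi}, and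
   dA = lam dx dy. *)
Definition finite_total_curv_at_0 (om th : CC -> CC) : Prop :=
  exists x0 : R, (x0 < 0)%R /\
    ex_RInt_gen
      (fun x => RInt (fun y => Rabs (gauss_curv om th x y) * lam om th x y) 0 (2 * PI))
      (Rbar_locally m_infty) (at_point x0).

Definition WCF_end (om th : CC -> CC) : Prop :=
  complete_at_0 om th /\ finite_total_curv_at_0 om th.

(* The meromorphic function a/b on the universal cover (here a = E11,
   b = E21 for G, a = E12, b = E22 for G_* ) has at most a pole at z = 0:
   near 0 it is of the form [p(z) : q(z)] with p, q holomorphic on a disk
   around 0, (p(0), q(0)) <> (0,0). *)
Definition at_most_pole_at_0 (a b : CC -> CC) : Prop :=
  exists (r : R) (p q : CC -> CC),
    (0 < r)%R /\ holo_disk r p /\ holo_disk r q /\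
    (p 0%C <> 0%C \/ q 0%C <> 0%C) /\
    forall w : CC, (Re w < ln r)%R -> (Re w < 0)%R ->
      (a w * q (cexp w) = b w * p (cexp w))%C.

Definition regular_end (E : CC -> M2) : Prop :=
  at_most_pole_at_0 (fun w => e11 (E w)) (fun w => e21 (E w)) /\
  at_most_pole_at_0 (fun w => e12 (E w)) (fun w => e22 (E w)).

Definition has_order_at_0 (h : CC -> CC) (n : nat) : Prop :=
  exists (r : R) (u : CC -> CC),
    (0 < r)%R /\ holo_disk r u /\ u 0%C <> 0%C /\
    forall z, disk r z -> h z = (Cpow z n * u z)%C.

(* m = min{ord_0 G', ord_0 G_*'} + 1, where the order of the zero function
   (constant Gauss map) is +oo; dg, dgs are G', G_*' (G(0) <> oo). *)
Definition is_multiplicity (dg dgs : CC -> CC) (m : nat) : Prop :=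
  (1 <= m)%nat /\
  ((has_order_at_0 dg (m - 1) /\ forall k, has_order_at_0 dgs k -> (m - 1 <= k)%nat) \/
   (has_order_at_0 dgs (m - 1) /\ forall k, has_order_at_0 dg k -> (m - 1 <= k)%nat)).

Definition is_gauss_ratio (dg dgs : CC -> CC) (alpha : CC) : Prop :=
  (filterlim (fun z => (dgs z / dg z)%C) (@locally' C_UniformSpace (RtoC 0)) (locally alpha)
     /\ (Cmod alpha <= 1)%R) \/
  (filterlim (fun z => (dg z / dgs z)%C) (@locally' C_UniformSpace (RtoC 0)) (locally alpha)
     /\ (Cmod alpha < 1)%R).

(* Q = om th = Qhat(w) dw^2 = z^{-2} Qhat dz^2, so q_{-2} = lim_{z->0} Qhat *)
Definition hopf_top_coeff (om th : CC -> CC) (q : CC) : Prop :=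
  forall eps : R, (0 < eps)%R -> exists M : R, forall w : CC,
    (Re w < M)%R -> (Re w < 0)%R -> (Cmod (om w * th w - q) < eps)%R.

(* (1,0)-part of df in the coordinate w:  d_w f = (f_x - i f_y)/2 *)
Definition dw_front (E : CC -> M2) (w : CC) : M2 :=
  mscal (/ 2)%C
    (msub (mrder (fun s => front E (s, Im w)) (Re w))
          (mscal Ci (mrder (fun s => front E (Re w, s)) (Im w)))).

(* Flux matrix  (i / 2 pi) \oint_gamma (\partial f) f^{-1}, gamma the circle
   |z| = exp x0 run counterclockwise, i.e. w(t) = x0 + i t, t in [0, 2 pi],
   dw = i dt. *)
Definition flux (E : CC -> M2) (x0 : R) : M2 :=
  mscal (Ci / RtoC (2 * PI))%C
    (mRInt (fun t => mscal Ci (mmul (dw_front E (x0, t)) (minv (front E (x0, t)))))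
           0 (2 * PI)).

(* Main.v *)
(** Write F for the moved frame, p and s for its second row, z = e^w,
    H = G - G_*, and ' for d/dw.  From dF = F [[0, th], [om, 0]] and det F = 1
    one gets H p s = 1, om = - G' p^2 and th = G_*' s^2, so all data are
    expressed by the Gauss maps, which are holomorphic in z.
    If G(0) <> G_*(0), then p and s stay bounded along the negative real axis
    and the metric is O(|z|), against completeness.  If alpha = 1, then H
    vanishes to higher order than G - G(0); so th / om has an essential
    singularity and its values sweep out a definite area over every small
    circle, against finite total curvature.
    Otherwise H vanishes to the order m of the Gauss maps.  The integrand
    (partial f) f^-1 = dE E^-1 of the flux is holomorphic and periodic in w, so its
    integral over a period does not depend on the radius.  Conjugated into the
    moved frame, translated so that G(0) = 0, its upper right entry tends to 0
    at the end and its diagonal entries tend to -2 m alpha / (1 - alpha)^2 and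
    the opposite.  Hence the flux matrix is conjugate to a lower triangular
    matrix with the asserted diagonal.
    The Gauss maps are only assumed complex differentiable, so Cauchy's theorem
    is needed in Goursat's form. *)

(* The frame [E] is not periodic in w, only [front E] is. Periodicity reaches dE E^-1 because that
   form coincides with (partial f) f^-1. In the centred frame the numerator of its upper right entry
   vanishes at least to order 3m and H^2 to order 2m, whereas the lower left entry -(z G' + z G_*')
   / H^2 has in general a pole of order m. So limits at the end yield a triangular matrix and no
   more, which is enough for trace and determinant.

   With G' = z^(m-1) u and G_*' = z^(m-1) v, the required limits come from G - G(0) = z^m (u(0)/m +
   o(1)) and its analogue for G_*. The value 2 m u v / (u - v)^2 at 0 is symmetric in u and v, so it
   does not matter which Gauss map realises the multiplicity.

   The obstacle is u(0) = v(0). Then p'/p = -z G'/H and s'/s = z G_*'/H have poles with opposite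
   leading terms, and th / om grows and decays along rays like the exponential of a pole. Up to sign
   the curvature form of |om|^2 + |th|^2 is the spherical area form pulled back by th / om, which
   turns this oscillation into infinite total curvature. *)
Require Import Defs.
From Stdlib Require Import Reals Lra Lia ClassicalEpsilon Wf_nat.
From Coquelicot Require Import Coquelicot.

Local Open Scope R_scope.

(** * Derivatives and continuity of complex-valued maps *)

(* One notion of derivative for maps from [R] and from [CC] to [CC]: the domain is embedded in [CC] by [i], which is [RtoC] or the identity. *)
Definition der {T : Type} (i : T -> CC) (f : T -> CC) (t : T) (l : CC) : Prop :=
  forall eps, 0 < eps -> exists d, 0 < d /\ forall s, Cmod (i s - i t) < d ->
    Cmod (f s - f t - l * (i s - i t)) <= eps * Cmod (i s - i t).

Definition ctn {T : Type} (i : T -> CC) (f : T -> CC) (t : T) : Prop :=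
  forall eps, 0 < eps -> exists d, 0 < d /\ forall s, Cmod (i s - i t) < d ->
    Cmod (f s - f t) < eps.

Definition idC (z : CC) : CC := z.
Notation cder := (der idC).
Notation rder := (der RtoC).
Notation ccont := (ctn idC).
Notation rcont := (ctn RtoC).

Lemma Cmod_tri_sub (x y : CC) : Cmod (x - y) <= Cmod x + Cmod y.
Proof.
  replace (x - y)%C with (x + - y)%C by ring.
  rewrite <- (Cmod_opp y). apply Cmod_triangle.
Qed.

Lemma Cmod_sub_ge (x y : CC) : Cmod x - Cmod y <= Cmod (x - y).
Proof.
  pose proof (Cmod_triangle (x - y) y) as H.
  replace (x - y + y)%C with x in H by ring. lra.
Qed.

Lemma Cmod_sym (x y : CC) : Cmod (x - y) = Cmod (y - x).
Proof. rewrite <- Cmod_opp. f_equal. ring. Qed.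

Lemma Cmod_neq0 (x : CC) : 0 < Cmod x -> x <> 0%C.
Proof. apply Cmod_gt_0. Qed.

Lemma cder_iff (h : CC -> CC) (z l : CC) : cderiv_at h z l <-> cder h z l.
Proof.
  unfold cderiv_at, is_derive, filterdiff, is_domin, der, idC. split.
  - intros [_ H] eps Heps.
    specialize (H z (fun P HP => HP) (mkposreal eps Heps)).
    destruct H as [d Hd]. exists d. split; [apply cond_pos|].
    intros s Hs. specialize (Hd s Hs).
    replace (h s - h z - l * (s - z))%C with (h s - h z - (s - z) * l)%C by ring.
    exact Hd.
  - intros H. split.
    + apply (is_linear_scal_l (K := C_AbsRing) (V := C_NormedModule) l).
    + intros x Hx.
      assert (x = z).
      { symmetry. apply (is_filter_lim_locally_unique (K := C_AbsRing) (V := AbsRing_NormedModule C_AbsRing)). exact Hx. }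
      subst x. intros eps. destruct (H eps (cond_pos eps)) as [d [Hd Hd']].
      exists (mkposreal d Hd). intros y Hy. change CC in (type of y).
      specialize (Hd' y Hy).
      replace (h y - h z - l * (y - z))%C with (h y - h z - (y - z) * l)%C in Hd' by ring.
      exact Hd'.
Qed.

Section DerRules.
Context {T : Type} (i : T -> CC).

Lemma der_ctn (f : T -> CC) t l : der i f t l -> ctn i f t.
Proof.
  intros H eps Heps. destruct (H 1 Rlt_0_1) as [d [Hd H1]].
  pose proof (Cmod_ge_0 l) as Hl.
  exists (Rmin d (eps / (Cmod l + 2))). split.
  { apply Rmin_pos; trivial. apply Rdiv_lt_0_compat; lra. }
  intros s Hs.
  destruct (Rmin_Rgt_l _ _ _ Hs) as [Hs1 Hs2].
  specialize (H1 s Hs1).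
  replace (f s - f t)%C with ((f s - f t - l * (i s - i t)) + l * (i s - i t))%C by ring.
  eapply Rle_lt_trans; [apply Cmod_triangle|]. rewrite Cmod_mult.
  apply Rle_lt_trans with ((Cmod l + 1) * Cmod (i s - i t)); [lra|].
  apply (Rmult_lt_compat_l (Cmod l + 2)) in Hs2; [|lra].
  replace ((Cmod l + 2) * (eps / (Cmod l + 2))) with eps in Hs2 by (field; lra).
  pose proof (Cmod_ge_0 (i s - i t)). lra.
Qed.

Lemma ctn_const (c : CC) t : ctn i (fun _ => c) t.
Proof.
  intros eps H. exists 1. split; [lra|]. intros s _.
  replace (c - c)%C with (RtoC 0) by ring. now rewrite Cmod_0.
Qed.

Lemma ctn_self t : ctn i i t.
Proof. intros eps H. exists eps. split; trivial. Qed.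

Lemma ctn_plus (f g : T -> CC) t : ctn i f t -> ctn i g t -> ctn i (fun s => f s + g s)%C t.
Proof.
  intros Hf Hg eps H.
  destruct (Hf (eps / 2)) as [d1 [Q1 H1]]; [lra|].
  destruct (Hg (eps / 2)) as [d2 [Q2 H2]]; [lra|].
  exists (Rmin d1 d2). split; [now apply Rmin_pos|]. intros s Hs.
  replace (f s + g s - (f t + g t))%C with ((f s - f t) + (g s - g t))%C by ring.
  eapply Rle_lt_trans; [apply Cmod_triangle|].
  destruct (Rmin_Rgt_l _ _ _ Hs) as [LH1 LH2]. specialize (H1 s LH1). specialize (H2 s LH2). lra.
Qed.

Lemma ctn_bounded (f : T -> CC) t : ctn i f t ->
  exists d, 0 < d /\ forall s, Cmod (i s - i t) < d -> Cmod (f s) < Cmod (f t) + 1.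
Proof.
  intros H. destruct (H 1 Rlt_0_1) as [d [Hd H1]]. exists d. split; trivial.
  intros s Hs. specialize (H1 s Hs). pose proof (Cmod_sub_ge (f s) (f t)). lra.
Qed.

Lemma ctn_mult (f g : T -> CC) t : ctn i f t -> ctn i g t -> ctn i (fun s => f s * g s)%C t.
Proof.
  intros Hf Hg eps H.
  destruct (ctn_bounded f t Hf) as [d0 [Q3 H0]].
  pose proof (Cmod_ge_0 (f t)) as Pf. pose proof (Cmod_ge_0 (g t)) as Pg.
  destruct (Hf (eps / (2 * (Cmod (g t) + 1)))) as [d1 [Q4 H1]].
  { apply Rdiv_lt_0_compat; lra. }
  destruct (Hg (eps / (2 * (Cmod (f t) + 1)))) as [d2 [Q5 H2]].
  { apply Rdiv_lt_0_compat; lra. }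
  exists (Rmin d0 (Rmin d1 d2)). split; [repeat apply Rmin_pos; trivial|].
  intros s Hs.
  specialize (H0 s (Rlt_le_trans _ _ _ Hs (Rmin_l _ _))).
  specialize (H1 s (Rlt_le_trans _ _ _ Hs (Rle_trans _ _ _ (Rmin_r _ _) (Rmin_l _ _)))).
  specialize (H2 s (Rlt_le_trans _ _ _ Hs (Rle_trans _ _ _ (Rmin_r _ _) (Rmin_r _ _)))).
  replace (f s * g s - f t * g t)%C with (f s * (g s - g t) + (f s - f t) * g t)%C by ring.
  eapply Rle_lt_trans; [apply Cmod_triangle|]. rewrite !Cmod_mult.
  apply Rlt_le_trans with (eps / 2 + eps / 2); [|lra].
  apply Rplus_lt_le_compat.
  - apply Rle_lt_trans with ((Cmod (f t) + 1) * Cmod (g s - g t)).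
    + apply Rmult_le_compat_r; [apply Cmod_ge_0|lra].
    + replace (eps / 2) with ((Cmod (f t) + 1) * (eps / (2 * (Cmod (f t) + 1)))) by (field; lra).
      apply Rmult_lt_compat_l; lra.
  - apply Rle_trans with (eps / (2 * (Cmod (g t) + 1)) * (Cmod (g t) + 1)).
    + apply Rmult_le_compat; try apply Cmod_ge_0; lra.
    + right. field. lra.
Qed.

Lemma ctn_ext (f g : T -> CC) t : (forall s, f s = g s) -> ctn i f t -> ctn i g t.
Proof.
  intros E H eps He. destruct (H eps He) as [d [Q6 Hd]]. exists d. split; trivial.
  intros s Hs. rewrite <- !E. now apply Hd.
Qed.

Lemma ctn_opp (f : T -> CC) t : ctn i f t -> ctn i (fun s => - f s)%C t.
Proof.
  intros H. apply ctn_ext with (fun s => (-(1)) * f s)%C; [intros; ring|].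
  apply ctn_mult; trivial. apply ctn_const.
Qed.

Lemma ctn_minus (f g : T -> CC) t : ctn i f t -> ctn i g t -> ctn i (fun s => f s - g s)%C t.
Proof. intros. apply ctn_plus; trivial. now apply ctn_opp. Qed.

Lemma ctn_comp (h : CC -> CC) (f : T -> CC) t :
  ccont h (f t) -> ctn i f t -> ctn i (fun s => h (f s)) t.
Proof.
  intros Hh Hf eps He. destruct (Hh eps He) as [d1 [Hd1 H1]].
  destruct (Hf d1 Hd1) as [d [Hd H]]. exists d. split; trivial.
  intros s Hs. apply H1. now apply H.
Qed.

Lemma ctn_away (f : T -> CC) t : ctn i f t -> f t <> 0%C ->
  exists d, 0 < d /\ forall s, Cmod (i s - i t) < d -> Cmod (f t) / 2 < Cmod (f s).
Proof.
  intros H Hn. apply Cmod_gt_0 in Hn.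
  destruct (H (Cmod (f t) / 2)) as [d [Hd H1]]; [lra|]. exists d. split; trivial.
  intros s Hs. specialize (H1 s Hs). rewrite Cmod_sym in H1.
  pose proof (Cmod_sub_ge (f t) (f s)). lra.
Qed.

Lemma der_ext (f g : T -> CC) t l : (forall s, f s = g s) -> der i f t l -> der i g t l.
Proof.
  intros E H eps He. destruct (H eps He) as [d [Q7 Hd]]. exists d. split; trivial.
  intros s Hs. rewrite <- !E. now apply Hd.
Qed.

Lemma der_ext_loc (f g : T -> CC) t l d : 0 < d ->
  (forall s, Cmod (i s - i t) < d -> f s = g s) -> der i f t l -> der i g t l.
Proof.
  intros Hd E H eps He. destruct (H eps He) as [d' [Q8 Hd']]. exists (Rmin d d').
  split; [now apply Rmin_pos|].
  intros s Hs. rewrite <- !E.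
  - apply Hd'. apply Rlt_le_trans with (1 := Hs). apply Rmin_r.
  - replace (i t - i t)%C with (RtoC 0) by ring. now rewrite Cmod_0.
  - apply Rlt_le_trans with (1 := Hs). apply Rmin_l.
Qed.

Lemma der_eq (f : T -> CC) t l l' : l = l' -> der i f t l -> der i f t l'.
Proof. now intros ->. Qed.

Lemma der_const (c : CC) t : der i (fun _ => c) t 0.
Proof.
  intros eps H. exists 1. split; [lra|]. intros s _.
  replace (c - c - 0 * (i s - i t))%C with (RtoC 0) by ring. rewrite Cmod_0.
  apply Rmult_le_pos; [lra|apply Cmod_ge_0].
Qed.

Lemma der_self t : der i i t 1.
Proof.
  intros eps H. exists 1. split; [lra|]. intros s _.
  replace (i s - i t - 1 * (i s - i t))%C with (RtoC 0) by ring. rewrite Cmod_0.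
  apply Rmult_le_pos; [lra|apply Cmod_ge_0].
Qed.

Lemma der_plus (f g : T -> CC) t l k :
  der i f t l -> der i g t k -> der i (fun s => f s + g s)%C t (l + k)%C.
Proof.
  intros Hf Hg eps H.
  destruct (Hf (eps / 2)) as [d1 [Q9 H1]]; [lra|].
  destruct (Hg (eps / 2)) as [d2 [Q10 H2]]; [lra|].
  exists (Rmin d1 d2). split; [now apply Rmin_pos|]. intros s Hs.
  replace (f s + g s - (f t + g t) - (l + k) * (i s - i t))%C
    with ((f s - f t - l * (i s - i t)) + (g s - g t - k * (i s - i t)))%C by ring.
  eapply Rle_trans; [apply Cmod_triangle|].
  destruct (Rmin_Rgt_l _ _ _ Hs) as [LH1 LH2]. specialize (H1 s LH1). specialize (H2 s LH2). lra.
Qed.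

(* Carathéodory's form of the derivative: it reduces the product, chain and inverse rules to continuity. *)
Lemma der_slope (f : T -> CC) t l :
  der i f t l <-> exists q : T -> CC,
    (exists d, 0 < d /\ forall s, Cmod (i s - i t) < d -> f s - f t = q s * (i s - i t))%C
    /\ q t = l /\ ctn i q t.
Proof.
  split.
  - intros H.
    (* For an abstract [i], [i s = i t] does not mean [s = t]. The slope is filled in with [l] at
       all such [s], and there the estimate in [der] forces [f s = f t]. *)
    exists (fun s => if excluded_middle_informative (i s = i t) then l
                     else (f s - f t) / (i s - i t))%C.
    repeat split.
    + destruct (H 1 Rlt_0_1) as [d [Hd H1]]. exists d. split; trivial. intros s Hs.
      destruct (excluded_middle_informative (i s = i t)) as [e|n].
      * specialize (H1 s Hs). rewrite e in *.
        replace (i t - i t)%C with (RtoC 0) in * by ring.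
        rewrite Cmod_0, Rmult_0_r in H1.
        assert (E : (f s - f t - l * 0)%C = 0%C)
          by (apply Cmod_eq_0, Rle_antisym; [exact H1|apply Cmod_ge_0]).
        replace (f s - f t)%C with (f s - f t - l * 0 + l * 0)%C by ring.
        rewrite E. ring.
      * field. intros E. apply n. replace (i s) with (i s - i t + i t)%C by ring.
        rewrite E. ring.
    + destruct (excluded_middle_informative (i t = i t)); [trivial|congruence].
    + intros eps He. destruct (H (eps / 2)) as [d [Hd H1]]; [lra|].
      exists d. split; trivial. intros s Hs.
      destruct (excluded_middle_informative (i t = i t)) as [_|?]; [|congruence].
      destruct (excluded_middle_informative (i s = i t)) as [e|n].
      * replace (l - l)%C with (RtoC 0) by ring. now rewrite Cmod_0.
      * assert (Hn : (i s - i t)%C <> 0%C).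
        { intros E. apply n. replace (i s) with (i s - i t + i t)%C by ring. rewrite E. ring. }
        replace ((f s - f t) / (i s - i t) - l)%C
          with ((f s - f t - l * (i s - i t)) / (i s - i t))%C by (field; trivial).
        rewrite Cmod_div by trivial. specialize (H1 s Hs).
        apply Cmod_gt_0 in Hn.
        apply Rle_lt_trans with (eps / 2); [|lra].
        apply Rmult_le_reg_r with (Cmod (i s - i t)); trivial.
        unfold Rdiv at 1. rewrite Rmult_assoc, Rinv_l by lra. lra.
  - intros [q [[d [Hd E]] [Hq Hc]]] eps He.
    destruct (Hc eps He) as [d' [Hd' H]].
    exists (Rmin d d'). split; [now apply Rmin_pos|]. intros s Hs.
    rewrite E by (apply Rlt_le_trans with (1 := Hs), Rmin_l).
    rewrite <- Hq.
    replace (q s * (i s - i t) - q t * (i s - i t))%C with ((q s - q t) * (i s - i t))%C by ring.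
    rewrite Cmod_mult. apply Rmult_le_compat_r; [apply Cmod_ge_0|].
    left. apply H. apply Rlt_le_trans with (1 := Hs), Rmin_r.
Qed.

Lemma der_mult (f g : T -> CC) t l k :
  der i f t l -> der i g t k -> der i (fun s => f s * g s)%C t (l * g t + f t * k)%C.
Proof.
  intros Hf Hg. pose proof (der_ctn _ _ _ Hf) as Cf.
  apply der_slope in Hf. apply der_slope in Hg. apply der_slope.
  destruct Hf as [q1 [[d1 [Hd1 E1]] [Q1 C1]]].
  destruct Hg as [q2 [[d2 [Hd2 E2]] [Q2 C2]]].
  exists (fun s => q1 s * g t + f s * q2 s)%C. repeat split.
  - exists (Rmin d1 d2). split; [now apply Rmin_pos|]. intros s Hs.
    destruct (Rmin_Rgt_l _ _ _ Hs) as [LE1 LE2]. specialize (E1 s LE1). specialize (E2 s LE2).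
    replace (f s * g s - f t * g t)%C with ((f s - f t) * g t + f s * (g s - g t))%C by ring.
    rewrite E1, E2. ring.
  - now rewrite Q1, Q2.
  - apply ctn_plus; apply ctn_mult; trivial. apply ctn_const.
Qed.

Lemma der_opp (f : T -> CC) t l : der i f t l -> der i (fun s => - f s)%C t (- l)%C.
Proof.
  intros H. apply der_ext with (fun s => (-(1)) * f s)%C; [intros; ring|].
  eapply der_eq; [|apply der_mult; [apply der_const|exact H]]. cbv beta. ring.
Qed.

Lemma der_minus (f g : T -> CC) t l k :
  der i f t l -> der i g t k -> der i (fun s => f s - g s)%C t (l - k)%C.
Proof. intros. apply der_plus; trivial. now apply der_opp. Qed.

Lemma der_comp (h : CC -> CC) (f : T -> CC) t l k :
  cder h (f t) l -> der i f t k -> der i (fun s => h (f s)) t (l * k)%C.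
Proof.
  intros Hh Hf. pose proof (der_ctn _ _ _ Hf) as Cf.
  intros eps He.
  apply der_slope in Hf. destruct Hf as [q [[d1 [Hd1 E1]] [Q1 C1]]].
  destruct (ctn_bounded _ _ C1) as [d2 [Hd2 B2]].
  pose proof (Cmod_ge_0 (q t)) as Pq. pose proof (Cmod_ge_0 l) as Pl.
  destruct (Hh (eps / 2 / (Cmod (q t) + 1))) as [d3 [Hd3 H3]].
  { apply Rdiv_lt_0_compat; lra. }
  destruct (Cf d3 Hd3) as [d4 [Hd4 H4]].
  destruct (C1 (eps / 2 / (Cmod l + 1))) as [d5 [Hd5 H5]].
  { apply Rdiv_lt_0_compat; lra. }
  exists (Rmin (Rmin d1 d2) (Rmin d4 d5)). split; [repeat apply Rmin_pos; trivial|].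
  intros s Hs.
  destruct (Rmin_Rgt_l _ _ _ Hs) as [Ha Hb].
  destruct (Rmin_Rgt_l _ _ _ Ha) as [LE1 LB2]. specialize (E1 s LE1). specialize (B2 s LB2).
  destruct (Rmin_Rgt_l _ _ _ Hb) as [LH4 LH5]. specialize (H4 s LH4). specialize (H5 s LH5).
  specialize (H3 (f s) H4). unfold idC in H3.
  replace (h (f s) - h (f t) - l * k * (i s - i t))%C
    with ((h (f s) - h (f t) - l * (f s - f t)) + l * (q s - q t) * (i s - i t))%C
    by (rewrite E1, <- Q1; ring).
  eapply Rle_trans; [apply Cmod_triangle|]. rewrite !Cmod_mult.
  replace eps with (eps / 2 + eps / 2) by field. rewrite Rmult_plus_distr_r.
  pose proof (Cmod_ge_0 (i s - i t)) as Pn.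
  apply Rplus_le_compat.
  - apply Rle_trans with (1 := H3). rewrite E1, Cmod_mult.
    apply Rle_trans with (eps / 2 / (Cmod (q t) + 1) * ((Cmod (q t) + 1) * Cmod (i s - i t))).
    + apply Rmult_le_compat_l; [left; apply Rdiv_lt_0_compat; lra|].
      apply Rmult_le_compat_r; lra.
    + right. field. lra.
  - apply Rmult_le_compat_r; trivial.
    apply Rle_trans with ((Cmod l + 1) * (eps / 2 / (Cmod l + 1))).
    + apply Rmult_le_compat; try apply Cmod_ge_0; lra.
    + right. field. lra.
Qed.

Lemma der_unique (f : T -> CC) t l k :
  (forall d, 0 < d -> exists s, 0 < Cmod (i s - i t) < d) ->
  der i f t l -> der i f t k -> l = k.
Proof.
  intros Hacc Hl Hk.
  destruct (Ceq_dec l k) as [|n]; trivial. exfalso.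
  assert (Hn : 0 < Cmod (l - k)).
  { apply Cmod_gt_0. intros E. apply n. replace l with (l - k + k)%C by ring. rewrite E. ring. }
  destruct (Hl (Cmod (l - k) / 4)) as [d1 [Hd1 H1]]; [lra|].
  destruct (Hk (Cmod (l - k) / 4)) as [d2 [Hd2 H2]]; [lra|].
  destruct (Hacc (Rmin d1 d2)) as [s [Hs0 Hs]]; [now apply Rmin_pos|].
  destruct (Rmin_Rgt_l _ _ _ Hs) as [LH1 LH2]. specialize (H1 s LH1). specialize (H2 s LH2).
  pose proof (Cmod_tri_sub (f s - f t - k * (i s - i t)) (f s - f t - l * (i s - i t))) as H3.
  replace (f s - f t - k * (i s - i t) - (f s - f t - l * (i s - i t)))%C
    with ((l - k) * (i s - i t))%C in H3 by ring.
  rewrite Cmod_mult in H3.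
  assert (0 < Cmod (l - k) * Cmod (i s - i t)) by now apply Rmult_lt_0_compat. lra.
Qed.

End DerRules.

Lemma cder_unique (f : CC -> CC) t l k : cder f t l -> cder f t k -> l = k.
Proof.
  apply der_unique. intros d Hd. exists (t + RtoC (d / 2))%C. unfold idC.
  replace (t + RtoC (d / 2) - t)%C with (RtoC (d / 2)) by ring.
  rewrite Cmod_R, Rabs_pos_eq; lra.
Qed.

Lemma cder_inv_id (z : CC) : z <> 0%C -> cder (fun u => / u)%C z (- / (z * z))%C.
Proof.
  intros Hz. pose proof Hz as Hz'. apply Cmod_gt_0 in Hz'.
  intros eps He. unfold idC.
  exists (Rmin (Cmod z / 2) (eps * (Cmod z * Cmod z * Cmod z) / 2)). split.
  { apply Rmin_pos; [lra|]. repeat apply Rmult_lt_0_compat; lra. }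
  intros s Hs.
  destruct (Rmin_Rgt_l _ _ _ Hs) as [H1 H2].
  assert (Hs' : Cmod z / 2 < Cmod s).
  { rewrite Cmod_sym in H1. pose proof (Cmod_sub_ge z s). lra. }
  assert (Hs0 : s <> 0%C) by (apply Cmod_neq0; lra).
  replace (/ s - / z - - / (z * z) * (s - z))%C
    with ((s - z) * ((s - z) / (s * z * z)))%C by (field; auto).
  rewrite Cmod_mult, Rmult_comm. apply Rmult_le_compat_r; [apply Cmod_ge_0|].
  rewrite Cmod_div by (repeat apply Cmult_neq_0; trivial). rewrite !Cmod_mult.
  set (a := Cmod z) in *. set (b := Cmod s) in *.
  assert (0 < b * a * a) by (repeat apply Rmult_lt_0_compat; lra).
  apply Rmult_le_reg_r with (b * a * a); trivial.
  unfold Rdiv. rewrite Rmult_assoc, Rinv_l, Rmult_1_r by lra.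
  apply Rle_trans with (eps * (a * a * a) / 2); [lra|].
  replace (eps * (a * a * a) / 2) with (eps * (a / 2 * a * a)) by field.
  apply Rmult_le_compat_l; [lra|].
  repeat (apply Rmult_le_compat_r; [lra|]). lra.
Qed.

Lemma der_inv {T} (i : T -> CC) (f : T -> CC) t l : f t <> 0%C ->
  der i f t l -> der i (fun s => / f s)%C t (- (l / (f t * f t)))%C.
Proof.
  intros Hn H. eapply der_eq; [|apply (der_comp i (fun u => / u)%C f t)].
  2: apply cder_inv_id; trivial. 2: exact H. field. trivial.
Qed.

Lemma der_div {T} (i : T -> CC) (f g : T -> CC) t l k : g t <> 0%C ->
  der i f t l -> der i g t k ->
  der i (fun s => f s / g s)%C t ((l * g t - f t * k) / (g t * g t))%C.
Proof.
  intros Hn Hf Hg. eapply der_eq; [|apply der_mult; [exact Hf|apply der_inv; [trivial|exact Hg]]].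
  simpl. field. trivial.
Qed.

Lemma ctn_inv {T} (i : T -> CC) (f : T -> CC) t : f t <> 0%C ->
  ctn i f t -> ctn i (fun s => / f s)%C t.
Proof.
  intros Hn H. apply (ctn_comp i (fun u => / u)%C); trivial.
  eapply der_ctn. now apply cder_inv_id.
Qed.

Lemma ctn_div {T} (i : T -> CC) (f g : T -> CC) t : g t <> 0%C ->
  ctn i f t -> ctn i g t -> ctn i (fun s => f s / g s)%C t.
Proof. intros. apply ctn_mult; trivial. now apply ctn_inv. Qed.

Lemma ctn_pow {T} (i : T -> CC) (f : T -> CC) t n :
  ctn i f t -> ctn i (fun s => f s ^ n)%C t.
Proof.
  intros H. induction n as [|n IH]; simpl.
  - apply ctn_const.
  - apply ctn_mult; trivial.
Qed.

Lemma der_pow {T} (i : T -> CC) (f : T -> CC) t l n :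
  der i f t l -> der i (fun s => f s ^ n)%C t (RtoC (INR n) * f t ^ (n - 1) * l)%C.
Proof.
  intros H. induction n as [|n IH].
  - eapply der_eq; [|apply (der_const i 1 t)]. simpl. ring.
  - simpl Cpow. eapply der_eq; [|apply der_mult; [exact H|exact IH]]. simpl.
    destruct n as [|n].
    + simpl. ring.
    + rewrite !S_INR. simpl. rewrite !Nat.sub_0_r, !RtoC_plus. ring.
Qed.

(** * Integrals of complex-valued functions *)

Ltac parts := unfold Re, Im, Cminus, Cplus, Copp, Cmult, RtoC; simpl; ring.

Ltac min_bounds := repeat
  match goal with
  | |- context [Rmin ?a ?b] =>
      pose proof (Rmin_l a b); pose proof (Rmin_r a b);
      let m := fresh in set (m := Rmin a b) in *; clearbody m
  | H : context [Rmin ?a ?b] |- _ =>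
      pose proof (Rmin_l a b); pose proof (Rmin_r a b);
      let m := fresh in set (m := Rmin a b) in *; clearbody m
  end.

Lemma is_derive_eps (f : R -> R) (t l : R) :
  is_derive f t l <-> forall eps, 0 < eps -> exists d, 0 < d /\ forall s, Rabs (s - t) < d ->
    Rabs (f s - f t - l * (s - t)) <= eps * Rabs (s - t).
Proof.
  unfold is_derive, filterdiff, is_domin. split.
  - intros [_ H] eps Heps.
    destruct (H t (fun P HP => HP) (mkposreal eps Heps)) as [d Hd].
    exists d. split; [apply cond_pos|]. intros s Hs. specialize (Hd s Hs).
    replace (f s - f t - l * (s - t)) with (f s - f t - (s - t) * l) by ring. exact Hd.
  - intros H. split.
    + apply is_linear_scal_l.
    + intros x Hx.
      assert (x = t) by (symmetry; now apply is_filter_lim_locally_unique).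
      subst x. intros eps. destruct (H eps (cond_pos eps)) as [d [Hd Hd']].
      exists (mkposreal d Hd). intros y Hy. specialize (Hd' y Hy).
      replace (f y - f t - l * (y - t)) with (f y - f t - (y - t) * l) in Hd' by ring.
      exact Hd'.
Qed.

Lemma im_le_Cmod (c : CC) : Rabs (Im c) <= Cmod c.
Proof. apply Rle_trans with (2 := Rmax_Cmod c). apply Rmax_r. Qed.

Lemma Cmod_le_sum (c : CC) : Cmod c <= Rabs (Re c) + Rabs (Im c).
Proof.
  destruct c as [x y]. simpl.
  replace (x, y) with (RtoC x + Ci * RtoC y)%C
    by (unfold RtoC, Ci, Cplus, Cmult; simpl; f_equal; ring).
  eapply Rle_trans; [apply Cmod_triangle|]. rewrite Cmod_mult, !Cmod_R, Cmod_Ci. lra.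
Qed.

Lemma Cmod_RtoC_sub (s t : R) : Cmod (RtoC s - RtoC t) = Rabs (s - t).
Proof. now rewrite <- RtoC_minus, Cmod_R. Qed.

Lemma rder_iff (f : R -> CC) (t : R) (v : CC) :
  rder f t v <-> is_derive (fun s => Re (f s)) t (Re v) /\ is_derive (fun s => Im (f s)) t (Im v).
Proof.
  rewrite !is_derive_eps. split.
  - intros H. split; intros eps He; destruct (H eps He) as [d [Hd H1]]; exists d;
      (split; [trivial|]); intros s Hs; specialize (H1 s); rewrite Cmod_RtoC_sub in H1;
      specialize (H1 Hs); apply Rle_trans with (2 := H1).
    + replace (Re (f s) - Re (f t) - Re v * (s - t))
        with (Re (f s - f t - v * (RtoC s - RtoC t))) by parts. apply re_le_Cmod.
    + replace (Im (f s) - Im (f t) - Im v * (s - t))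
        with (Im (f s - f t - v * (RtoC s - RtoC t))) by parts. apply im_le_Cmod.
  - intros [H1 H2] eps He.
    destruct (H1 (eps / 2)) as [d1 [Hd1 H1']]; [lra|].
    destruct (H2 (eps / 2)) as [d2 [Hd2 H2']]; [lra|].
    exists (Rmin d1 d2). split; [now apply Rmin_pos|]. intros s. rewrite Cmod_RtoC_sub. intros Hs.
    specialize (H1' s (Rlt_le_trans _ _ _ Hs (Rmin_l _ _))).
    specialize (H2' s (Rlt_le_trans _ _ _ Hs (Rmin_r _ _))).
    eapply Rle_trans; [apply Cmod_le_sum|].
    replace (Re (f s - f t - v * (RtoC s - RtoC t)))
      with (Re (f s) - Re (f t) - Re v * (s - t)) by parts.
    replace (Im (f s - f t - v * (RtoC s - RtoC t)))
      with (Im (f s) - Im (f t) - Im v * (s - t)) by parts.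
    lra.
Qed.

Lemma continuous_eps (f : R -> R) (t : R) :
  continuous f t <-> forall eps, 0 < eps -> exists d, 0 < d /\ forall s, Rabs (s - t) < d ->
    Rabs (f s - f t) < eps.
Proof.
  unfold continuous. rewrite filterlim_locally. split.
  - intros H eps He. destruct (H (mkposreal eps He)) as [d Hd].
    exists d. split; [apply cond_pos|]. intros s Hs. apply (Hd s Hs).
  - intros H eps. destruct (H eps (cond_pos eps)) as [d [Hd H1]].
    exists (mkposreal d Hd). intros s Hs. apply (H1 s Hs).
Qed.

Lemma rcont_iff (f : R -> CC) (t : R) :
  rcont f t <-> continuous (fun s => Re (f s)) t /\ continuous (fun s => Im (f s)) t.
Proof.
  rewrite !continuous_eps. split.
  - intros H. split; intros eps He; destruct (H eps He) as [d [Hd H1]]; exists d;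
      (split; [trivial|]); intros s Hs; specialize (H1 s); rewrite Cmod_RtoC_sub in H1;
      specialize (H1 Hs); apply Rle_lt_trans with (2 := H1).
    + apply (re_le_Cmod (f s - f t)).
    + apply (im_le_Cmod (f s - f t)).
  - intros [H1 H2] eps He.
    destruct (H1 (eps / 2)) as [d1 [Hd1 H1']]; [lra|].
    destruct (H2 (eps / 2)) as [d2 [Hd2 H2']]; [lra|].
    exists (Rmin d1 d2). split; [now apply Rmin_pos|]. intros s. rewrite Cmod_RtoC_sub. intros Hs.
    specialize (H1' s (Rlt_le_trans _ _ _ Hs (Rmin_l _ _))).
    specialize (H2' s (Rlt_le_trans _ _ _ Hs (Rmin_r _ _))).
    eapply Rle_lt_trans; [apply Cmod_le_sum|].
    change (Re (f s - f t)) with (Re (f s) - Re (f t)).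
    change (Im (f s - f t)) with (Im (f s) - Im (f t)). lra.
Qed.

Definition icont (f : R -> CC) (a b : R) : Prop :=
  forall t, Rmin a b <= t <= Rmax a b -> rcont f t.

Lemma icont_Re f a b : icont f a b -> ex_RInt (fun t => Re (f t)) a b.
Proof.
  intros H. apply (ex_RInt_continuous (V := R_CompleteNormedModule)).
  intros t Ht. now apply rcont_iff, H.
Qed.

Lemma icont_Im f a b : icont f a b -> ex_RInt (fun t => Im (f t)) a b.
Proof.
  intros H. apply (ex_RInt_continuous (V := R_CompleteNormedModule)).
  intros t Ht. now apply rcont_iff, H.
Qed.

Lemma RIntC_ext f g a b :
  (forall t, Rmin a b < t < Rmax a b -> f t = g t) -> RIntC f a b = RIntC g a b.
Proof. intros H. unfold RIntC. f_equal; apply RInt_ext; intros t Ht; now rewrite H. Qed.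

Lemma RIntC_plus f g a b : icont f a b -> icont g a b ->
  RIntC (fun t => f t + g t)%C a b = (RIntC f a b + RIntC g a b)%C.
Proof.
  intros Hf Hg. unfold RIntC, Cplus. simpl. f_equal.
  - apply (RInt_plus (V := R_CompleteNormedModule)); now apply icont_Re.
  - apply (RInt_plus (V := R_CompleteNormedModule)); now apply icont_Im.
Qed.

Lemma RIntC_scal c f a b : icont f a b ->
  RIntC (fun t => c * f t)%C a b = (c * RIntC f a b)%C.
Proof.
  intros Hf. pose proof (icont_Re _ _ _ Hf) as H1. pose proof (icont_Im _ _ _ Hf) as H2.
  pose proof (RInt_correct (V := R_CompleteNormedModule) _ _ _ H1) as I1.
  pose proof (RInt_correct (V := R_CompleteNormedModule) _ _ _ H2) as I2.
  unfold RIntC, Cmult. simpl. f_equal; apply is_RInt_unique.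
  - apply (is_RInt_minus (V := R_NormedModule) (fun t => fst c * fst (f t)) (fun t => snd c * snd (f t)));
      now apply (is_RInt_scal (V := R_NormedModule)).
  - apply (is_RInt_plus (V := R_NormedModule) (fun t => fst c * snd (f t)) (fun t => snd c * fst (f t)));
      now apply (is_RInt_scal (V := R_NormedModule)).
Qed.

Lemma RIntC_minus f g a b : icont f a b -> icont g a b ->
  RIntC (fun t => f t - g t)%C a b = (RIntC f a b - RIntC g a b)%C.
Proof.
  intros Hf Hg. unfold RIntC, Cminus, Cplus, Copp. simpl. f_equal.
  - apply (RInt_minus (V := R_CompleteNormedModule)); now apply icont_Re.
  - apply (RInt_minus (V := R_CompleteNormedModule)); now apply icont_Im.
Qed.

Lemma RIntC_Chasles f a b c : icont f a b -> icont f b c ->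
  RIntC f a c = (RIntC f a b + RIntC f b c)%C.
Proof.
  intros H1 H2. unfold RIntC, Cplus. simpl. f_equal; symmetry.
  - apply (RInt_Chasles (V := R_CompleteNormedModule)); now apply icont_Re.
  - apply (RInt_Chasles (V := R_CompleteNormedModule)); now apply icont_Im.
Qed.

Lemma RIntC_const c a b : RIntC (fun _ => c) a b = (RtoC (b - a) * c)%C.
Proof.
  unfold RIntC. rewrite !RInt_const. unfold scal, mult, RtoC, Cmult. simpl.
  unfold mult. simpl. destruct c; simpl. f_equal; ring.
Qed.

Lemma RIntC_bound f a b M : a <= b -> icont f a b ->
  (forall t, a <= t <= b -> Cmod (f t) <= M) -> Cmod (RIntC f a b) <= M * (b - a).
Proof.
  intros Hab Hf HM. rewrite Cmod_norm, Rmult_comm.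
  apply (norm_RInt_le_const (V := C_R_NormedModule) f a b); trivial.
  - intros t Ht. rewrite <- Cmod_norm. now apply HM.
  - apply (is_RInt_fct_extend_pair (U := R_NormedModule) (V := R_NormedModule));
      apply (RInt_correct (V := R_CompleteNormedModule)).
    + now apply icont_Re.
    + now apply icont_Im.
Qed.

Lemma RIntC_FTC F f a b :
  (forall t, Rmin a b <= t <= Rmax a b -> rder F t (f t)) -> icont f a b ->
  RIntC f a b = (F b - F a)%C.
Proof.
  intros HF Hf. unfold RIntC.
  replace (F b - F a)%C with (Re (F b) - Re (F a), Im (F b) - Im (F a)) by reflexivity.
  f_equal; apply is_RInt_unique.
  - apply (is_RInt_derive (V := R_CompleteNormedModule) (fun t => Re (F t)) (fun t => Re (f t))); intros t Ht.
    + now apply rder_iff, HF.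
    + now apply rcont_iff, Hf.
  - apply (is_RInt_derive (V := R_CompleteNormedModule) (fun t => Im (F t)) (fun t => Im (f t))); intros t Ht.
    + now apply rder_iff, HF.
    + now apply rcont_iff, Hf.
Qed.

Lemma icont_global f a b : (forall t, rcont f t) -> icont f a b.
Proof. intros H t _. apply H. Qed.

(** Complex values admit no mean value equality. Multiplied by the conjugate [c] of the increment,
    the increment becomes its squared modulus, so the real theorem for the real part of [c * F]
    gives the inequality. *)
Lemma rder_mvt F f a b M : a <= b ->
  (forall t, a <= t <= b -> rder F t (f t)) ->
  (forall t, a <= t <= b -> Cmod (f t) <= M) -> Cmod (F b - F a) <= M * (b - a).
Proof.
  intros Hab HF HM.
  set (c := Cconj (F b - F a)).
  destruct (Req_dec (Cmod (F b - F a)) 0) as [E|E].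
  { rewrite E. apply Rmult_le_pos; [|lra].
    apply Rle_trans with (Cmod (f a)); [apply Cmod_ge_0|apply HM; lra]. }
  pose proof (Cmod_ge_0 (F b - F a)) as P.
  assert (HD : forall t, a <= t <= b -> is_derive (fun s => Re (c * F s)) t (Re (c * f t))).
  { intros t Ht. apply (rder_iff (fun s => c * F s)%C t (c * f t)%C).
    eapply der_eq; [|apply (der_mult RtoC (fun _ => c) F); [apply der_const|now apply HF]].
    cbv beta. ring. }
  destruct (MVT_gen (fun s => Re (c * F s)) a b (fun t => Re (c * f t))) as [t [Ht Eq]].
  - intros t Ht. rewrite Rmin_left, Rmax_right in Ht by lra. apply HD. lra.
  - intros t Ht. rewrite Rmin_left, Rmax_right in Ht by lra.
    apply continuity_pt_filterlim, (ex_derive_continuous (V := R_NormedModule)).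
    eexists. apply HD. lra.
  - rewrite Rmin_left, Rmax_right in Ht by lra.
    assert (E1 : Re (c * F b) - Re (c * F a) = Cmod (F b - F a) * Cmod (F b - F a)).
    { replace (Re (c * F b) - Re (c * F a)) with (Re (c * (F b - F a))) by parts.
      unfold c. rewrite Cmult_comm, <- Cmod2_conj. unfold RtoC. simpl. ring. }
    apply Rmult_le_reg_l with (Cmod (F b - F a)); [lra|].
    rewrite <- E1, Eq, <- Rmult_assoc. apply Rmult_le_compat_r; [lra|].
    apply Rle_trans with (Cmod (c * f t)).
    + apply Rle_trans with (2 := re_le_Cmod _). apply Rle_abs.
    + rewrite Cmod_mult. unfold c. rewrite Cmod_conj. apply Rmult_le_compat_l; trivial.
      now apply HM.
Qed.

Lemma Re_near (X : R) (u w : CC) : Cmod (u - w) < X - Re w -> Re u < X.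
Proof.
  intros Hu. pose proof (re_le_Cmod (u - w)) as L. pose proof (Rle_abs (Re (u - w))) as L'.
  replace (Re (u - w)) with (Re u - Re w) in * by parts. lra.
Qed.

(** * Goursat's lemma *)

(** Goursat's bisection as an induction principle on rectangles. If the conclusion failed, some
    quarter would fail at every stage, and the nested bad rectangles would shrink to a point
    [(u, v)], around which [P] holds for small rectangles. *)
Lemma bisection_induction (P : R -> R -> R -> R -> Prop) (s0 s1 t0 t1 : R) :
  s0 <= s1 -> t0 <= t1 ->
  (forall s s' t t', s0 <= s <= s' -> s' <= s1 -> t0 <= t <= t' -> t' <= t1 ->
     P s ((s + s') / 2) t ((t + t') / 2) -> P ((s + s') / 2) s' t ((t + t') / 2) ->
     P s ((s + s') / 2) ((t + t') / 2) t' -> P ((s + s') / 2) s' ((t + t') / 2) t' ->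
     P s s' t t') ->
  (forall u v, s0 <= u <= s1 -> t0 <= v <= t1 -> exists d, 0 < d /\
     forall s s' t t', s0 <= s <= u -> u <= s' <= s1 -> t0 <= t <= v -> v <= t' <= t1 ->
     s' - s < d -> t' - t < d -> P s s' t t') ->
  P s0 s1 t0 t1.
Proof.
  intros Hs Ht Hstep Hloc. apply NNPP. intros HnP.
  set (Q := fun r : R * R * (R * R) => P (fst (fst r)) (snd (fst r)) (fst (snd r)) (snd (snd r))).
  set (good := fun r : R * R * (R * R) =>
    s0 <= fst (fst r) <= snd (fst r) /\ snd (fst r) <= s1 /\
    t0 <= fst (snd r) <= snd (snd r) /\ snd (snd r) <= t1).
  set (child := fun r r' : R * R * (R * R) =>
    fst (fst r) <= fst (fst r') /\ snd (fst r') <= snd (fst r) /\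
    fst (snd r) <= fst (snd r') /\ snd (snd r') <= snd (snd r) /\
    snd (fst r') - fst (fst r') = (snd (fst r) - fst (fst r)) / 2 /\
    snd (snd r') - fst (snd r') = (snd (snd r) - fst (snd r)) / 2).
  (* Stated as an implication under the existential, so that choice yields a total function [next]
     on all rectangles. *)
  assert (Hex : forall r, exists r', good r /\ ~ Q r -> good r' /\ ~ Q r' /\ child r r').
  { intros [[s s'] [t t']].
    destruct (excluded_middle_informative (good (s, s', (t, t')) /\ ~ Q (s, s', (t, t'))))
      as [[Hg HQ]|Hn].
    2: { exists (s, s', (t, t')). tauto. }
    unfold good, child, Q in *. simpl in *.
    set (sm := (s + s') / 2) in *. set (tm := (t + t') / 2) in *.
    destruct (excluded_middle_informative (P s sm t tm)) as [P1|P1].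
    2: { exists (s, sm, (t, tm)). intros _. simpl. repeat split; trivial; unfold sm, tm; lra. }
    destruct (excluded_middle_informative (P sm s' t tm)) as [P2|P2].
    2: { exists (sm, s', (t, tm)). intros _. simpl. repeat split; trivial; unfold sm, tm; lra. }
    destruct (excluded_middle_informative (P s sm tm t')) as [P3|P3].
    2: { exists (s, sm, (tm, t')). intros _. simpl. repeat split; trivial; unfold sm, tm; lra. }
    destruct (excluded_middle_informative (P sm s' tm t')) as [P4|P4].
    2: { exists (sm, s', (tm, t')). intros _. simpl. repeat split; trivial; unfold sm, tm; lra. }
    exfalso. apply HQ. apply Hstep; trivial; lra. }
  set (next := fun r => proj1_sig (constructive_indefinite_description _ (Hex r))).
  assert (Hnext : forall r, good r /\ ~ Q r -> good (next r) /\ ~ Q (next r) /\ child r (next r))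
    by (intros r; exact (proj2_sig (constructive_indefinite_description _ (Hex r)))).
  set (sq := fix sq n := match n with O => (s0, s1, (t0, t1)) | S n => next (sq n) end).
  assert (Hsq : forall n, good (sq n) /\ ~ Q (sq n)).
  { induction n as [|n IH].
    - split; [unfold good; simpl; lra|exact HnP].
    - simpl. specialize (Hnext _ IH). tauto. }
  assert (Hch : forall n, child (sq n) (sq (S n))).
  { intros n. apply (Hnext _ (Hsq n)). }
  assert (Hmon : forall n k, fst (fst (sq n)) <= fst (fst (sq (k + n)%nat)) /\
    snd (fst (sq (k + n)%nat)) <= snd (fst (sq n)) /\
    fst (snd (sq n)) <= fst (snd (sq (k + n)%nat)) /\
    snd (snd (sq (k + n)%nat)) <= snd (snd (sq n))).
  { intros n k. induction k as [|k IH]; [simpl; lra|].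
    destruct (Hch (k + n)%nat) as (A1 & A2 & A3 & A4 & _). change (S k + n)%nat with (S (k + n)). lra. }
  assert (Hcross : forall n k, fst (fst (sq n)) <= snd (fst (sq k)) /\
    fst (snd (sq n)) <= snd (snd (sq k))).
  { intros n k. destruct (Hmon n k) as (A1 & _ & A3 & _). destruct (Hmon k n) as (_ & A2 & _ & A4).
    rewrite Nat.add_comm in A1, A3. destruct (Hsq (n + k)%nat) as [[G1 [G2 [G3 G4]]] _]. lra. }
  destruct (completeness (fun x => exists n, x = fst (fst (sq n)))) as [u [Hu1 Hu2]].
  { exists s1. intros x [n ->]. destruct (Hsq n) as [[G1 [G2 G3]] _]. lra. }
  { exists s0, 0%nat. reflexivity. }
  destruct (completeness (fun x => exists n, x = fst (snd (sq n)))) as [v [Hv1 Hv2]].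
  { exists t1. intros x [n ->]. destruct (Hsq n) as [[G1 [G2 G3]] _]. lra. }
  { exists t0, 0%nat. reflexivity. }
  assert (Bu : forall n, fst (fst (sq n)) <= u <= snd (fst (sq n))).
  { intros n. split; [apply Hu1; now exists n|]. apply Hu2. intros x [k ->]. apply Hcross. }
  assert (Bv : forall n, fst (snd (sq n)) <= v <= snd (snd (sq n))).
  { intros n. split; [apply Hv1; now exists n|]. apply Hv2. intros x [k ->]. apply Hcross. }
  destruct (Hloc u v (Bu 0%nat) (Bv 0%nat)) as [d [Hd HP]].
  assert (Hsize : forall n, snd (fst (sq n)) - fst (fst (sq n)) = (s1 - s0) * (/ 2) ^ n /\
    snd (snd (sq n)) - fst (snd (sq n)) = (t1 - t0) * (/ 2) ^ n).
  { induction n as [|n IH]; [simpl; lra|].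
    destruct (Hch n) as (_ & _ & _ & _ & A5 & A6). rewrite A5, A6. simpl pow. lra. }
  (* The summand 1 keeps the divisor positive when the rectangle is degenerate. *)
  destruct (pow_lt_1_zero (/ 2)) with (y := d / (s1 - s0 + (t1 - t0) + 1)) as [N HN].
  { rewrite Rabs_pos_eq; lra. }
  { apply Rdiv_lt_0_compat; lra. }
  specialize (HN N (Nat.le_refl N)). rewrite Rabs_pos_eq in HN by (apply pow_le; lra).
  assert (HN' : (s1 - s0 + (t1 - t0) + 1) * (/ 2) ^ N < d).
  { replace d with ((s1 - s0 + (t1 - t0) + 1) * (d / (s1 - s0 + (t1 - t0) + 1))) by (field; lra).
    apply Rmult_lt_compat_l; lra. }
  assert (Hp : 0 < (/ 2) ^ N) by (apply pow_lt; lra).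
  destruct (Hsq N) as [G HQ]. apply HQ. destruct (Hsize N) as [Z1 Z2].
  specialize (Bu N). specialize (Bv N). unfold good in G. unfold Q.
  assert ((s1 - s0) * (/ 2) ^ N <= (s1 - s0 + (t1 - t0) + 1) * (/ 2) ^ N)
    by (apply Rmult_le_compat_r; lra).
  assert ((t1 - t0) * (/ 2) ^ N <= (s1 - s0 + (t1 - t0) + 1) * (/ 2) ^ N)
    by (apply Rmult_le_compat_r; lra).
  apply HP; lra.
Qed.

(** The integral of q dw along the image under [G] of the counterclockwise boundary of a rectangle;
    [Gs] and [Gt] stand for the partial derivatives of [G]. Working with a map [G] lets one theorem
    serve both for deforming circles and for rectangles in the w-plane. *)
Definition loop_int (q : CC -> CC) (G Gs Gt : R -> R -> CC) (s s' t t' : R) : CC :=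
  (RIntC (fun x => q (G x t) * Gs x t) s s' + RIntC (fun y => q (G s' y) * Gt s' y) t t'
   - RIntC (fun x => q (G x t') * Gs x t') s s' - RIntC (fun y => q (G s y) * Gt s y) t t')%C.

Section Goursat.
Context (q : CC -> CC) (G Gs Gt : R -> R -> CC) (K s0 s1 t0 t1 : R).
Hypothesis Hs01 : s0 <= s1.
Hypothesis Ht01 : t0 <= t1.
Hypothesis HGs : forall s t, rder (fun x => G x t) s (Gs s t).
Hypothesis HGt : forall s t, rder (fun y => G s y) t (Gt s t).
Hypothesis HCs : forall s t, rcont (fun x => Gs x t) s.
Hypothesis HCt : forall s t, rcont (fun y => Gt s y) t.
Hypothesis HKs : forall s t, s0 <= s <= s1 -> t0 <= t <= t1 -> Cmod (Gs s t) <= K.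
Hypothesis HKt : forall s t, s0 <= s <= s1 -> t0 <= t <= t1 -> Cmod (Gt s t) <= K.

Lemma icont_s (p : CC -> CC) s s' t : s0 <= s <= s' -> s' <= s1 -> t0 <= t <= t1 ->
  (forall s t, s0 <= s <= s1 -> t0 <= t <= t1 -> ccont p (G s t)) ->
  icont (fun x => p (G x t) * Gs x t)%C s s'.
Proof.
  intros H1 H2 H3 Hp x Hx. rewrite Rmin_left, Rmax_right in Hx by lra.
  apply ctn_mult; [|apply HCs]. apply (ctn_comp RtoC p (fun x => G x t)).
  - apply Hp; lra.
  - eapply der_ctn, HGs.
Qed.

Lemma icont_t (p : CC -> CC) s t t' : s0 <= s <= s1 -> t0 <= t <= t' -> t' <= t1 ->
  (forall s t, s0 <= s <= s1 -> t0 <= t <= t1 -> ccont p (G s t)) ->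
  icont (fun y => p (G s y) * Gt s y)%C t t'.
Proof.
  intros H1 H2 H3 Hp x Hx. rewrite Rmin_left, Rmax_right in Hx by lra.
  apply ctn_mult; [|apply HCt]. apply (ctn_comp RtoC p (fun y => G s y)).
  - apply Hp; lra.
  - eapply der_ctn, HGt.
Qed.

Lemma loop_int_quarters s s' t t' :
  (forall s t, s0 <= s <= s1 -> t0 <= t <= t1 -> ccont q (G s t)) ->
  s0 <= s <= s' -> s' <= s1 -> t0 <= t <= t' -> t' <= t1 ->
  let sm := (s + s') / 2 in let tm := (t + t') / 2 in
  (loop_int q G Gs Gt s s' t t' =
   loop_int q G Gs Gt s sm t tm + loop_int q G Gs Gt sm s' t tm +
   loop_int q G Gs Gt s sm tm t' + loop_int q G Gs Gt sm s' tm t')%C.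
Proof.
  intros Hq H1 H2 H3 H4 sm tm.
  assert (s <= sm <= s') by (unfold sm; lra). assert (t <= tm <= t') by (unfold tm; lra).
  unfold loop_int.
  assert (E : forall y, t0 <= y <= t1 ->
    (RIntC (fun x => q (G x y) * Gs x y) s s' = RIntC (fun x => q (G x y) * Gs x y) s sm +
     RIntC (fun x => q (G x y) * Gs x y) sm s')%C).
  { intros y Hy. apply RIntC_Chasles; apply icont_s; trivial; lra. }
  assert (E' : forall x, s0 <= x <= s1 ->
    (RIntC (fun y => q (G x y) * Gt x y) t t' = RIntC (fun y => q (G x y) * Gt x y) t tm +
     RIntC (fun y => q (G x y) * Gt x y) tm t')%C).
  { intros x Hx. apply RIntC_Chasles; apply icont_t; trivial; lra. }
  rewrite !E, !E' by lra. ring.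
Qed.

Lemma homotopy_lipschitz u v s t :
  s0 <= u <= s1 -> s0 <= s <= s1 -> t0 <= v <= t1 -> t0 <= t <= t1 ->
  Cmod (G s t - G u v) <= K * (Rabs (s - u) + Rabs (t - v)).
Proof.
  intros Hu Hs Hv Ht.
  replace (G s t - G u v)%C with ((G s t - G u t) + (G u t - G u v))%C by ring.
  eapply Rle_trans; [apply Cmod_triangle|]. rewrite Rmult_plus_distr_l.
  apply Rplus_le_compat.
  - destruct (Rle_dec u s).
    + rewrite Rabs_pos_eq by lra. apply (rder_mvt (fun x => G x t) (fun x => Gs x t)); trivial.
      intros x Hx. apply HKs; lra.
    + rewrite Rabs_left1, Cmod_sym by lra. replace (- (s - u)) with (u - s) by ring.
      apply (rder_mvt (fun x => G x t) (fun x => Gs x t)); [lra|trivial|].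
      intros x Hx. apply HKs; lra.
  - destruct (Rle_dec v t).
    + rewrite Rabs_pos_eq by lra. apply (rder_mvt (fun y => G u y) (fun y => Gt u y)); trivial.
      intros x Hx. apply HKt; lra.
    + rewrite Rabs_left1, Cmod_sym by lra. replace (- (t - v)) with (v - t) by ring.
      apply (rder_mvt (fun y => G u y) (fun y => Gt u y)); [lra|trivial|].
      intros x Hx. apply HKt; lra.
Qed.

(** An affine map has the polynomial primitive [F]; each side contributes a difference of values of
    [F] at the corners, and these cancel. *)
Lemma loop_int_affine (q0 q1 z : CC) s s' t t' :
  s0 <= s <= s' -> s' <= s1 -> t0 <= t <= t' -> t' <= t1 ->
  loop_int (fun w => q0 + q1 * (w - z))%C G Gs Gt s s' t t' = 0%C.
Proof.
  intros H1 H2 H3 H4.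
  set (F := fun w : CC => (q0 * w + q1 * ((w - z) * (w - z)) / 2)%C).
  assert (HF : forall w, cder F w (q0 + q1 * (w - z))%C).
  { intros w. unfold F. eapply der_eq; [|apply der_plus].
    2: apply (der_mult idC (fun _ => q0) idC); [apply der_const|apply der_self].
    2: apply (der_mult idC (fun w => q1 * ((w - z) * (w - z)))%C (fun _ => / 2)%C);
       [apply (der_mult idC (fun _ => q1) (fun w => (w - z) * (w - z))%C);
        [apply der_const|apply der_mult; apply (der_minus idC idC (fun _ => z)); [apply der_self|apply der_const| apply der_self|apply der_const]]|apply der_const].
    unfold idC. field. }
  assert (Hc : forall s t, s0 <= s <= s1 -> t0 <= t <= t1 -> ccont (fun w => q0 + q1 * (w - z))%C (G s t)).
  { intros. apply ctn_plus; [apply ctn_const|]. apply ctn_mult; [apply ctn_const|].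
    apply (ctn_minus idC idC); [apply ctn_self|apply ctn_const]. }
  assert (I1 : forall y, t0 <= y <= t1 ->
    RIntC (fun x => (q0 + q1 * (G x y - z)) * Gs x y)%C s s' = (F (G s' y) - F (G s y))%C).
  { intros y Hy. apply (RIntC_FTC (fun x => F (G x y))).
    - intros x Hx. apply (der_comp RtoC F (fun x => G x y)); [apply HF|apply HGs].
    - apply (icont_s (fun w => q0 + q1 * (w - z))%C); trivial. }
  assert (I2 : forall x, s0 <= x <= s1 ->
    RIntC (fun y => (q0 + q1 * (G x y - z)) * Gt x y)%C t t' = (F (G x t') - F (G x t))%C).
  { intros x Hx. apply (RIntC_FTC (fun y => F (G x y))).
    - intros y Hy. apply (der_comp RtoC F (fun y => G x y)); [apply HF|apply HGt].
    - apply (icont_t (fun w => q0 + q1 * (w - z))%C); trivial. }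
  unfold loop_int. rewrite !I1, !I2 by lra. ring.
Qed.

Hypothesis Hq : forall s t, s0 <= s <= s1 -> t0 <= t <= t1 -> exists l, cder q (G s t) l.

Lemma holo_cont_homotopy : forall s t, s0 <= s <= s1 -> t0 <= t <= t1 -> ccont q (G s t).
Proof. intros s t H1 H2. destruct (Hq s t H1 H2) as [l Hl]. eapply der_ctn, Hl. Qed.

(** Near [G u v] replace [q] by its first-order approximation [A], whose loop integral is zero. The
    remaining error is small relative to the distance from [G u v], and both that distance and the
    length of the loop are of the order of the size of the rectangle. *)
Lemma loop_int_local e u v : 0 < e -> s0 <= u <= s1 -> t0 <= v <= t1 ->
  exists d, 0 < d /\ forall s s' t t',
    s0 <= s <= u -> u <= s' <= s1 -> t0 <= t <= v -> v <= t' <= t1 -> s' - s < d -> t' - t < d ->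
    Cmod (loop_int q G Gs Gt s s' t t') <= e * (s' - s + (t' - t)) ^ 2.
Proof.
  intros He Hu Hv.
  assert (HK0 : 0 <= K) by (apply Rle_trans with (2 := HKs u v Hu Hv), Cmod_ge_0).
  destruct (Hq u v Hu Hv) as [l Hl].
  (* One factor [K + 1] bounds distances in the image, the other the speed of the sides, and 2
     accounts for the perimeter [2 * D]. *)
  set (e' := e / (2 * (K + 1) * (K + 1))).
  assert (He' : 0 < e') by (apply Rdiv_lt_0_compat; [|repeat apply Rmult_lt_0_compat]; lra).
  destruct (Hl e' He') as [d [Hd H]]. unfold idC in H.
  exists (d / (2 * (K + 1))). split; [apply Rdiv_lt_0_compat; lra|].
  intros s s' t t' H1 H2 H3 H4 H5 H6.
  set (A := fun w => (q (G u v) + l * (w - G u v))%C).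
  assert (HcA : forall s t, s0 <= s <= s1 -> t0 <= t <= t1 -> ccont A (G s t)).
  { intros. apply ctn_plus; [apply ctn_const|]. apply ctn_mult; [apply ctn_const|].
    apply (ctn_minus idC idC); [apply ctn_self|apply ctn_const]. }
  set (D := s' - s + (t' - t)) in *.
  assert (HDd : (K + 1) * D < d).
  { assert (E : (K + 1) * (d / (2 * (K + 1)) + d / (2 * (K + 1))) = d) by (field; lra).
    rewrite <- E. apply Rmult_lt_compat_l; unfold D; lra. }
  assert (Hpt : forall x y, s <= x <= s' -> t <= y <= t' ->
    Cmod (q (G x y) - A (G x y)) <= e' * ((K + 1) * D)).
  { intros x y Hx Hy.
    assert (HL : Cmod (G x y - G u v) <= (K + 1) * D).
    { eapply Rle_trans; [apply homotopy_lipschitz; lra|].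
      apply Rmult_le_compat; try lra.
      - pose proof (Rabs_pos (x - u)). pose proof (Rabs_pos (y - v)). lra.
      - unfold D. assert (Rabs (x - u) <= s' - s) by (apply Rabs_le; lra).
        assert (Rabs (y - v) <= t' - t) by (apply Rabs_le; lra). lra. }
    unfold A. replace (q (G x y) - (q (G u v) + l * (G x y - G u v)))%C
      with (q (G x y) - q (G u v) - l * (G x y - G u v))%C by ring.
    eapply Rle_trans; [apply H; lra|]. apply Rmult_le_compat_l; lra. }
  assert (HD0 : 0 <= D) by (unfold D; lra).
  assert (Side : forall (gm gv : R -> CC) lo hi, lo <= hi ->
    icont (fun x => q (gm x) * gv x)%C lo hi -> icont (fun x => A (gm x) * gv x)%C lo hi ->
    (forall x, lo <= x <= hi -> Cmod (q (gm x) - A (gm x)) <= e' * ((K + 1) * D) /\ Cmod (gv x) <= K) ->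
    Cmod (RIntC (fun x => q (gm x) * gv x)%C lo hi - RIntC (fun x => A (gm x) * gv x)%C lo hi)
    <= e' * ((K + 1) * D) * (K + 1) * (hi - lo)).
  { intros gm gv lo hi Hle Iq IA Hb. rewrite <- RIntC_minus by trivial.
    apply RIntC_bound; trivial.
    - intros x Hx. apply ctn_minus; auto.
    - intros x Hx. destruct (Hb x Hx) as [Hb1 Hb2].
      replace (q (gm x) * gv x - A (gm x) * gv x)%C with ((q (gm x) - A (gm x)) * gv x)%C by ring.
      rewrite Cmod_mult. apply Rmult_le_compat; try apply Cmod_ge_0; lra. }
  pose proof holo_cont_homotopy as Hcq.
  assert (IS : forall y, t <= y <= t' ->
    Cmod (RIntC (fun x => q (G x y) * Gs x y)%C s s' - RIntC (fun x => A (G x y) * Gs x y)%C s s')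
    <= e' * ((K + 1) * D) * (K + 1) * (s' - s)).
  { intros y Hy. apply (Side (fun x => G x y) (fun x => Gs x y)); [lra| | |].
    - apply icont_s; trivial; lra.
    - apply (icont_s A); trivial; lra.
    - intros x Hx. split; [apply Hpt|apply HKs]; lra. }
  assert (IT : forall x, s <= x <= s' ->
    Cmod (RIntC (fun y => q (G x y) * Gt x y)%C t t' - RIntC (fun y => A (G x y) * Gt x y)%C t t')
    <= e' * ((K + 1) * D) * (K + 1) * (t' - t)).
  { intros x Hx. apply (Side (fun y => G x y) (fun y => Gt x y)); [lra| | |].
    - apply icont_t; trivial; lra.
    - apply (icont_t A); trivial; lra.
    - intros y Hy. split; [apply Hpt|apply HKt]; lra. }
  assert (HA : loop_int A G Gs Gt s s' t t' = 0%C) by (apply loop_int_affine; lra).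
  replace (loop_int q G Gs Gt s s' t t')
    with (loop_int q G Gs Gt s s' t t' - loop_int A G Gs Gt s s' t t')%C by (rewrite HA; ring).
  unfold loop_int.
  pose proof (IS t ltac:(lra)) as B1. pose proof (IS t' ltac:(lra)) as B2.
  pose proof (IT s ltac:(lra)) as B3. pose proof (IT s' ltac:(lra)) as B4.
  match goal with |- Cmod (?a1 + ?a2 - ?a3 - ?a4 - (?b1 + ?b2 - ?b3 - ?b4)) <= _ =>
    replace (a1 + a2 - a3 - a4 - (b1 + b2 - b3 - b4))%C
      with ((a1 - b1) + (a2 - b2) - (a3 - b3) - (a4 - b4))%C by ring;
    set (c1 := (a1 - b1)%C) in *; set (c2 := (a2 - b2)%C) in *;
    set (c3 := (a3 - b3)%C) in *; set (c4 := (a4 - b4)%C) in * end.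
  pose proof (Cmod_tri_sub (c1 + c2 - c3) c4). pose proof (Cmod_tri_sub (c1 + c2) c3).
  pose proof (Cmod_triangle c1 c2).
  apply Rle_trans with (2 * (e' * ((K + 1) * D) * (K + 1) * D)).
  - unfold D at 2. lra.
  - right. unfold e'. field. lra.
Qed.

(** The bound [e * (s' - s + (t' - t)) ^ 2] reproduces itself under quartering: each quarter has
    half the size, and four quarters of the square add up to the whole. Hence the bisection carries
    it from small rectangles to the full one, for every [e]. *)
Theorem goursat : loop_int q G Gs Gt s0 s1 t0 t1 = 0%C.
Proof.
  apply Cmod_eq_0, Rle_antisym; [|apply Cmod_ge_0].
  set (D := s1 - s0 + (t1 - t0)).
  assert (H : forall e, 0 < e -> Cmod (loop_int q G Gs Gt s0 s1 t0 t1) <= e * D ^ 2).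
  { intros e He.
    apply (bisection_induction (fun s s' t t' =>
      Cmod (loop_int q G Gs Gt s s' t t') <= e * (s' - s + (t' - t)) ^ 2)); trivial.
    - intros s s' t t' H1 H2 H3 H4 B1 B2 B3 B4.
      rewrite loop_int_quarters by (trivial; apply holo_cont_homotopy).
      eapply Rle_trans; [apply Cmod_triangle|].
      eapply Rle_trans; [apply Rplus_le_compat_r, Cmod_triangle|].
      eapply Rle_trans; [apply Rplus_le_compat_r, Rplus_le_compat_r, Cmod_triangle|].
      replace (e * (s' - s + (t' - t)) ^ 2) with
        (e * ((s + s') / 2 - s + ((t + t') / 2 - t)) ^ 2 + e * (s' - (s + s') / 2 + ((t + t') / 2 - t)) ^ 2
         + e * ((s + s') / 2 - s + (t' - (t + t') / 2)) ^ 2 + e * (s' - (s + s') / 2 + (t' - (t + t') / 2)) ^ 2)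
        by field.
      repeat apply Rplus_le_compat; trivial.
    - intros u v Hu Hv. apply loop_int_local; trivial. }
  apply Rnot_lt_le. intros Hpos.
  assert (HD : 0 <= D ^ 2) by apply pow2_ge_0.
  specialize (H (Cmod (loop_int q G Gs Gt s0 s1 t0 t1) / (2 * (D ^ 2 + 1)))).
  assert (P : 0 < Cmod (loop_int q G Gs Gt s0 s1 t0 t1) / (2 * (D ^ 2 + 1)))
    by (apply Rdiv_lt_0_compat; lra).
  specialize (H P).
  set (c := Cmod (loop_int q G Gs Gt s0 s1 t0 t1)) in *.
  assert (c / (2 * (D ^ 2 + 1)) * D ^ 2 <= c / (2 * (D ^ 2 + 1)) * (D ^ 2 + 1))
    by (apply Rmult_le_compat_l; lra).
  replace (c / (2 * (D ^ 2 + 1)) * (D ^ 2 + 1)) with (c / 2) in H0 by (field; lra). lra.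
Qed.

End Goursat.

(** * Cauchy's formula and orders of vanishing *)

Definition cis (t : R) : CC := (cos t, sin t).

Lemma cis_der t : rder cis t (Ci * cis t)%C.
Proof.
  apply rder_iff. unfold Re, Im, cis, Ci, Cmult. simpl. split.
  - replace (0 * cos t - 1 * sin t) with (- sin t) by ring. apply is_derive_cos.
  - replace (0 * sin t + 1 * cos t) with (cos t) by ring. apply is_derive_sin.
Qed.

Lemma cis_cont t : rcont cis t.
Proof. eapply der_ctn, cis_der. Qed.

Lemma Cmod_cis t : Cmod (cis t) = 1.
Proof.
  unfold Cmod, cis. simpl. rewrite !Rmult_1_r.
  replace (cos t * cos t + sin t * sin t) with (Rsqr (sin t) + Rsqr (cos t)) by (unfold Rsqr; ring).
  rewrite sin2_cos2. apply sqrt_1.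
Qed.

Lemma cis_2PI : cis (2 * PI) = cis 0.
Proof. unfold cis. now rewrite cos_2PI, sin_2PI, cos_0, sin_0. Qed.

Lemma Cmod_real_cis r t : 0 <= r -> Cmod (r * cis t) = r.
Proof. intros H. rewrite Cmod_mult, Cmod_R, Cmod_cis, Rabs_pos_eq; lra. Qed.

Lemma rcont_scal_cis (c : CC) t : rcont (fun t => c * cis t)%C t.
Proof. apply ctn_mult; [apply ctn_const|apply cis_cont]. Qed.

Lemma circle_sub_ge r t z : 0 <= r -> r - Cmod z <= Cmod (r * cis t - z).
Proof. intros H. rewrite <- (Cmod_real_cis r t H) at 1. apply Cmod_sub_ge. Qed.

Lemma circle_sub_neq0 r t z : Cmod z < r -> (r * cis t - z)%C <> 0%C.
Proof.
  intros H. pose proof (Cmod_ge_0 z). apply Cmod_neq0.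
  pose proof (circle_sub_ge r t z). lra.
Qed.

Lemma rcont_bounded (f : R -> CC) a b : a <= b -> icont f a b ->
  exists M, 0 < M /\ forall t, a <= t <= b -> Cmod (f t) <= M.
Proof.
  intros Hab Hf.
  destruct (continuity_ab_maj (fun t => Cmod (f t)) a b Hab) as [m [Hm _]].
  { intros t Ht. apply continuity_pt_filterlim, continuous_eps.
    intros eps He. destruct (Hf t) with (eps := eps) as [d [Hd H]]; trivial.
    { rewrite Rmin_left, Rmax_right; lra. }
    exists d. split; trivial. intros s Hs. rewrite <- Cmod_RtoC_sub in Hs. specialize (H s Hs).
    apply Rabs_lt_between. pose proof (Cmod_sub_ge (f s) (f t)).
    pose proof (Cmod_sub_ge (f t) (f s)). rewrite (Cmod_sym (f t)) in *. lra. }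
  exists (Cmod (f m) + 1). pose proof (Cmod_ge_0 (f m)). split; [lra|].
  intros t Ht. specialize (Hm t Ht). simpl in Hm. lra.
Qed.

Lemma C_eq_eps (x y : CC) K : 0 < K -> (forall e, 0 < e -> Cmod (x - y) <= e * K) -> x = y.
Proof.
  intros HK H. replace x with (x - y + y)%C by ring.
  replace (x - y)%C with (RtoC 0); [ring|]. symmetry. apply Cmod_eq_0.
  apply Rle_antisym; [|apply Cmod_ge_0]. apply Rnot_lt_le. intros Hp.
  specialize (H (Cmod (x - y) / (2 * K))).
  assert (P : 0 < Cmod (x - y) / (2 * K)) by (apply Rdiv_lt_0_compat; lra).
  specialize (H P). replace (Cmod (x - y) / (2 * K) * K) with (Cmod (x - y) / 2) in H by (field; lra).
  lra.
Qed.

Definition holo_on (r : R) (h : CC -> CC) : Prop :=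
  forall z, Cmod z < r -> exists l, cder h z l.

Lemma holo_on_cont r h z : holo_on r h -> Cmod z < r -> ccont h z.
Proof. intros H Hz. destruct (H z Hz) as [l Hl]. eapply der_ctn, Hl. Qed.

Lemma holo_on_le r r' h : r' <= r -> holo_on r h -> holo_on r' h.
Proof. intros Hr H z Hz. apply H. lra. Qed.

Lemma two_pi_pos : 0 < 2 * PI.
Proof. pose proof PI_RGT_0. lra. Qed.

(* The circle around [0] is deformed linearly into a small circle around [z], without crossing [z]. *)
Lemma circle_deformation (h : CC -> CC) r rho z eps :
  holo_on r h -> rho < r -> Cmod z < rho -> 0 < eps < rho - Cmod z ->
  RIntC (fun t => h (rho * cis t) * (rho * cis t) / (rho * cis t - z))%C 0 (2 * PI) =
  RIntC (fun t => h (z + eps * cis t))%C 0 (2 * PI).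
Proof.
  intros Hh Hr Hz Heps. pose proof (Cmod_ge_0 z) as Pz. pose proof two_pi_pos as P2.
  set (q := fun w => (h w / (w - z))%C).
  set (G := fun s t : R => ((1 - s) * (z + eps * cis t) + s * (rho * cis t))%C).
  set (Gs := fun s t : R => (rho * cis t - (z + eps * cis t))%C).
  set (Gt := fun s t : R => (((1 - s) * eps + s * rho) * (Ci * cis t))%C).
  assert (EG : forall s t, (G s t - z = (RtoC ((1 - s) * eps + s * rho)) * cis t - s * z)%C).
  { intros s t. unfold G. rewrite RtoC_plus, !RtoC_mult, RtoC_minus. ring. }
  (* By [EG] the point [G s t - z] lies within [s * Cmod z] of the circle of radius
     [(1 - s) * eps + s * rho] about 0, and this radius is the larger number. *)
  assert (HGz : forall s t, 0 <= s <= 1 -> (G s t - z)%C <> 0%C).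
  { intros s t Hs. rewrite EG. apply circle_sub_neq0. rewrite Cmod_mult, Cmod_R, Rabs_pos_eq by lra.
    apply Rle_lt_trans with (0 + s * Cmod z); [lra|].
    destruct (Req_dec s 0) as [->|]; [lra|].
    apply Rplus_le_lt_compat; [apply Rmult_le_pos; lra|apply Rmult_lt_compat_l; lra]. }
  assert (HGr : forall s t, 0 <= s <= 1 -> Cmod (G s t) < r).
  { intros s t Hs. unfold G. eapply Rle_lt_trans; [apply Cmod_triangle|].
    rewrite !Cmod_mult, <- RtoC_minus, !Cmod_R, Cmod_cis, !Rabs_pos_eq by lra.
    apply Rle_lt_trans with ((1 - s) * rho + s * rho); [|lra].
    apply Rplus_le_compat; [|lra]. apply Rmult_le_compat_l; [lra|].
    eapply Rle_trans; [apply Cmod_triangle|]. rewrite Cmod_real_cis by lra. lra. }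
  assert (L : loop_int q G Gs Gt 0 1 0 (2 * PI) = 0%C).
  { apply goursat with (K := rho + Cmod z + eps).
    - lra.
    - lra.
    - intros s t. unfold G, Gs. eapply der_eq; [|apply der_plus].
      2: apply der_mult; [apply der_minus; [apply der_const|apply der_self]|apply der_const].
      2: apply der_mult; [apply der_self|apply der_const].
      cbv beta; ring.
    - intros s t. unfold G, Gt. eapply der_eq; [|apply der_plus].
      2: apply der_mult; [apply der_const|apply der_plus; [apply der_const|apply der_mult; [apply der_const|apply cis_der]]].
      2: apply der_mult; [apply der_const|apply der_mult; [apply der_const|apply cis_der]].
      cbv beta; ring.
    - intros s t. apply (ctn_const RtoC (rho * cis t - (z + eps * cis t))%C).
    - intros s t. apply (ctn_mult RtoC (fun _ => (1 - s) * eps + s * rho)%C); [apply ctn_const|apply rcont_scal_cis].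
    - intros s t Hs Ht. unfold Gs. eapply Rle_trans; [apply Cmod_tri_sub|].
      rewrite Cmod_real_cis by lra.
      pose proof (Cmod_triangle z (eps * cis t)) as T. rewrite Cmod_real_cis in T by lra. lra.
    - intros s t Hs Ht. unfold Gt.
      replace ((1 - s) * eps + s * rho)%C with (RtoC ((1 - s) * eps + s * rho))
        by (rewrite RtoC_plus, !RtoC_mult, RtoC_minus; ring).
      rewrite !Cmod_mult, Cmod_Ci, Cmod_cis, Cmod_R, Rabs_pos_eq.
      2: apply Rplus_le_le_0_compat; apply Rmult_le_pos; lra.
      assert (0 <= s * eps) by (apply Rmult_le_pos; lra).
      assert (s * rho <= 1 * rho) by (apply Rmult_le_compat_r; lra). lra.
    - intros s t Hs Ht. destruct (Hh (G s t)) as [l Hl]; [now apply HGr|].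
      eexists. apply (der_div idC h (fun w => w - z)%C); [now apply HGz|exact Hl|].
      apply (der_minus idC idC (fun _ => z)); [apply der_self|apply der_const]. }
  unfold loop_int in L.
  (* All the intermediate curves are closed, so the sides at angles 0 and 2 pi coincide and drop out
     of the contour. *)
  assert (E1 : RIntC (fun x => q (G x (2 * PI)%R) * Gs x (2 * PI)%R)%C 0 1 =
               RIntC (fun x => q (G x 0) * Gs x 0)%C 0 1).
  { apply RIntC_ext. intros t _. unfold G, Gs. now rewrite cis_2PI. }
  rewrite E1 in L.
  assert (E2 : RIntC (fun y => q (G 1 y) * Gt 1 y)%C 0 (2 * PI) =
               RIntC (fun y => q (G 0 y) * Gt 0 y)%C 0 (2 * PI)).
  { match type of L with (?x + ?a - ?x - ?b)%C = _ =>
      replace a with (x + a - x - b + b)%C by ring; rewrite L; ring end. }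
  assert (C1 : icont (fun t => h (rho * cis t) * (rho * cis t) / (rho * cis t - z))%C 0 (2 * PI)).
  { apply icont_global. intros t. apply ctn_div.
    - now apply circle_sub_neq0.
    - apply ctn_mult; [|apply rcont_scal_cis].
      apply (ctn_comp RtoC h (fun t => rho * cis t)%C); [|apply rcont_scal_cis].
      apply (holo_on_cont r); trivial. rewrite Cmod_real_cis; lra.
    - apply ctn_minus; [apply rcont_scal_cis|apply ctn_const]. }
  assert (C2 : icont (fun t => h (z + eps * cis t))%C 0 (2 * PI)).
  { apply icont_global. intros t. apply (ctn_comp RtoC h (fun t => z + eps * cis t)%C).
    - apply (holo_on_cont r); trivial. eapply Rle_lt_trans; [apply Cmod_triangle|].
      rewrite Cmod_real_cis; lra.
    - apply ctn_plus; [apply ctn_const|apply rcont_scal_cis]. }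
  assert (E3 : RIntC (fun y => q (G 1 y) * Gt 1 y)%C 0 (2 * PI) = (Ci *
    RIntC (fun t => h (rho * cis t) * (rho * cis t) / (rho * cis t - z))%C 0 (2 * PI))%C).
  { rewrite <- RIntC_scal by trivial. apply RIntC_ext. intros t _.
    unfold q, Gt.
    replace (G 1 t) with (rho * cis t)%C by (unfold G; ring).
    field. now apply circle_sub_neq0. }
  assert (E4 : RIntC (fun y => q (G 0 y) * Gt 0 y)%C 0 (2 * PI) = (Ci *
    RIntC (fun t => h (z + eps * cis t))%C 0 (2 * PI))%C).
  { rewrite <- RIntC_scal by trivial. apply RIntC_ext. intros t _.
    unfold q, Gt.
    replace (G 0 t) with (z + eps * cis t)%C by (unfold G; ring).
    field. replace (z + eps * cis t - z)%C with (eps * cis t)%C by ring.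
    apply Cmod_neq0. rewrite Cmod_real_cis; lra. }
  rewrite E3, E4 in E2.
  apply (f_equal (Cmult (- Ci))) in E2.
  match type of E2 with (- Ci * (Ci * ?a) = - Ci * (Ci * ?b))%C =>
    replace (- Ci * (Ci * a))%C with (- (Ci * Ci) * a)%C in E2 by ring;
    replace (- Ci * (Ci * b))%C with (- (Ci * Ci) * b)%C in E2 by ring end.
  replace (Ci * Ci)%C with (- RtoC 1)%C in E2 by (unfold Ci, Cmult, Copp, RtoC; simpl; f_equal; ring).
  match type of E2 with (- - RtoC 1 * ?a = - - RtoC 1 * ?b)%C =>
    replace a with (- - RtoC 1 * a)%C by ring;
    replace b with (- - RtoC 1 * b)%C by ring end.
  exact E2.
Qed.

(** On a sufficiently small circle around [z], [h] is within [e] of [h z]; since the left side does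
    not depend on that circle, the two sides agree up to [e * (2 * PI)] for every [e]. *)
Lemma cauchy_formula (h : CC -> CC) r rho z :
  holo_on r h -> rho < r -> Cmod z < rho ->
  RIntC (fun t => h (rho * cis t) * (rho * cis t) / (rho * cis t - z))%C 0 (2 * PI) =
  (RtoC (2 * PI) * h z)%C.
Proof.
  intros Hh Hr Hz. pose proof (Cmod_ge_0 z) as Pz. pose proof two_pi_pos as P2.
  apply C_eq_eps with (2 * PI); [lra|]. intros e He.
  destruct (holo_on_cont r h z Hh ltac:(lra) e He) as [d [Hd H]]. unfold idC in H.
  set (eps := Rmin d (rho - Cmod z) / 2).
  assert (He' : 0 < eps < rho - Cmod z /\ eps < d).
  { unfold eps. pose proof (Rmin_l d (rho - Cmod z)). pose proof (Rmin_r d (rho - Cmod z)).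
    assert (0 < Rmin d (rho - Cmod z)) by (apply Rmin_pos; lra). lra. }
  rewrite (circle_deformation h r rho z eps) by (trivial; lra).
  assert (C2 : icont (fun t => h (z + eps * cis t))%C 0 (2 * PI)).
  { apply icont_global. intros t. apply (ctn_comp RtoC h (fun t => z + eps * cis t)%C).
    - apply (holo_on_cont r); trivial. eapply Rle_lt_trans; [apply Cmod_triangle|].
      rewrite Cmod_real_cis; lra.
    - apply ctn_plus; [apply ctn_const|apply rcont_scal_cis]. }
  replace (RtoC (2 * PI)) with (RtoC (2 * PI - 0)) by (f_equal; ring).
  rewrite <- RIntC_const, <- RIntC_minus; trivial.
  2: apply icont_global; intros; apply ctn_const.
  replace (e * (2 * PI)) with (e * (2 * PI - 0)) by ring. apply RIntC_bound; [lra| |].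
  - intros t Ht. apply ctn_minus; [now apply C2|apply ctn_const].
  - intros t Ht. left. apply H. replace (z + eps * cis t - z)%C with (eps * cis t)%C by ring.
    rewrite Cmod_real_cis; lra.
Qed.

(** A quadratic remainder of the kernel, uniform in [t], integrates to a quadratic remainder of the
    integral with the constant [M * C * (2 * PI)]. *)
Lemma der_under_integral (phi : R -> CC) (k k' : R -> CC -> CC) z C d :
  0 < d -> 0 < C -> (forall t, rcont phi t) ->
  (forall t u, Cmod (u - z) < d -> rcont (fun s => k s u) t) ->
  (forall t, rcont (fun s => k' s z) t) ->
  (forall t u, Cmod (u - z) < d ->
     Cmod (k t u - k t z - k' t z * (u - z)) <= C * Cmod (u - z) ^ 2) ->
  cder (fun u => RIntC (fun t => phi t * k t u)%C 0 (2 * PI)) z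
       (RIntC (fun t => phi t * k' t z)%C 0 (2 * PI)).
Proof.
  intros Hd HC Hphi Hk Hk' Hrem. pose proof two_pi_pos as P2.
  destruct (rcont_bounded phi 0 (2 * PI)) as [M [HM HMb]]; [lra|now apply icont_global|].
  assert (HP : 0 < M * C * (2 * PI)) by (apply Rmult_lt_0_compat; [now apply Rmult_lt_0_compat|lra]).
  assert (Hz : Cmod (z - z) < d) by (replace (z - z)%C with (RtoC 0) by ring; now rewrite Cmod_0).
  intros eps He. exists (Rmin d (eps / (M * C * (2 * PI)))). split.
  { apply Rmin_pos; trivial. now apply Rdiv_lt_0_compat. }
  intros u Hu. unfold idC in *.
  destruct (Rmin_Rgt_l _ _ _ Hu) as [Hu1 Hu2].
  assert (I : forall v, Cmod (v - z) < d -> icont (fun t => phi t * k t v)%C 0 (2 * PI))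
    by (intros v Hv; apply icont_global; intros; apply ctn_mult; auto).
  assert (I' : icont (fun t => phi t * k' t z)%C 0 (2 * PI))
    by (apply icont_global; intros; apply ctn_mult; auto).
  rewrite <- RIntC_minus by auto.
  rewrite Cmult_comm, <- RIntC_scal by trivial.
  rewrite <- RIntC_minus.
  2: intros t Ht; apply ctn_minus; [apply (I u)|apply (I z)]; auto.
  2: intros t Ht; apply ctn_mult; [apply ctn_const|now apply I'].
  apply Rle_trans with (M * (C * Cmod (u - z) ^ 2) * (2 * PI - 0)).
  - apply RIntC_bound; [lra| |].
    + intros t Ht. apply ctn_minus; [apply ctn_minus; [apply (I u)|apply (I z)]; auto|].
      apply ctn_mult; [apply ctn_const|now apply I'].
    + intros t Ht.
      replace (phi t * k t u - phi t * k t z - (u - z) * (phi t * k' t z))%C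
        with (phi t * (k t u - k t z - k' t z * (u - z)))%C by ring.
      rewrite Cmod_mult. apply Rmult_le_compat; try apply Cmod_ge_0; auto.
  - replace (M * (C * Cmod (u - z) ^ 2) * (2 * PI - 0))
      with ((M * C * (2 * PI)) * Cmod (u - z) * Cmod (u - z)) by ring.
    apply Rmult_le_compat_r; [apply Cmod_ge_0|].
    replace eps with ((M * C * (2 * PI)) * (eps / (M * C * (2 * PI)))) by (field; lra).
    apply Rmult_le_compat_l; lra.
Qed.

(** * Cauchy integrals, Taylor remainders and the holomorphy of derivatives *)

Lemma rcont_kernel rho u n t : Cmod u < rho -> rcont (fun s => (/ (rho * cis s - u)) ^ n)%C t.
Proof.
  intros H. apply ctn_pow, ctn_inv; [now apply circle_sub_neq0|].
  apply ctn_minus; [apply rcont_scal_cis|apply ctn_const].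
Qed.

(** Cauchy's integral with the factor w of dw = i w dt absorbed in the density. Exponent 1
    represents a function and exponent 2 its derivative. *)
Definition cauchy_int (phi : R -> CC) (rho : R) (n : nat) (u : CC) : CC :=
  RIntC (fun t => phi t * (/ (rho * cis t - u)) ^ n)%C 0 (2 * PI).

(** A point closer to [z] than half the distance from [z] to the circle keeps at least the other
    half as its distance to the circle. *)
Lemma kernel_bounds rho z u t : Cmod z < rho -> Cmod (u - z) < (rho - Cmod z) / 2 ->
  let a := (rho * cis t - z)%C in let b := (rho * cis t - u)%C in
  a <> 0%C /\ b <> 0%C /\ Cmod (/ a) <= 2 / (rho - Cmod z) /\ Cmod (/ b) <= 2 / (rho - Cmod z) /\
  Cmod u < rho.
Proof.
  intros Hz Hu a b. pose proof (Cmod_ge_0 z).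
  assert (Ha : rho - Cmod z <= Cmod a) by (apply circle_sub_ge; lra).
  assert (Hb : (rho - Cmod z) / 2 <= Cmod b).
  { replace b with (a - (u - z))%C by (unfold a, b; ring).
    pose proof (Cmod_sub_ge a (u - z)). lra. }
  assert (Hu' : Cmod u < rho).
  { pose proof (Cmod_sub_ge u z). lra. }
  assert (Na : a <> 0%C) by (apply Cmod_neq0; lra).
  assert (Nb : b <> 0%C) by (apply Cmod_neq0; lra).
  repeat split; trivial.
  - rewrite Cmod_inv by trivial. replace (2 / (rho - Cmod z)) with (/ ((rho - Cmod z) / 2)) by (field; lra).
    apply Rinv_le_contravar; lra.
  - rewrite Cmod_inv by trivial. replace (2 / (rho - Cmod z)) with (/ ((rho - Cmod z) / 2)) by (field; lra).
    apply Rinv_le_contravar; lra.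
Qed.

Lemma cauchy_int1_der phi rho z : (forall t, rcont phi t) -> Cmod z < rho ->
  cder (cauchy_int phi rho 1) z (cauchy_int phi rho 2 z).
Proof.
  intros Hphi Hz.
  set (c := 2 / (rho - Cmod z)). assert (Hc : 0 < c) by (apply Rdiv_lt_0_compat; lra).
  apply (der_under_integral phi (fun t u => (/ (rho * cis t - u)) ^ 1)%C
           (fun t u => (/ (rho * cis t - u)) ^ 2)%C z (c ^ 3) ((rho - Cmod z) / 2)); trivial.
  - lra.
  - now apply pow_lt.
  - intros t u Hu. apply rcont_kernel. now apply (kernel_bounds rho z u 0).
  - intros t. now apply rcont_kernel.
  - intros t u Hu. destruct (kernel_bounds rho z u t Hz Hu) as (Na & Nb & Ba & Bb & _).
    set (a := (rho * cis t - z)%C) in *. set (b := (rho * cis t - u)%C) in *.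
    replace ((/ b) ^ 1 - (/ a) ^ 1 - (/ a) ^ 2 * (u - z))%C
      (* Since [u - z] is [a - b], the first-order remainder of the kernel is exactly (u - z)^2 /
         (a^2 b): three kernels, hence the constant [c ^ 3]. *)
      with (/ a * (/ a * / b) * ((u - z) * (u - z)))%C.
    2: { replace (u - z)%C with (a - b)%C by (unfold a, b; ring). simpl. field. auto. }
    rewrite !Cmod_mult. replace (Cmod (u - z) ^ 2) with (Cmod (u - z) * Cmod (u - z)) by ring.
    apply Rmult_le_compat_r; [apply Rmult_le_pos; apply Cmod_ge_0|].
    replace (c ^ 3) with (c * (c * c)) by ring.
    repeat apply Rmult_le_compat; trivial; try apply Rmult_le_pos; apply Cmod_ge_0.
Qed.

Lemma cauchy_int2_der phi rho z : (forall t, rcont phi t) -> Cmod z < rho ->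
  cder (cauchy_int phi rho 2) z (RIntC (fun t => phi t * (2 * (/ (rho * cis t - z)) ^ 3))%C 0 (2 * PI)).
Proof.
  intros Hphi Hz.
  set (c := 2 / (rho - Cmod z)). assert (Hc : 0 < c) by (apply Rdiv_lt_0_compat; lra).
  (* The remainder equals (1 / (a^2 b^2) + 2 / (a^3 b)) (u - z)^2, three products of four kernels,
     whence [3 * c ^ 4]. *)
  apply (der_under_integral phi (fun t u => (/ (rho * cis t - u)) ^ 2)%C
           (fun t u => 2 * (/ (rho * cis t - u)) ^ 3)%C z (3 * c ^ 4) ((rho - Cmod z) / 2)); trivial.
  - lra.
  - apply Rmult_lt_0_compat; [lra|now apply pow_lt].
  - intros t u Hu. apply rcont_kernel. now apply (kernel_bounds rho z u 0).
  - intros t. apply ctn_mult; [apply ctn_const|now apply rcont_kernel].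
  - intros t u Hu. destruct (kernel_bounds rho z u t Hz Hu) as (Na & Nb & Ba & Bb & _).
    set (a := (rho * cis t - z)%C) in *. set (b := (rho * cis t - u)%C) in *.
    replace ((/ b) ^ 2 - (/ a) ^ 2 - 2 * (/ a) ^ 3 * (u - z))%C
      with ((/ a * / a * (/ b * / b) + 2 * (/ a * / a * (/ a * / b))) * ((u - z) * (u - z)))%C.
    2: { replace (u - z)%C with (a - b)%C by (unfold a, b; ring). simpl. field. auto. }
    rewrite (Cmod_mult _ ((u - z) * (u - z))), (Cmod_mult (u - z)).
    replace (Cmod (u - z) ^ 2) with (Cmod (u - z) * Cmod (u - z)) by ring.
    apply Rmult_le_compat_r; [apply Rmult_le_pos; apply Cmod_ge_0|].
    eapply Rle_trans; [apply Cmod_triangle|]. rewrite !Cmod_mult, Cmod_R, Rabs_pos_eq by lra.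
    assert (P4 : forall x y v w, 0 <= x <= c -> 0 <= y <= c -> 0 <= v <= c -> 0 <= w <= c ->
      x * y * (v * w) <= c ^ 4).
    { intros x y v w Hx Hy Hv Hw. replace (c ^ 4) with (c * c * (c * c)) by ring.
      repeat apply Rmult_le_compat; try apply Rmult_le_pos; lra. }
    pose proof (Cmod_ge_0 (/ a)). pose proof (Cmod_ge_0 (/ b)).
    pose proof (P4 (Cmod (/ a)) (Cmod (/ a)) (Cmod (/ b)) (Cmod (/ b))).
    pose proof (P4 (Cmod (/ a)) (Cmod (/ a)) (Cmod (/ a)) (Cmod (/ b))).
    fold c in Ba, Bb. lra.
Qed.

Lemma cauchy_density_cont (h : CC -> CC) r rho n t : holo_on r h -> 0 < rho < r ->
  rcont (fun t => h (rho * cis t) * (rho * cis t) * (/ (rho * cis t)) ^ n / RtoC (2 * PI))%C t.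
Proof.
  intros Hh Hr. apply ctn_mult; [|apply ctn_const]. apply ctn_mult.
  - apply ctn_mult; [|apply rcont_scal_cis].
    apply (ctn_comp RtoC h (fun t => rho * cis t)%C); [|apply rcont_scal_cis].
    apply (holo_on_cont r); trivial. rewrite Cmod_real_cis; lra.
  - apply ctn_pow, ctn_inv; [|apply rcont_scal_cis]. apply Cmod_neq0. rewrite Cmod_real_cis; lra.
Qed.

(* [taylor_rem h rho n] is the [n]-th Taylor remainder of [h] at [0] divided by [z ^ n]. *)
Definition taylor_rem (h : CC -> CC) (rho : R) (n : nat) : CC -> CC :=
  cauchy_int (fun t => h (rho * cis t) * (rho * cis t) * (/ (rho * cis t)) ^ n / RtoC (2 * PI))%C rho 1.

Lemma RtoC_2PI_neq0 : RtoC (2 * PI) <> 0%C.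
Proof. pose proof two_pi_pos. intros E. apply RtoC_inj in E. lra. Qed.

Lemma taylor_rem_0 h r rho z : holo_on r h -> rho < r -> Cmod z < rho ->
  taylor_rem h rho 0 z = h z.
Proof.
  intros Hh Hr Hz. pose proof (Cmod_ge_0 z). pose proof RtoC_2PI_neq0 as N.
  replace (h z) with (/ RtoC (2 * PI) * (RtoC (2 * PI) * h z))%C by (field; trivial).
  rewrite <- (cauchy_formula h r rho z) by trivial. unfold taylor_rem, cauchy_int.
  rewrite <- RIntC_scal.
  - apply RIntC_ext. intros t _. simpl. field. split; [now apply circle_sub_neq0|trivial].
  - apply icont_global. intros t. apply ctn_div.
    + now apply circle_sub_neq0.
    + apply ctn_mult; [|apply rcont_scal_cis].
      apply (ctn_comp RtoC h (fun t => rho * cis t)%C); [|apply rcont_scal_cis].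
      apply (holo_on_cont r); trivial. rewrite Cmod_real_cis; lra.
    + apply ctn_minus; [apply rcont_scal_cis|apply ctn_const].
Qed.

Lemma taylor_rem_holo h r rho n : holo_on r h -> 0 < rho < r -> holo_on rho (taylor_rem h rho n).
Proof.
  intros Hh Hr z Hz. eexists. apply cauchy_int1_der; trivial.
  intros t. apply (cauchy_density_cont h r); trivial.
Qed.

(** One step of the geometric expansion under the integral: 1 / (w - z) = 1 / w + (z / w) / (w -
    z). *)
Lemma taylor_rem_S h r rho n z : holo_on r h -> 0 < rho < r -> Cmod z < rho ->
  taylor_rem h rho n z = (taylor_rem h rho n 0 + z * taylor_rem h rho (S n) z)%C.
Proof.
  intros Hh Hr Hz. unfold taylor_rem, cauchy_int.
  assert (I : forall m u t, Cmod u < rho -> rcont (fun t => h (rho * cis t) * (rho * cis t) *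
    (/ (rho * cis t)) ^ m / RtoC (2 * PI) * (/ (rho * cis t - u)) ^ 1)%C t).
  { intros m u t Hu. apply ctn_mult; [apply (cauchy_density_cont h r); trivial|now apply rcont_kernel]. }
  assert (H0 : Cmod 0 < rho) by (rewrite Cmod_0; lra).
  rewrite <- RIntC_scal by (apply icont_global; auto).
  rewrite <- RIntC_plus.
  - apply RIntC_ext. intros t _. simpl.
    assert (Hc : (rho * cis t)%C <> 0%C) by (apply Cmod_neq0; rewrite Cmod_real_cis; lra).
    set (w := (rho * cis t)%C) in *. 
    assert (Hw : (w - z)%C <> 0%C) by (apply circle_sub_neq0; lra).
    set (W := ((/ w) ^ n)%C). replace (w - 0)%C with w by ring.
    field. repeat split; trivial. apply RtoC_2PI_neq0.
  - apply icont_global. auto.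
  - apply icont_global. intros t. apply ctn_mult; [apply ctn_const|auto].
Qed.

(** The index enters the density only through w^(-n), of modulus rho^(-n) on the circle, so a bound
    for index 0 serves all [n] at a fixed [z]. *)
Lemma taylor_rem_bound h r rho z : holo_on r h -> 0 < rho < r -> Cmod z < rho ->
  exists M, 0 < M /\ forall n, Cmod (taylor_rem h rho n z) <= M * (/ rho) ^ n.
Proof.
  intros Hh Hr Hz. pose proof two_pi_pos as P2.
  destruct (rcont_bounded (fun t => h (rho * cis t) * (rho * cis t) * (/ (rho * cis t)) ^ 0 /
    RtoC (2 * PI) * (/ (rho * cis t - z)) ^ 1)%C 0 (2 * PI)) as [M [HM HB]].
  { lra. }
  { apply icont_global. intros t. apply ctn_mult; [apply (cauchy_density_cont h r); trivial|now apply rcont_kernel]. }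
  exists (M * (2 * PI)). split; [now apply Rmult_lt_0_compat|]. intros n.
  unfold taylor_rem, cauchy_int.
  replace (M * (2 * PI) * (/ rho) ^ n) with (M * (/ rho) ^ n * (2 * PI - 0)) by ring.
  apply RIntC_bound; [lra| |].
  - apply icont_global. intros t. apply ctn_mult; [apply (cauchy_density_cont h r); trivial|now apply rcont_kernel].
  - intros t Ht. specialize (HB t Ht). simpl in HB |- *.
    assert (Hc : (rho * cis t)%C <> 0%C) by (apply Cmod_neq0; rewrite Cmod_real_cis; lra).
    match goal with |- Cmod (?a * ?b * ?W / ?p * ?k) <= _ =>
      replace (a * b * W / p * k)%C with ((a * b * 1 / p * k) * W)%C
        by (unfold Cdiv; ring) end.
    rewrite Cmod_mult. apply Rmult_le_compat; try apply Cmod_ge_0; trivial.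
    rewrite Cmod_pow, Cmod_inv, Cmod_real_cis by (trivial; lra). apply Rle_refl.
Qed.

(** The values [taylor_rem h rho n 0] are the Taylor coefficients. The first nonzero one gives the
    factorization. If all vanish, then |h z| is at most M (|z| / rho)^n for every n, which forces
    [h z] to be 0. *)
Lemma holo_order_dichotomy h r : 0 < r -> holo_on r h ->
  (exists r', 0 < r' /\ forall z, Cmod z < r' -> h z = 0%C) \/
  (exists n r' u, 0 < r' /\ holo_on r' u /\ u 0%C <> 0%C /\
     forall z, Cmod z < r' -> h z = (z ^ n * u z)%C).
Proof.
  intros Hr Hh. set (rho := r / 2). assert (Hrho : 0 < rho < r) by (unfold rho; lra).
  assert (Exp : forall n, (forall k, (k < n)%nat -> taylor_rem h rho k 0 = 0%C) ->
    forall z, Cmod z < rho -> h z = (z ^ n * taylor_rem h rho n z)%C).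
  { induction n as [|n IH]; intros H z Hz.
    - simpl. rewrite (taylor_rem_0 h r) by (trivial; lra). ring.
    - rewrite IH by (trivial; intros; apply H; lia).
      rewrite (taylor_rem_S h r) by trivial. rewrite H by lia. simpl. ring. }
  destruct (excluded_middle_informative (exists n, taylor_rem h rho n 0 <> 0%C)) as [Hex|Hn].
  - right.
    destruct (dec_inh_nat_subset_has_unique_least_element (fun n => taylor_rem h rho n 0 <> 0%C))
      as [n [[Hn Hmin] _]]; trivial.
    { intros n. destruct (Ceq_dec (taylor_rem h rho n 0) 0); tauto. }
    exists n, rho, (taylor_rem h rho n). split; [lra|]. split.
    { apply (taylor_rem_holo h r); trivial. } split; trivial.
    apply Exp. intros k Hk. apply NNPP. intros Hk'. apply Hmin in Hk'. lia.
  - left. exists rho. split; [lra|]. intros z Hz.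
    assert (H0 : forall k, taylor_rem h rho k 0 = 0%C) by (intros k; apply NNPP; eauto).
    destruct (taylor_rem_bound h r rho z Hh Hrho Hz) as [M [HM HB]].
    apply C_eq_eps with M; trivial. intros e He.
    replace (h z - 0)%C with (h z) by ring.
    destruct (pow_lt_1_zero (Cmod z / rho)) with (y := e) as [N HN]; trivial.
    { pose proof (Cmod_ge_0 z). rewrite Rabs_pos_eq.
      - apply Rmult_lt_reg_r with rho; [lra|]. unfold Rdiv. rewrite Rmult_assoc, Rinv_l; lra.
      - apply Rmult_le_pos; [trivial|left; apply Rinv_0_lt_compat; lra]. }
    specialize (HN N (Nat.le_refl N)).
    rewrite (Exp N) by auto. rewrite Cmod_mult, Cmod_pow.
    apply Rle_trans with (Cmod z ^ N * (M * (/ rho) ^ N)).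
    + apply Rmult_le_compat_l; [apply pow_le, Cmod_ge_0|apply HB].
    + replace (Cmod z ^ N * (M * (/ rho) ^ N)) with ((Cmod z / rho) ^ N * M)
        by (unfold Rdiv; rewrite Rpow_mult_distr; ring).
      apply Rmult_le_compat_r; [lra|]. apply Rle_trans with (2 := Rlt_le _ _ HN). apply Rle_abs.
Qed.

(** Near a point, [h] is a Cauchy integral, hence [h'] is the Cauchy integral with exponent 2, which
    is differentiable in turn. In this way the mere existence of derivatives yields the continuity
    and the power factorization of G' and G_*'. *)
Lemma holo_on_derivative h h' r : (forall z, Cmod z < r -> cder h z (h' z)) -> holo_on r h'.
Proof.
  intros Hh z Hz. pose proof (Cmod_ge_0 z).
  set (rho := (Cmod z + r) / 2). assert (Hrho : 0 < rho < r) by (unfold rho; lra).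
  assert (Hz' : Cmod z < rho) by (unfold rho; lra).
  assert (Hh' : holo_on r h) by (intros u Hu; eexists; now apply Hh).
  set (phi := (fun t => h (rho * cis t) * (rho * cis t) * (/ (rho * cis t)) ^ 0 / RtoC (2 * PI))%C).
  assert (Hphi : forall t, rcont phi t) by (intros t; apply (cauchy_density_cont h r); trivial).
  eexists. apply der_ext_loc with (f := cauchy_int phi rho 2) (d := rho - Cmod z).
  - lra.
  - intros u Hu. unfold idC in Hu.
    assert (Hu' : Cmod u < rho) by (pose proof (Cmod_sub_ge u z); lra).
    apply cder_unique with (f := h) (t := u); [|apply Hh; lra].
    apply der_ext_loc with (f := cauchy_int phi rho 1) (d := rho - Cmod u).
    + lra.
    + intros v Hv. unfold idC in Hv. apply (taylor_rem_0 h r); trivial; try lra.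
      pose proof (Cmod_sub_ge v u). lra.
    + now apply cauchy_int1_der.
  - now apply cauchy_int2_der.
Qed.

Lemma der_shift h c z l : cder h (c + z)%C l -> cder (fun u => h (c + u)%C) z l.
Proof.
  intros H. eapply der_eq; [|apply (der_comp idC h (fun u => c + u)%C); [exact H|]].
  2: apply (der_plus idC (fun _ => c) idC); [apply der_const|apply der_self]. ring.
Qed.

Lemma holo_derivative_at h h' c r : 0 < r -> (forall z, Cmod (z - c) < r -> cder h z (h' z)) ->
  exists l, cder h' c l.
Proof.
  intros Hr Hh.
  destruct (holo_on_derivative (fun u => h (c + u)%C) (fun u => h' (c + u)%C) r) with (z := RtoC 0) as [l Hl].
  - intros z Hz. apply der_shift, Hh. now replace (c + z - c)%C with z by ring.
  - now rewrite Cmod_0.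
  - exists l. apply der_ext with (f := fun u => h' (c + (- c + u))%C).
    { intros s. f_equal. ring. }
    apply (der_shift (fun u => h' (c + u)%C)). now replace (- c + c)%C with (RtoC 0) by ring.
Qed.

(** * Gauss maps near the end *)

Lemma cexp_cis w : cexp w = (exp (Re w) * cis (Im w))%C.
Proof. unfold cexp, cis, Cmult, RtoC. simpl. f_equal; ring. Qed.

Lemma Cmod_cexp w : Cmod (cexp w) = exp (Re w).
Proof. rewrite cexp_cis. apply Cmod_real_cis. left. apply exp_pos. Qed.

Lemma cexp_neq0 w : cexp w <> 0%C.
Proof. apply Cmod_neq0. rewrite Cmod_cexp. apply exp_pos. Qed.

Lemma cexp_plus a b : cexp (a + b)%C = (cexp a * cexp b)%C.
Proof.
  unfold cexp, Cmult, Cplus, Re, Im. simpl. rewrite exp_plus, cos_plus, sin_plus. f_equal; ring.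
Qed.

Lemma cexp_0 : cexp 0 = 1%C.
Proof. unfold cexp, RtoC. simpl. rewrite exp_0, cos_0, sin_0. f_equal; ring. Qed.

Lemma cexp_ray_der (h : CC) t : rder (fun s => cexp (s * h)%C) t (h * cexp (t * h))%C.
Proof.
  assert (E : forall s : R, cexp (s * h)%C = (exp (s * Re h) * cos (s * Im h), exp (s * Re h) * sin (s * Im h))).
  { intros s. unfold cexp, Cmult, RtoC, Re, Im. simpl.
    now rewrite !Rmult_0_l, Rminus_0_r, Rplus_0_r. }
  apply rder_iff. split.
  - apply is_derive_ext with (fun s => exp (s * Re h) * cos (s * Im h)).
    { intros s. now rewrite E. }
    rewrite E. unfold Re, Im, Cmult. simpl. auto_derive; trivial. ring.
  - apply is_derive_ext with (fun s => exp (s * Re h) * sin (s * Im h)).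
    { intros s. now rewrite E. }
    rewrite E. unfold Re, Im, Cmult. simpl. auto_derive; trivial. ring.
Qed.

(** Mean value estimate along the segment from 0 to [h]; there the real part of the exponent is at
    most 1, and 3 bounds [exp 1]. *)
Lemma cexp_sub1_bound h : Cmod h <= 1 -> Cmod (cexp h - 1) <= 3 * Cmod h.
Proof.
  intros H. pose proof (Cmod_ge_0 h).
  pose proof (rder_mvt (fun s => cexp (s * h)%C) (fun t => h * cexp (t * h))%C 0 1 (3 * Cmod h)) as L.
  cbv beta in L. rewrite Cmult_1_l, Cmult_0_l, cexp_0, Rminus_0_r, Rmult_1_r in L. apply L; [lra| |].
  - intros t _. apply cexp_ray_der.
  - intros t Ht. rewrite Cmod_mult, Cmod_cexp, Rmult_comm. apply Rmult_le_compat_r; trivial.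
    apply Rle_trans with (exp 1); [|apply exp_le_3].
    assert (Re (t * h) <= 1).
    { replace (Re (t * h)) with (t * Re h) by parts.
      pose proof (re_le_Cmod h). pose proof (Rle_abs (Re h)).
      apply Rle_trans with (t * Cmod h); [apply Rmult_le_compat_l; lra|].
      replace 1 with (1 * 1) by ring. apply Rmult_le_compat; lra. }
    destruct H1 as [H1| ->]; [left; now apply exp_increasing|lra].
Qed.

(** By the addition formula only the remainder [cexp h - h - 1] at 0 matters. Its derivative along
    the segment to [h] is [h * (cexp (t * h) - 1)], so the previous estimate makes it quadratic in
    [h]. *)
Lemma cexp_der w : cder cexp w (cexp w).
Proof.
  intros eps He. unfold idC. pose proof (exp_pos (Re w)) as P.
  exists (Rmin 1 (eps / (3 * exp (Re w)))). split.
  { apply Rmin_pos; [lra|apply Rdiv_lt_0_compat; lra]. }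
  intros s Hs.
  destruct (Rmin_Rgt_l _ _ _ Hs) as [H1 H2].
  set (h := (s - w)%C) in *. replace s with (w + h)%C by (unfold h; ring).
  rewrite cexp_plus.
  replace (cexp w * cexp h - cexp w - cexp w * h)%C with (cexp w * (cexp h - h - 1))%C by ring.
  rewrite Cmod_mult, Cmod_cexp. pose proof (Cmod_ge_0 h) as Ph.
  assert (B : Cmod (cexp h - h - 1) <= 3 * Cmod h * Cmod h).
  { pose proof (rder_mvt (fun s => cexp (s * h) - s * h)%C (fun t => h * cexp (t * h) - h)%C 0 1
      (3 * Cmod h * Cmod h)) as L.
    cbv beta in L. rewrite Cmult_1_l, Cmult_0_l, cexp_0, Rminus_0_r, Rmult_1_r in L.
    replace (cexp h - h - 1)%C with (cexp h - h - (1 - 0))%C by ring. apply L; [lra| |].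
    - intros t _. apply der_minus; [apply cexp_ray_der|].
      eapply der_eq; [|apply der_mult; [apply der_self|apply der_const]]. cbv beta. ring.
    - intros t Ht. replace (h * cexp (t * h) - h)%C with (h * (cexp (t * h) - 1))%C by ring.
      rewrite Cmod_mult, Rmult_comm. apply Rmult_le_compat_r; trivial.
      assert (Cmod (t * h) <= Cmod h).
      { rewrite Cmod_mult, Cmod_R, Rabs_pos_eq by lra.
        apply Rle_trans with (1 * Cmod h); [apply Rmult_le_compat_r; lra|lra]. }
      eapply Rle_trans; [apply cexp_sub1_bound; lra|lra]. }
  apply Rle_trans with (exp (Re w) * (3 * Cmod h * Cmod h)); [apply Rmult_le_compat_l; lra|].
  replace (exp (Re w) * (3 * Cmod h * Cmod h)) with (3 * exp (Re w) * Cmod h * Cmod h) by ring.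
  apply Rmult_le_compat_r; trivial.
  replace eps with (3 * exp (Re w) * (eps / (3 * exp (Re w)))) by (field; lra).
  apply Rmult_le_compat_l; lra.
Qed.

Lemma cexp_small d w : 0 < d -> Re w < ln d -> Cmod (cexp w) < d.
Proof.
  intros Hd H. rewrite Cmod_cexp. rewrite <- (exp_ln d) by trivial. now apply exp_increasing.
Qed.

Lemma der_comp_cexp h w l : cder h (cexp w) l -> cder (fun u => h (cexp u)) w (cexp w * l)%C.
Proof.
  intros H. eapply der_eq; [|apply (der_comp idC h cexp); [exact H|apply cexp_der]]. ring.
Qed.

Lemma ccont_end f eps : ccont f 0 -> 0 < eps ->
  exists M, forall w, Re w < M -> Cmod (f (cexp w) - f (RtoC 0)) < eps.
Proof.
  intros H He. destruct (H eps He) as [d [Hd H1]]. unfold idC in H1.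
  exists (ln d). intros w Hw. apply H1.
  replace (cexp w - 0)%C with (cexp w) by ring. now apply cexp_small.
Qed.

Lemma holo_on_iff r h : holo_disk r h <-> holo_on r h.
Proof.
  unfold holo_disk, holo_on, disk. split; intros H z Hz; destruct (H z Hz) as [l Hl];
    exists l; now apply cder_iff.
Qed.

Lemma holo_on_deriv_fun r h : holo_on r h ->
  exists h', forall z, Cmod z < r -> cder h z (h' z).
Proof.
  intros H.
  exists (fun z => match excluded_middle_informative (Cmod z < r) with
    | left p => proj1_sig (constructive_indefinite_description _ (H z p)) | right _ => 0%C end).
  intros z Hz. destruct (excluded_middle_informative (Cmod z < r)) as [p|n]; [|tauto].
  exact (proj2_sig (constructive_indefinite_description _ (H z p))).
Qed.

(** * Orders of vanishing of the derivatives of the Gauss maps and the limit of their ratio *)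

Lemma ccont_0_holo r h : 0 < r -> holo_on r h -> ccont h 0.
Proof. intros Hr H. apply (holo_on_cont r); trivial. now rewrite Cmod_0. Qed.

Lemma holo_on_const r c : holo_on r (fun _ => c).
Proof. intros z _. eexists. apply der_const. Qed.

Lemma holo_on_pow_mult r n u : holo_on r u -> holo_on r (fun z => z ^ n * u z)%C.
Proof.
  intros H z Hz. destruct (H z Hz) as [l Hl]. eexists.
  apply (der_mult idC (fun z => z ^ n)%C u); [|exact Hl].
  apply (der_pow idC idC). apply der_self.
Qed.

(** A constant Gauss map has derivative zero and no order; then [u] is 0. Otherwise the surplus
    power of z is moved into [u], so [u] may vanish at 0. *)
Lemma factor_min_order (h : CC -> CC) r n : 0 < r -> holo_on r h ->
  (forall k, has_order_at_0 h k -> (n <= k)%nat) ->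
  exists r' u, 0 < r' /\ holo_on r' u /\ forall z, Cmod z < r' -> h z = (z ^ n * u z)%C.
Proof.
  intros Hr Hh Hmin. destruct (holo_order_dichotomy h r Hr Hh) as [[r' [Hr' H0]]|(k & r' & u & Hr' & Hu & Hu0 & E)].
  - exists r', (fun _ => RtoC 0). split; trivial. split; [apply holo_on_const|].
    intros z Hz. rewrite H0 by trivial. ring.
  - assert (Hk : (n <= k)%nat).
    { apply Hmin. exists r', u. split; trivial. split; [now apply holo_on_iff|]. split; trivial. }
    exists r', (fun z => z ^ (k - n) * u z)%C. split; trivial.
    split; [now apply holo_on_pow_mult|].
    intros z Hz. rewrite E by trivial.
    replace k with (n + (k - n))%nat at 1 by lia. rewrite Cpow_add_r. ring.
Qed.

Lemma filterlim_locally'_0 (f : CC -> CC) (l : CC) :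
  filterlim f (@locally' C_UniformSpace (RtoC 0)) (locally l) ->
  forall eps, 0 < eps -> exists d, 0 < d /\
    forall z, Cmod z < d -> z <> 0%C -> Cmod (f z - l) < eps.
Proof.
  intros H eps He.
  assert (L : locally l (fun y : CC => Cmod (y - l) < eps)).
  { apply (locally_le_locally_norm (K := C_AbsRing) (V := C_NormedModule)).
    exists (mkposreal eps He). intros y Hy. exact Hy. }
  specialize (H _ L). unfold filtermap, locally', within in H.
  apply (locally_norm_le_locally (K := C_AbsRing) (V := C_NormedModule)) in H.
  destruct H as [d Hd]. exists d. split; [apply cond_pos|].
  intros z Hz Hn. apply Hd; trivial.
  unfold ball_norm. change (Cmod (z - 0) < d). now replace (z - 0)%C with z by ring.
Qed.

Lemma small_point r : 0 < r -> exists z : CC, Cmod z < r /\ z <> 0%C.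
Proof.
  intros H. exists (RtoC (r / 2)). split.
  - rewrite Cmod_R, Rabs_pos_eq; lra.
  - intros E. apply RtoC_inj in E. lra.
Qed.

Lemma ccont_eq_punctured f1 f2 d : ccont f1 0 -> ccont f2 0 -> 0 < d ->
  (forall z, Cmod z < d -> z <> 0%C -> f1 z = f2 z) -> f1 0%C = f2 0%C.
Proof.
  intros H1 H2 Hd E. apply C_eq_eps with 2; [lra|]. intros e He.
  destruct (H1 e He) as [d1 [Hd1 B1]]. destruct (H2 e He) as [d2 [Hd2 B2]]. unfold idC in *.
  destruct (small_point (Rmin d (Rmin d1 d2))) as [z [Hz Hn]]; [repeat apply Rmin_pos; trivial|].
  pose proof (Rmin_l d (Rmin d1 d2)). pose proof (Rmin_r d (Rmin d1 d2)).
  pose proof (Rmin_l d1 d2). pose proof (Rmin_r d1 d2).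
  assert (Ez : (z - 0)%C = z) by ring.
  specialize (B1 z). specialize (B2 z). rewrite Ez in *.
  specialize (B1 ltac:(lra)). specialize (B2 ltac:(lra)). specialize (E z ltac:(lra) Hn).
  rewrite E in B1.
  replace (f1 0%C - f2 0%C)%C with ((f2 z - f2 0%C) - (f2 z - f1 0%C))%C by ring.
  eapply Rle_trans; [apply Cmod_tri_sub|]. lra.
Qed.

Lemma Cdiv_0_r (x : CC) : (x / 0 = 0)%C.
Proof.
  unfold Cdiv. replace (/ RtoC 0)%C with (RtoC 0); [ring|].
  unfold Cinv, RtoC. simpl. f_equal; unfold Rdiv; ring.
Qed.

Lemma ccont_away f : ccont f 0 -> f 0%C <> 0%C ->
  exists d, 0 < d /\ forall z, Cmod z < d -> f z <> 0%C.
Proof.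
  intros Cf Nf. destruct (ctn_away idC f 0 Cf Nf) as [d [Hd H]]. exists d. split; trivial.
  intros z Hz. apply Cmod_neq0. apply Cmod_gt_0 in Nf. unfold idC in H. specialize (H z).
  replace (z - 0)%C with z in H by ring. specialize (H Hz). lra.
Qed.

(* Where [f] vanishes the quotient is [h / 0 = 0]; hence a nonzero limit keeps [f] away from [0]. *)
Lemma ratio_limit (f h u v : CC -> CC) (r : R) (n : nat) (alpha : CC) :
  0 < r -> ccont u 0 -> ccont v 0 ->
  (forall z, Cmod z < r -> f z = (z ^ n * u z)%C) ->
  (forall z, Cmod z < r -> h z = (z ^ n * v z)%C) ->
  (u 0%C <> 0%C \/ v 0%C <> 0%C) ->
  filterlim (fun z : CC => h z / f z)%C (@locally' C_UniformSpace (RtoC 0)) (locally alpha) ->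
  (u 0%C <> 0%C /\ v 0%C = (alpha * u 0)%C) \/ (v 0%C <> 0%C /\ u 0%C = 0%C /\ alpha = 0%C).
Proof.
  intros Hr Hu Hv Ef Eh Hnz Hlim.
  (* The ratio, completed by its limit, is continuous at 0, so relations on the punctured disk pass
     to the point 0. *)
  set (phi := fun z : CC => if Ceq_dec z 0 then alpha else (h z / f z)%C).
  assert (P0 : phi 0%C = alpha) by (unfold phi; destruct (Ceq_dec 0 0); congruence).
  assert (Cphi : ccont phi 0).
  { intros e He. destruct (filterlim_locally'_0 _ _ Hlim e He) as [d [Hd B]]. exists d. split; trivial.
    unfold idC. intros z Hz. rewrite P0. unfold phi. destruct (Ceq_dec z 0) as [_|N].
    - replace (alpha - alpha)%C with (RtoC 0) by ring. now rewrite Cmod_0.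
    - apply B; trivial. now replace (z - 0)%C with z in Hz by ring. }
  assert (Prod : forall d, 0 < d -> (forall z, Cmod z < d -> z <> 0%C -> u z <> 0%C) ->
    v 0%C = (alpha * u 0%C)%C).
  { intros d Hd Nu. rewrite <- P0.
    apply (ccont_eq_punctured v (fun z => phi z * u z)%C (Rmin d r)); trivial.
    - now apply ctn_mult.
    - now apply Rmin_pos.
    - intros z Hz Nz. destruct (Rmin_Rgt_l _ _ _ Hz) as [Hz1 Hz2]. specialize (Nu z Hz1 Nz).
      unfold phi. destruct (Ceq_dec z 0); [contradiction|]. rewrite Ef, Eh by trivial.
      field. split; [trivial|now apply Cpow_nz]. }
  destruct (Ceq_dec (u 0%C) 0) as [U0|U0].
  - right. assert (V0 : v 0%C <> 0%C) by tauto. repeat split; trivial. apply NNPP. intros Na.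
    apply V0. rewrite <- P0 in Na. destruct (ccont_away phi Cphi Na) as [d [Hd Nphi]].
    rewrite (Prod (Rmin d r)), U0; [ring|now apply Rmin_pos|].
    intros z Hz Nz Uz. destruct (Rmin_Rgt_l _ _ _ Hz) as [Hz1 Hz2]. apply (Nphi z Hz1).
    unfold phi. destruct (Ceq_dec z 0); [contradiction|]. rewrite Ef, Uz by trivial.
    replace (z ^ n * 0)%C with (RtoC 0) by ring. apply Cdiv_0_r.
  - left. split; trivial. destruct (ccont_away u Hu U0) as [d [Hd Nu]]. apply (Prod d Hd). auto.
Qed.

(** The multiplicity provides the common factor z^(m-1) with at least one of [u], [v] nonzero at 0;
    the limit of the ratio then relates their values there. The alternative at the end is symmetric
    because either Gauss map may be the one of lower order. *)
Lemma gauss_ratio_orders (g gs dg dgs : CC -> CC) r m alpha : 0 < r ->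
  (forall z, Cmod z < r -> cder g z (dg z)) -> (forall z, Cmod z < r -> cder gs z (dgs z)) ->
  is_multiplicity dg dgs m -> is_gauss_ratio dg dgs alpha ->
  exists r' u v, 0 < r' <= r /\ holo_on r' u /\ holo_on r' v /\
    (forall z, Cmod z < r' -> dg z = (z ^ (m - 1) * u z)%C) /\
    (forall z, Cmod z < r' -> dgs z = (z ^ (m - 1) * v z)%C) /\
    ((u 0%C <> 0%C /\ v 0%C = (alpha * u 0)%C) \/ (v 0%C <> 0%C /\ u 0%C = (alpha * v 0)%C)).
Proof.
  intros Hr Hg Hgs [_ Hm] Ha.
  assert (H1 : holo_on r dg) by now apply holo_on_derivative with g.
  assert (H2 : holo_on r dgs) by now apply holo_on_derivative with gs.
  assert (Hf : exists r' u v, 0 < r' <= r /\ holo_on r' u /\ holo_on r' v /\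
    (forall z, Cmod z < r' -> dg z = (z ^ (m - 1) * u z)%C) /\
    (forall z, Cmod z < r' -> dgs z = (z ^ (m - 1) * v z)%C) /\ (u 0%C <> 0%C \/ v 0%C <> 0%C)).
  { assert (Hcomb : forall r1 u r2 v, 0 < r1 -> 0 < r2 -> holo_on r1 u -> holo_on r2 v ->
      (forall z, Cmod z < r1 -> dg z = (z ^ (m - 1) * u z)%C) ->
      (forall z, Cmod z < r2 -> dgs z = (z ^ (m - 1) * v z)%C) ->
      (u 0%C <> 0%C \/ v 0%C <> 0%C) ->
      exists r' u v, 0 < r' <= r /\ holo_on r' u /\ holo_on r' v /\
      (forall z, Cmod z < r' -> dg z = (z ^ (m - 1) * u z)%C) /\
      (forall z, Cmod z < r' -> dgs z = (z ^ (m - 1) * v z)%C) /\ (u 0%C <> 0%C \/ v 0%C <> 0%C)).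
    { intros r1 u r2 v P1 P2 Hu Hv Eu Ev Hn.
      pose proof (Rmin_l r (Rmin r1 r2)). pose proof (Rmin_r r (Rmin r1 r2)).
      pose proof (Rmin_l r1 r2). pose proof (Rmin_r r1 r2).
      exists (Rmin r (Rmin r1 r2)), u, v. repeat split; trivial.
      - repeat apply Rmin_pos; trivial.
      - apply holo_on_le with r1; trivial; lra.
      - apply holo_on_le with r2; trivial; lra.
      - intros z Hz. apply Eu. lra.
      - intros z Hz. apply Ev. lra. }
    destruct Hm as [[(r1 & u & Hr1 & Hu & Hu0 & Eu) Hmin]|[(r2 & v & Hr2 & Hv & Hv0 & Ev) Hmin]].
    - apply holo_on_iff in Hu.
      destruct (factor_min_order dgs r (m - 1) Hr H2 Hmin) as (r2 & v & Hr2 & Hv & Ev).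
      apply (Hcomb r1 u r2 v); auto.
    - apply holo_on_iff in Hv.
      destruct (factor_min_order dg r (m - 1) Hr H1 Hmin) as (r1 & u & Hr1 & Hu & Eu).
      apply (Hcomb r1 u r2 v); auto. }
  destruct Hf as (r' & u & v & Hr' & Hu & Hv & Eu & Ev & Hn).
  exists r', u, v. refine (conj Hr' (conj Hu (conj Hv (conj Eu (conj Ev _))))).
  assert (Cu : ccont u 0) by (apply ccont_0_holo with r'; trivial; lra).
  assert (Cv : ccont v 0) by (apply ccont_0_holo with r'; trivial; lra).
  destruct Ha as [[Hl _]|[Hl _]].
  - destruct (ratio_limit dg dgs u v r' (m - 1) alpha) as [?|(V & U & ->)]; trivial; try lra.
    + now left.
    + right. split; trivial. rewrite U. ring.
  - destruct (ratio_limit dgs dg v u r' (m - 1) alpha) as [?|(U & V & ->)]; trivial; try lra; try tauto.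
    left. split; trivial. rewrite V. ring.
Qed.

(* The difference quotient of order [m] extends continuously over [0]; [0] itself is filled in with the limit. *)
Definition quot_pow (g u : CC -> CC) (m : nat) (z : CC) : CC :=
  if Ceq_dec z 0 then (u 0%C / RtoC (INR m))%C else ((g z - g 0%C) / z ^ m)%C.

Lemma quot_pow_0 (g u : CC -> CC) (m : nat) : quot_pow g u m 0 = (u 0%C / RtoC (INR m))%C.
Proof. unfold quot_pow. destruct (Ceq_dec 0 0); congruence. Qed.

Lemma quot_pow_spec (g u : CC -> CC) (m : nat) (z : CC) : z <> 0%C -> g z = (g 0%C + z ^ m * quot_pow g u m z)%C.
Proof.
  intros H. unfold quot_pow. destruct (Ceq_dec z 0); [contradiction|].
  field. now apply Cpow_nz.
Qed.

Lemma INR_C_neq0 (m : nat) : (1 <= m)%nat -> RtoC (INR m) <> 0%C.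
Proof. intros H E. apply RtoC_inj in E. apply (not_0_INR m); [lia|exact E]. Qed.

(** The map [g (t * z) - (t * z) ^ m * (u 0 / m)] has the derivative [z * (t * z) ^ (m - 1) * (u (t
    * z) - u 0)] in [t]. For small z the mean value inequality bounds its increment over [0, 1] by
    [eps / 2 * Cmod (z ^ m)]. *)
Lemma quot_pow_cont (g dg u : CC -> CC) (m : nat) (r : R) : (1 <= m)%nat -> 0 < r ->
  (forall z, Cmod z < r -> cder g z (dg z)) ->
  (forall z, Cmod z < r -> dg z = (z ^ (m - 1) * u z)%C) -> ccont u 0 ->
  ccont (quot_pow g u m) 0.
Proof.
  intros Hm Hr Hg Eu Hu eps He. pose proof (INR_C_neq0 m Hm) as Nm.
  destruct (Hu (eps / 2)) as [d [Hd H]]; [lra|].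
  exists (Rmin d r). split; [now apply Rmin_pos|]. unfold idC in *. intros z Hz.
  replace (z - 0)%C with z in Hz by ring.
  destruct (Rmin_Rgt_l _ _ _ Hz) as [Hz1 Hz2].
  rewrite quot_pow_0.
  destruct (Ceq_dec z 0) as [->|Nz].
  { rewrite quot_pow_0. match goal with |- Cmod (?a - ?a) < _ => replace (a - a)%C with (RtoC 0) by ring end.
    now rewrite Cmod_0. }
  unfold quot_pow. destruct (Ceq_dec z 0); [contradiction|].
  pose proof (Cpow_nz z m Nz) as Nzm.
  replace ((g z - g 0%C) / z ^ m - u 0%C / RtoC (INR m))%C
    with ((g z - g 0%C - z ^ m * u 0%C / RtoC (INR m)) / z ^ m)%C by (field; auto).
  rewrite Cmod_div by trivial. apply Cmod_gt_0 in Nzm.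
  apply Rle_lt_trans with (eps / 2); [|lra].
  apply Rmult_le_reg_r with (Cmod (z ^ m)); trivial.
  unfold Rdiv at 1. rewrite Rmult_assoc, Rinv_l, Rmult_1_r by lra.
  pose proof (rder_mvt (fun t => g (t * z) - (t * z) ^ m * (u 0%C / RtoC (INR m)))%C
    (fun t => z * ((t * z) ^ (m - 1) * (u (t * z) - u 0%C)))%C 0 1 (eps / 2 * Cmod (z ^ m))) as L.
  cbv beta in L. rewrite Cmult_1_l, Cmult_0_l, Rminus_0_r, Rmult_1_r in L.
  replace (g z - g 0%C - z ^ m * u 0%C / RtoC (INR m))%C with
    (g z - z ^ m * (u 0%C / RtoC (INR m)) - (g 0%C - 0 ^ m * (u 0%C / RtoC (INR m))))%C.
  2: { replace (0 ^ m)%C with (RtoC 0); [field; trivial|]. destruct m; [lia|]. simpl. ring. }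
  assert (Bt : forall t, 0 <= t <= 1 -> Cmod (t * z) <= Cmod z).
  { intros t Ht. rewrite Cmod_mult, Cmod_R, Rabs_pos_eq by lra. pose proof (Cmod_ge_0 z).
    apply Rle_trans with (1 * Cmod z); [apply Rmult_le_compat_r; lra|lra]. }
  apply L; [lra| |].
  - intros t Ht. specialize (Bt t Ht).
    assert (Dt : rder (fun t => t * z)%C t z).
    { eapply der_eq; [|apply der_mult; [apply der_self|apply der_const]]. cbv beta. ring. }
    eapply der_eq; [|apply der_minus].
    2: apply (der_comp RtoC g (fun t => t * z)%C); [apply Hg; lra|exact Dt].
    2: apply der_mult; [apply der_pow; exact Dt|apply der_const].
    cbv beta. rewrite Eu by lra. field. trivial.
  - intros t Ht. specialize (Bt t Ht).
    assert (Hb : Cmod (u (t * z)%C - u 0%C) <= eps / 2).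
    { left. apply H. replace (t * z - 0)%C with (t * z)%C by ring. lra. }
    rewrite !Cmod_mult. rewrite !Cmod_pow, Cmod_mult, Cmod_R.
    replace (Cmod z ^ m) with (Cmod z * Cmod z ^ (m - 1)).
    2: { replace m with (S (m - 1)) at 2 by lia. reflexivity. }
    rewrite (Rmult_comm (eps / 2)), Rmult_assoc.
    apply Rmult_le_compat_l; [apply Cmod_ge_0|].
    apply Rmult_le_compat; trivial; try apply Cmod_ge_0.
    + apply pow_le, Rmult_le_pos; [apply Rabs_pos|apply Cmod_ge_0].
    + apply pow_incr. split; [apply Rmult_le_pos; [apply Rabs_pos|apply Cmod_ge_0]|].
      rewrite Cmod_mult, Cmod_R in Bt. exact Bt.
Qed.

(** * Curvature *)

Lemma path_x_der (y x : R) : rder (fun s : R => ((s, y) : CC)) x 1.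
Proof.
  apply der_ext with (f := fun s : R => (s + Ci * y)%C).
  { intros s. unfold Ci, Cplus, Cmult, RtoC. simpl. f_equal; ring. }
  eapply der_eq; [|apply der_plus; [apply der_self|apply der_const]]. ring.
Qed.

Lemma path_y_der (x y : R) : rder (fun s : R => ((x, s) : CC)) y Ci.
Proof.
  apply der_ext with (f := fun s : R => (x + Ci * s)%C).
  { intros s. unfold Ci, Cplus, Cmult, RtoC. simpl. f_equal; ring. }
  eapply der_eq; [|apply der_plus; [apply der_const|apply der_mult; [apply der_const|apply der_self]]].
  cbv beta. ring.
Qed.

Lemma cder_x h (x y : R) l : cder h (x, y) l -> rder (fun s => h (s, y)) x l.
Proof.
  intros H. eapply der_eq; [|apply (der_comp RtoC h (fun s => (s, y))); [exact H|apply path_x_der]]. ring.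
Qed.

Lemma cder_y h (x y : R) l : cder h (x, y) l -> rder (fun s => h (x, s)) y (Ci * l)%C.
Proof.
  intros H. eapply der_eq; [|apply (der_comp RtoC h (fun s => (x, s))); [exact H|apply path_y_der]]. ring.
Qed.

Lemma rder_Re f t v : rder f t v -> is_derive (fun s => Re (f s)) t (Re v).
Proof. intros H. now apply rder_iff. Qed.

Lemma rder_Im f t v : rder f t v -> is_derive (fun s => Im (f s)) t (Im v).
Proof. intros H. now apply rder_iff. Qed.

Lemma locally_lt (X t : R) (P : R -> Prop) : t < X -> (forall s, s < X -> P s) -> locally t P.
Proof.
  intros H HP. assert (Hd : 0 < X - t) by lra. exists (mkposreal _ Hd). intros s Hs.
  apply HP. unfold ball in Hs. simpl in Hs. unfold AbsRing_ball, abs, minus, plus, opp in Hs. simpl in Hs.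
  apply Rabs_def2 in Hs. lra.
Qed.

Lemma Derive_eta (f : R -> R) (x l : R) : is_derive f x l -> Derive (fun y => f y) x = l.
Proof. apply is_derive_unique. Qed.

(** The real computation behind the curvature: the four functions will be the real and imaginary
    parts of [om] and [th] along a coordinate line. *)
Lemma second_derivative_ln_sum (a b c d a1 b1 c1 d1 : R -> R) (t a2 b2 c2 d2 : R) :
  locally t (fun s => is_derive a s (a1 s) /\ is_derive b s (b1 s) /\ is_derive c s (c1 s) /\
    is_derive d s (d1 s) /\ 0 < a s ^ 2 + b s ^ 2 + (c s ^ 2 + d s ^ 2)) ->
  is_derive a1 t a2 -> is_derive b1 t b2 -> is_derive c1 t c2 -> is_derive d1 t d2 ->
  Derive (fun s => Derive (fun t => ln (a t ^ 2 + b t ^ 2 + (c t ^ 2 + d t ^ 2))) s) t =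
  let N := a t ^ 2 + b t ^ 2 + (c t ^ 2 + d t ^ 2) in
  2 * (a1 t ^ 2 + b1 t ^ 2 + c1 t ^ 2 + d1 t ^ 2 + a t * a2 + b t * b2 + c t * c2 + d t * d2) / N
  - 4 * (a t * a1 t + b t * b1 t + c t * c1 t + d t * d1 t) ^ 2 / N ^ 2.
Proof.
  intros HL Ha Hb Hc Hd. cbv zeta.
  rewrite (Derive_ext_loc _ (fun s => 2 * (a s * a1 s + b s * b1 s + c s * c1 s + d s * d1 s) /
    (a s ^ 2 + b s ^ 2 + (c s ^ 2 + d s ^ 2)))).
  - apply is_derive_unique. apply locally_singleton in HL. destruct HL as (H1 & H2 & H3 & H4 & HN).
    auto_derive.
    + repeat split; try (eexists; eassumption); trivial. simpl in HN. lra.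
    + rewrite (Derive_eta _ _ _ H1), (Derive_eta _ _ _ H2), (Derive_eta _ _ _ H3),
        (Derive_eta _ _ _ H4), (Derive_eta _ _ _ Ha), (Derive_eta _ _ _ Hb),
        (Derive_eta _ _ _ Hc), (Derive_eta _ _ _ Hd).
      field. simpl in HN. lra.
  - apply filter_imp with (2 := HL). intros s (H1 & H2 & H3 & H4 & HN).
    change R in (type of s). simpl in HN. apply is_derive_unique. auto_derive.
    { repeat split; try (eexists; eassumption); trivial. }
    rewrite (Derive_eta _ _ _ H1), (Derive_eta _ _ _ H2), (Derive_eta _ _ _ H3), (Derive_eta _ _ _ H4).
    field. lra.
Qed.

Lemma lam_alt om th x y : lam om th x y =
  Re (om (x, y)) ^ 2 + Im (om (x, y)) ^ 2 + (Re (th (x, y)) ^ 2 + Im (th (x, y)) ^ 2).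
Proof. unfold lam. now rewrite !Cmod2_alt. Qed.

(* |om|^2 + |th|^2 = |om|^2 (1 + |th / om|^2), so the curvature is that of the pull-back of the Fubini-Study metric by [th / om]. *)
Lemma gauss_curv_formula (om th om1 th1 : CC -> CC) (X x y : R) :
  (forall w, Re w < X -> cder om w (om1 w)) -> (forall w, Re w < X -> cder th w (th1 w)) ->
  (forall w, Re w < X -> om w <> 0%C) -> x < X ->
  gauss_curv om th x y =
  - (2 * Cmod (om (x, y) * th1 (x, y) - th (x, y) * om1 (x, y)) ^ 2 / lam om th x y ^ 3).
Proof.
  intros Hom Hth Hn Hx.
  assert (Hd : forall h h1, (forall w, Re w < X -> cder h w (h1 w)) -> exists l, cder h1 (x, y) l).
  { intros h h1 H. apply holo_derivative_at with h (X - x); [lra|]. intros w Hw. apply H. now apply Re_near with (x, y). }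
  destruct (Hd om om1 Hom) as [om2 Hom2]. destruct (Hd th th1 Hth) as [th2 Hth2].
  assert (HN : forall x y, x < X -> 0 < Re (om (x, y)) ^ 2 + Im (om (x, y)) ^ 2 +
    (Re (th (x, y)) ^ 2 + Im (th (x, y)) ^ 2)).
  { intros s t Hs. rewrite <- !Cmod2_alt.
    assert (P : 0 < Cmod (om (s, t))) by (apply Cmod_gt_0, Hn; exact Hs).
    pose proof (pow_lt _ 2 P). pose proof (pow2_ge_0 (Cmod (th (s, t)))). lra. }
  unfold gauss_curv, laplacian.
  assert (E1 : Derive (fun s => Derive (fun t => ln (lam om th t y)) s) x = Derive (fun s => Derive (fun t =>
    ln (Re (om (t, y)) ^ 2 + Im (om (t, y)) ^ 2 + (Re (th (t, y)) ^ 2 + Im (th (t, y)) ^ 2))) s) x).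
  { apply Derive_ext. intros s. apply Derive_ext. intros t. now rewrite lam_alt. }
  assert (E2 : Derive (fun s => Derive (fun t => ln (lam om th x t)) s) y = Derive (fun s => Derive (fun t =>
    ln (Re (om (x, t)) ^ 2 + Im (om (x, t)) ^ 2 + (Re (th (x, t)) ^ 2 + Im (th (x, t)) ^ 2))) s) y).
  { apply Derive_ext. intros s. apply Derive_ext. intros t. now rewrite lam_alt. }
  rewrite E1, E2. clear E1 E2.
  rewrite (second_derivative_ln_sum _ _ _ _ (fun s => Re (om1 (s, y))) (fun s => Im (om1 (s, y)))
    (fun s => Re (th1 (s, y))) (fun s => Im (th1 (s, y))) x (Re om2) (Im om2) (Re th2) (Im th2)).
  2: { apply locally_lt with (1 := Hx). intros s Hs. split; [|split; [|split; [|split]]]; cbv beta.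
       - apply (rder_Re (fun s => om (s, y))), cder_x, Hom, Hs.
       - apply (rder_Im (fun s => om (s, y))), cder_x, Hom, Hs.
       - apply (rder_Re (fun s => th (s, y))), cder_x, Hth, Hs.
       - apply (rder_Im (fun s => th (s, y))), cder_x, Hth, Hs.
       - now apply HN. }
  2: apply (rder_Re (fun s => om1 (s, y))), cder_x, Hom2.
  2: apply (rder_Im (fun s => om1 (s, y))), cder_x, Hom2.
  2: apply (rder_Re (fun s => th1 (s, y))), cder_x, Hth2.
  2: apply (rder_Im (fun s => th1 (s, y))), cder_x, Hth2.
  (* Each derivative in y brings a factor i. The second derivatives [om2] and [th2] thus enter with
     the sign opposite to that in x and cancel in the Laplacian. *)
  rewrite (second_derivative_ln_sum _ _ _ _ (fun s => Re (Ci * om1 (x, s))) (fun s => Im (Ci * om1 (x, s)))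
    (fun s => Re (Ci * th1 (x, s))) (fun s => Im (Ci * th1 (x, s))) y
    (Re (Ci * (Ci * om2))) (Im (Ci * (Ci * om2))) (Re (Ci * (Ci * th2))) (Im (Ci * (Ci * th2)))).
  2: { apply filter_forall. intros s. split; [|split; [|split; [|split]]]; cbv beta.
       - apply (rder_Re (fun s => om (x, s))), cder_y, Hom, Hx.
       - apply (rder_Im (fun s => om (x, s))), cder_y, Hom, Hx.
       - apply (rder_Re (fun s => th (x, s))), cder_y, Hth, Hx.
       - apply (rder_Im (fun s => th (x, s))), cder_y, Hth, Hx.
       - now apply HN. }
  2-5: assert (Hmul : forall h l, cder h (x, y) l -> rder (fun s => Ci * h (x, s))%C y (Ci * (Ci * l))%C)
    by (intros h l Hl; eapply der_eq; [|apply der_mult; [apply der_const|apply cder_y, Hl]]; cbv beta; ring).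
  2: apply (rder_Re (fun s => Ci * om1 (x, s))%C), Hmul, Hom2.
  2: apply (rder_Im (fun s => Ci * om1 (x, s))%C), Hmul, Hom2.
  2: apply (rder_Re (fun s => Ci * th1 (x, s))%C), Hmul, Hth2.
  2: apply (rder_Im (fun s => Ci * th1 (x, s))%C), Hmul, Hth2.
  rewrite Cmod2_alt, lam_alt. specialize (HN x y Hx). cbv zeta.
  destruct (om (x, y)) as [o1 o2]. destruct (th (x, y)) as [p1 p2].
  destruct (om1 (x, y)) as [q1 q2]. destruct (th1 (x, y)) as [r1 r2].
  destruct om2 as [s1 s2]. destruct th2 as [u1 u2].
  unfold Re, Im, Cminus, Cplus, Copp, Cmult, Ci in *. simpl fst in *. simpl snd in *.
  field. lra.
Qed.

Lemma monotone_of_derivative (f df : R -> R) (x y : R) : x <= y ->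
  (forall t, x <= t <= y -> is_derive f t (df t)) -> (forall t, x <= t <= y -> 0 <= df t) -> f x <= f y.
Proof.
  intros Hxy Hf Hdf. destruct (MVT_gen f x y df) as [t [Ht Et]]; rewrite ?Rmin_left, ?Rmax_right in * by lra.
  - intros t Ht. apply Hf. lra.
  - intros t Ht. apply continuity_pt_filterlim, (ex_derive_continuous (V := R_NormedModule)).
    eexists. apply Hf. lra.
  - pose proof (Rmult_le_pos _ _ (Hdf t Ht) (proj1 (Rminus_le_0 x y) Hxy)). lra.
Qed.

Lemma ratio_exp_der (a b c d : R -> R) (t a' b' c' d' : R) :
  is_derive a t a' -> is_derive b t b' -> is_derive c t c' -> is_derive d t d' ->
  0 < c t ^ 2 + d t ^ 2 ->
  is_derive (fun x => (a x ^ 2 + b x ^ 2) / (c x ^ 2 + d x ^ 2) * exp (2 * x)) t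
    (2 * ((a t * a' + b t * b') * (c t ^ 2 + d t ^ 2) - (a t ^ 2 + b t ^ 2) * (c t * c' + d t * d')) /
     (c t ^ 2 + d t ^ 2) ^ 2 * exp (2 * t) + (a t ^ 2 + b t ^ 2) / (c t ^ 2 + d t ^ 2) * (2 * exp (2 * t))).
Proof.
  intros Ha Hb Hc Hd HN. simpl in HN. auto_derive.
  { repeat split; try (eexists; eassumption). lra. }
  rewrite (Derive_eta _ _ _ Ha), (Derive_eta _ _ _ Hb), (Derive_eta _ _ _ Hc), (Derive_eta _ _ _ Hd).
  field. lra.
Qed.

Section RayGrowth.
Context (f1 f2 b1 b2 : R -> CC) (X : R).
Hypothesis Hf1 : forall x, x < X -> rder f1 x (f1 x * b1 x)%C.
Hypothesis Hf2 : forall x, x < X -> rder f2 x (f2 x * b2 x)%C.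
Hypothesis Hn1 : forall x, x < X -> f1 x <> 0%C.
Hypothesis Hn2 : forall x, x < X -> f2 x <> 0%C.
Hypothesis Hb : forall x, x < X -> Re (b1 x - b2 x) <= - 1.

(* |f1 / f2|^2 exp (2 x) is nonincreasing. *)
Lemma ray_growth : exists X', X' <= X /\ forall x, x < X' -> 3 * Cmod (f2 x) ^ 2 <= Cmod (f1 x) ^ 2.
Proof.
  set (rho := fun x => (Re (f1 x) ^ 2 + Im (f1 x) ^ 2) / (Re (f2 x) ^ 2 + Im (f2 x) ^ 2) * exp (2 * x)).
  assert (N1 : forall x, x < X -> 0 < Re (f1 x) ^ 2 + Im (f1 x) ^ 2).
  { intros x Hx. rewrite <- Cmod2_alt. apply pow_lt, Cmod_gt_0. auto. }
  assert (N2 : forall x, x < X -> 0 < Re (f2 x) ^ 2 + Im (f2 x) ^ 2).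
  { intros x Hx. rewrite <- Cmod2_alt. apply pow_lt, Cmod_gt_0. auto. }
  assert (D : forall x, x < X -> is_derive rho x (2 * (Re (b1 x - b2 x) + 1) * rho x)).
  { intros x Hx. unfold rho.
    pose proof (rder_Re _ _ _ (Hf1 x Hx)) as D1. pose proof (rder_Im _ _ _ (Hf1 x Hx)) as D2.
    pose proof (rder_Re _ _ _ (Hf2 x Hx)) as D3. pose proof (rder_Im _ _ _ (Hf2 x Hx)) as D4.
    specialize (N1 x Hx). specialize (N2 x Hx).
    apply is_derive_ext with (fun x => ((fun s => Re (f1 s)) x ^ 2 + (fun s => Im (f1 s)) x ^ 2) /
      ((fun s => Re (f2 s)) x ^ 2 + (fun s => Im (f2 s)) x ^ 2) * exp (2 * x)); [reflexivity|].
    replace (2 * (Re (b1 x - b2 x) + 1) * ((Re (f1 x) ^ 2 + Im (f1 x) ^ 2) /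
      (Re (f2 x) ^ 2 + Im (f2 x) ^ 2) * exp (2 * x))) with
      (2 * ((Re (f1 x) * Re (f1 x * b1 x) + Im (f1 x) * Im (f1 x * b1 x)) * (Re (f2 x) ^ 2 + Im (f2 x) ^ 2) -
       (Re (f1 x) ^ 2 + Im (f1 x) ^ 2) * (Re (f2 x) * Re (f2 x * b2 x) + Im (f2 x) * Im (f2 x * b2 x))) /
       (Re (f2 x) ^ 2 + Im (f2 x) ^ 2) ^ 2 * exp (2 * x) +
       (Re (f1 x) ^ 2 + Im (f1 x) ^ 2) / (Re (f2 x) ^ 2 + Im (f2 x) ^ 2) * (2 * exp (2 * x))).
    - apply (ratio_exp_der (fun s => Re (f1 s)) (fun s => Im (f1 s)) (fun s => Re (f2 s))
        (fun s => Im (f2 s))); trivial.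
    - destruct (f1 x) as [p1 p2], (f2 x) as [q1 q2], (b1 x) as [s1 s2], (b2 x) as [t1 t2].
      unfold Re, Im, Cminus, Cplus, Copp, Cmult in *. simpl fst in *. simpl snd in *.
      field. lra. }
  set (x1 := X - 1).
  assert (Hrho : forall x, x < X -> 0 < rho x).
  { intros x Hx. unfold rho. apply Rmult_lt_0_compat; [|apply exp_pos]. apply Rdiv_lt_0_compat; auto. }
  assert (Mon : forall x, x < x1 -> rho x1 <= rho x).
  { intros x Hx. apply Ropp_le_cancel.
    apply (monotone_of_derivative (fun t => - rho t) (fun t => - (2 * (Re (b1 t - b2 t) + 1) * rho t))); [lra| |].
    - intros t Ht. apply (is_derive_opp (V := R_NormedModule) rho), D. unfold x1 in *; lra.
    - intros t Ht. assert (Htx : t < X) by (unfold x1 in *; lra). specialize (Hb t Htx). specialize (Hrho t Htx).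
      assert (0 <= (- Re (b1 t - b2 t) - 1) * rho t) by (apply Rmult_le_pos; lra). lra. }
  (* Below this bound [exp (2 * x)] is less than [rho x1 / 3] while [rho x] is at least [rho x1].
     The factor 3 between the squared moduli is what makes (A - B) / (A + B) at least 1/2. *)
  set (X' := Rmin x1 (ln (rho x1 / 3) / 2)).
  exists X'. split; [unfold X', x1; pose proof (Rmin_l (X - 1) (ln (rho (X - 1) / 3) / 2)); lra|].
  intros x Hx.
  assert (H1 : x < x1) by (apply Rlt_le_trans with (1 := Hx), Rmin_l).
  assert (H2 : x < ln (rho x1 / 3) / 2) by (apply Rlt_le_trans with (1 := Hx), Rmin_r).
  assert (HxX : x < X) by (unfold x1 in *; lra).
  assert (P1 : 0 < rho x1) by (apply Hrho; unfold x1; lra).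
  assert (H3 : exp (2 * x) < rho x1 / 3).
  { rewrite <- (exp_ln (rho x1 / 3)) by lra. apply exp_increasing. lra. }
  specialize (Mon x H1). unfold rho at 2 in Mon. rewrite !Cmod2_alt.
  specialize (N1 x HxX). specialize (N2 x HxX).
  set (A1 := Re (f1 x) ^ 2 + Im (f1 x) ^ 2) in *. set (A2 := Re (f2 x) ^ 2 + Im (f2 x) ^ 2) in *.
  assert (H4 : A1 / A2 * exp (2 * x) <= A1 / A2 * (rho x1 / 3)).
  { apply Rmult_le_compat_l; [left; now apply Rdiv_lt_0_compat|lra]. }
  assert (H5 : 3 * rho x1 <= A1 / A2 * rho x1) by lra.
  apply Rmult_le_reg_r in H5; trivial.
  apply (Rmult_le_compat_r A2) in H5; [|lra].
  replace (A1 / A2 * A2) with A1 in H5 by (field; lra). exact H5.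
Qed.

End RayGrowth.

(** * Completeness and total curvature *)

(** The starting points [a1] and [a2] lie [3 / delta] apart, so the two integrals up to [x0] differ
    by at least 3, although both lie within 1 of the supposed limit. *)
Lemma not_ex_RInt_gen_m_infty (I : R -> R) (X x0 delta : R) : 0 < delta ->
  (forall x, x < X -> delta <= I x) ->
  ~ ex_RInt_gen I (Rbar_locally m_infty) (at_point x0).
Proof.
  intros Hd HI [l Hl]. specialize (Hl (fun y => Rabs (y - l) < 1)).
  destruct Hl as [Q S HQ HS H].
  { exists (mkposreal 1 Rlt_0_1). intros y Hy. exact Hy. }
  destruct HQ as [M HM]. unfold at_point in HS.
  set (a1 := Rmin M X - 1). set (a2 := a1 - 3 / delta).
  pose proof (Rmin_l M X). pose proof (Rmin_r M X).
  assert (P : 0 < 3 / delta) by (apply Rdiv_lt_0_compat; lra).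
  destruct (H a1 x0) as [y1 [I1 B1]]; [apply HM; unfold a1; lra|exact HS|].
  destruct (H a2 x0) as [y2 [I2 B2]]; [apply HM; unfold a2, a1; lra|exact HS|].
  simpl in I1, I2.
  pose proof (is_RInt_Chasles _ _ _ _ _ _ I2 (is_RInt_swap _ _ _ _ I1)) as I3.
  pose proof (is_RInt_const (V := R_NormedModule) a2 a1 delta) as I4.
  assert (L : scal (a1 - a2) delta <= plus y2 (opp y1)).
  { apply (is_RInt_le (fun _ => delta) I a2 a1); trivial; [unfold a2; lra|].
    intros x Hx. apply HI. unfold a1 in Hx. lra. }
  unfold scal, plus, opp in L. simpl in L. unfold mult in L. simpl in L.
  replace ((a1 - a2) * delta) with 3 in L by (unfold a2; field; lra).
  apply Rabs_def2 in B1. apply Rabs_def2 in B2. lra.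
Qed.

Lemma rcont_Cmod f t : rcont f t -> continuous (fun s => Cmod (f s)) t.
Proof.
  intros H. apply continuous_eps. intros eps He. destruct (H eps He) as [d [Hd H1]].
  exists d. split; trivial. intros s Hs. rewrite <- Cmod_RtoC_sub in Hs. specialize (H1 s Hs).
  apply Rabs_lt_between. pose proof (Cmod_sub_ge (f s) (f t)).
  pose proof (Cmod_sub_ge (f t) (f s)). rewrite (Cmod_sym (f t)) in *. lra.
Qed.

(** The logarithmic derivative [b] is integrable towards the end. Concretely, the integrating factor
    [exp (2 * C * exp x)] makes the squared modulus nondecreasing in x, so its value at [x1] bounds
    it all the way to the left. *)
Lemma bounded_on_ray (f b : R -> CC) (X C : R) : 0 < C ->
  (forall x, x < X -> rder f x (f x * b x)%C) -> (forall x, x < X -> Cmod (b x) <= C * exp x) ->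
  exists M, forall x, x < X - 1 -> Cmod (f x) <= M.
Proof.
  intros HC Hf Hb. set (x1 := X - 1).
  set (rho := fun x => (Re (f x) ^ 2 + Im (f x) ^ 2) * exp (2 * C * exp x)).
  assert (D : forall x, x < X -> is_derive rho x (2 * (Re (b x) + C * exp x) * rho x)).
  { intros x Hx. unfold rho.
    pose proof (rder_Re _ _ _ (Hf x Hx)) as D1. pose proof (rder_Im _ _ _ (Hf x Hx)) as D2.
    assert (G : forall (p q : R -> R) p' q', is_derive p x p' -> is_derive q x q' ->
      is_derive (fun x => (p x ^ 2 + q x ^ 2) * exp (2 * C * exp x)) x
        (2 * (p x * p' + q x * q' + C * exp x * (p x ^ 2 + q x ^ 2)) * exp (2 * C * exp x))).
    { intros p q p' q' Hp Hq. auto_derive; [repeat split; eexists; eassumption|].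
      rewrite (Derive_eta _ _ _ Hp), (Derive_eta _ _ _ Hq). ring. }
    specialize (G _ _ _ _ D1 D2). cbv beta in G.
    replace (2 * (Re (b x) + C * exp x) * ((Re (f x) ^ 2 + Im (f x) ^ 2) * exp (2 * C * exp x)))
      with (2 * (Re (f x) * Re (f x * b x) + Im (f x) * Im (f x * b x) +
        C * exp x * (Re (f x) ^ 2 + Im (f x) ^ 2)) * exp (2 * C * exp x)) by parts.
    exact G. }
  assert (Pr : forall x, 0 <= rho x).
  { intros x. apply Rmult_le_pos; [|left; apply exp_pos]. rewrite <- Cmod2_alt. apply pow2_ge_0. }
  exists (rho x1 + 1). intros x Hx. fold x1 in Hx.
  assert (Mon : rho x <= rho x1).
  { apply (monotone_of_derivative rho (fun t => 2 * (Re (b t) + C * exp t) * rho t)); [lra| |].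
    - intros t Ht. apply D. unfold x1 in *; lra.
    - intros t Ht. apply Rmult_le_pos; [|apply Pr].
      specialize (Hb t ltac:(unfold x1 in *; lra)). pose proof (re_le_Cmod (b t)).
      pose proof (Rcomplements.Rabs_maj2 (Re (b t))). lra. }
  assert (Sq : Cmod (f x) ^ 2 <= rho x).
  { rewrite Cmod2_alt. unfold rho. rewrite <- (Rmult_1_r (Re (f x) ^ 2 + Im (f x) ^ 2)) at 1.
    apply Rmult_le_compat_l; [rewrite <- Cmod2_alt; apply pow2_ge_0|].
    rewrite <- exp_0. apply Rlt_le, exp_increasing. pose proof (exp_pos x).
    apply Rmult_lt_0_compat; lra. }
  (* A nonnegative number whose square is at most R is at most R + 1. *)
  pose proof (Cmod_ge_0 (f x)). specialize (Pr x1).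
  apply Rnot_lt_le. intros Hc.
  assert ((rho x1 + 1) * (rho x1 + 1) <= Cmod (f x) ^ 2)
    by (simpl; rewrite Rmult_1_r; apply Rmult_le_compat; lra).
  assert (0 <= rho x1 * rho x1) by (apply Rmult_le_pos; lra). lra.
Qed.

(** The path [g1] is the segment z = exp (X - 1) (1 - t), run at constant speed to 0. The decay
    [exp (g1 t)] of the metric cancels the speed [/ (1 - t)] in w, so the length never exceeds
    [K]. *)
Lemma incomplete_of_decay (om th : CC -> CC) (X C : R) : X <= 0 -> 0 < C ->
  (forall x, x < X -> rcont (fun s => om (s, 0)) x) -> (forall x, x < X -> rcont (fun s => th (s, 0)) x) ->
  (forall x, x < X -> sqrt (lam om th x 0) <= C * exp x) -> ~ complete_at_0 om th.
Proof.
  intros HX HC Hom Hth Hlam Hcomp.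
  set (g1 := fun t : R => X - 1 + ln (1 - t)). set (g2 := fun _ : R => 0).
  assert (D1 : forall t, t < 1 -> is_derive g1 t (- / (1 - t))).
  { intros t Ht. unfold g1. auto_derive; [lra|]. field. lra. }
  assert (D2 : forall t, is_derive g2 t 0) by (intros t; apply (is_derive_const (V := R_NormedModule))).
  assert (g1X : forall t, 0 <= t < 1 -> g1 t < X).
  { intros t Ht. unfold g1. assert (ln (1 - t) <= ln 1) by (apply ln_le; lra).
    rewrite ln_1 in *. lra. }
  assert (C1 : forall t, t < 1 -> continuous (Derive g1) t).
  { intros t Ht. apply continuous_ext_loc with (fun s => - / (1 - s)).
    - apply locally_lt with (1 := Ht). intros s Hs. symmetry. now apply is_derive_unique, D1.
    - apply (ex_derive_continuous (V := R_NormedModule)). auto_derive. lra. }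
  assert (C2 : forall t, continuous (Derive g2) t).
  { intros t. apply continuous_ext with (fun _ => 0); [|apply continuous_const].
    intros s. symmetry. apply is_derive_unique, D2. }
  assert (Hlim := Hcomp g1 g2).
  assert (L1 : filterlim g1 (at_left 1) (Rbar_locally m_infty)).
  { intros P [M HM]. unfold filtermap, at_left, within.
    assert (Pe : 0 < exp (M - X)) by apply exp_pos.
    exists (mkposreal _ Pe). intros t Ht Hlt. apply HM. unfold g1.
    unfold ball in Ht. simpl in Ht. unfold AbsRing_ball, abs, minus, plus, opp in Ht. simpl in Ht.
    apply Rabs_def2 in Ht.
    assert (ln (1 - t) < ln (exp (M - X))) by (apply ln_increasing; lra).
    rewrite ln_exp in *. lra. }
  specialize (Hlim ltac:(intros t Ht; specialize (g1X t Ht); repeat split;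
    [lra|eexists; apply D1; lra|eexists; apply D2|apply C1; lra|apply C2]) L1). clear Hcomp L1.
  set (K := C * exp (X - 1)).
  set (F := fun t => sqrt (lam om th (g1 t) (g2 t)) * sqrt (Derive g1 t ^ 2 + Derive g2 t ^ 2)) in *.
  assert (HF : forall t, 0 <= t < 1 -> F t <= K).
  { intros t Ht. unfold F. rewrite (is_derive_unique _ _ _ (D1 t ltac:(lra))), (is_derive_unique _ _ _ (D2 t)).
    replace ((- / (1 - t)) ^ 2 + 0 ^ 2) with (/ (1 - t) * / (1 - t)) by ring.
    assert (P : 0 < / (1 - t)) by (apply Rinv_0_lt_compat; lra).
    rewrite sqrt_square by lra.
    apply Rle_trans with (C * exp (g1 t) * / (1 - t)).
    - apply Rmult_le_compat_r; [lra|]. apply Hlam. now apply g1X.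
    - unfold g1. rewrite exp_plus, exp_ln by lra. right. unfold K. field. lra. }
  assert (CF : forall t, 0 <= t < 1 -> continuous F t).
  { intros t Ht. unfold F. apply (continuous_mult (K := R_AbsRing)).
    - apply (continuous_comp (fun t => lam om th (g1 t) (g2 t)) sqrt); [|apply continuous_sqrt].
      assert (G1 : continuous g1 t) by (apply (ex_derive_continuous (V := R_NormedModule)); eexists; apply D1; lra).
      assert (Sq : forall h : CC -> CC, (forall x, x < X -> rcont (fun s => h (s, 0)) x) ->
        continuous (fun t => Cmod (h (g1 t, g2 t)) ^ 2) t).
      { intros h Hh. apply (continuous_comp g1 (fun x => Cmod (h (x, 0)) ^ 2)); trivial.
        apply (continuous_comp (fun x => Cmod (h (x, 0))) (fun y => y ^ 2)).
        - apply rcont_Cmod, Hh. now apply g1X.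
        - apply (ex_derive_continuous (V := R_NormedModule)). auto_derive. trivial. }
      unfold lam. apply (continuous_plus (V := R_NormedModule)); now apply Sq.
    - apply (continuous_comp (fun t => Derive g1 t ^ 2 + Derive g2 t ^ 2) sqrt); [|apply continuous_sqrt].
      assert (Sq : forall h : R -> R, continuous h t -> continuous (fun t => h t ^ 2) t).
      { intros h Hh. apply (continuous_comp h (fun y => y ^ 2)); trivial.
        apply (ex_derive_continuous (V := R_NormedModule)). auto_derive. trivial. }
      apply (continuous_plus (V := R_NormedModule)); apply Sq; [apply C1; lra|apply C2]. }
  assert (BI : forall s, 0 <= s < 1 -> RInt F 0 s <= K).
  { intros s Hs. assert (HK : 0 < K) by (apply Rmult_lt_0_compat; [lra|apply exp_pos]).
    apply Rle_trans with (RInt (fun _ => K) 0 s).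
    - apply RInt_le; [lra| |apply ex_RInt_const|intros x Hx; apply HF; lra].
      apply (ex_RInt_continuous (V := R_CompleteNormedModule)). intros t Ht.
      rewrite Rmin_left, Rmax_right in Ht by lra. apply CF. lra.
    - rewrite RInt_const. unfold scal. simpl. unfold mult. simpl.
      rewrite <- (Rmult_1_l K) at 2. apply Rmult_le_compat_r; lra. }
  assert (HP : Rbar_locally p_infty (fun y => K < y)) by (exists K; trivial).
  specialize (Hlim _ HP). unfold filtermap, at_left, within in Hlim. destruct Hlim as [d Hd].
  set (s := 1 - Rmin (d / 2) (1 / 2)).
  pose proof (cond_pos d). pose proof (Rmin_l (d / 2) (1 / 2)). pose proof (Rmin_r (d / 2) (1 / 2)).
  assert (0 < Rmin (d / 2) (1 / 2)) by (apply Rmin_pos; lra).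
  assert (K < RInt F 0 s).
  { apply Hd; [|unfold s; lra]. unfold ball. simpl. unfold AbsRing_ball, abs, minus, plus, opp. simpl.
    apply Rabs_def1; unfold s; lra. }
  specialize (BI s ltac:(unfold s; lra)). lra.
Qed.

(** * Essential singularities *)

Lemma cis_mult a b : (cis a * cis b)%C = cis (a + b).
Proof. unfold cis, Cmult. simpl. rewrite cos_plus, sin_plus. f_equal; ring. Qed.

Lemma cexp_pow_xy (x y : R) n : (cexp (x, y) ^ n)%C = (exp (INR n * x) * cis (INR n * y))%C.
Proof.
  induction n as [|n IH].
  - simpl. rewrite !Rmult_0_l, exp_0. unfold cis. rewrite cos_0, sin_0.
    unfold RtoC, Cmult. simpl. f_equal; ring.
  - rewrite Cpow_S, IH, cexp_cis, S_INR. simpl Re. simpl Im.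
    replace ((INR n + 1) * x) with (x + INR n * x) by ring.
    replace ((INR n + 1) * y) with (y + INR n * y) by ring.
    rewrite exp_plus, <- cis_mult, RtoC_mult. ring.
Qed.

Lemma cis_0 : cis 0 = 1%C.
Proof. unfold cis. now rewrite cos_0, sin_0. Qed.

(** Turning [tau] = a + i b by quarter turns gives the real parts a, b, -a, -b, among which both
    signs occur. The angles are multiples of pi / 2 divided by [n], hence still within one
    period. *)
Lemma rotation_signs (n : nat) (tau : CC) : (1 <= n)%nat -> tau <> 0%C ->
  exists y1 y2, 0 <= y1 <= 2 * PI /\ 0 <= y2 <= 2 * PI /\
    0 < Re (cis (- (INR n * y1)) * tau) /\ Re (cis (- (INR n * y2)) * tau) < 0.
Proof.
  intros Hn Ht. pose proof PI_RGT_0 as P.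
  assert (Hn1 : 1 <= INR n) by (apply (le_INR 1 n Hn)).
  assert (Hy : forall c, 0 <= c <= 2 * PI -> 0 <= c / INR n <= 2 * PI).
  { intros c Hc. split.
    - apply Rmult_le_pos; [lra|left; apply Rinv_0_lt_compat; lra].
    - apply Rle_trans with c; [|lra]. apply Rmult_le_reg_r with (INR n); [lra|].
      unfold Rdiv. rewrite Rmult_assoc, Rinv_l, Rmult_1_r by lra.
      rewrite <- (Rmult_1_r c) at 1. apply Rmult_le_compat_l; lra. }
  assert (Ey : forall c, cis (- (INR n * (c / INR n))) = cis (- c)).
  { intros c. f_equal. field. lra. }
  destruct tau as [a b].
  assert (R0 : Re (cis (- 0) * (a, b)) = a).
  { rewrite Ropp_0, cis_0. unfold Re, Cmult, RtoC. simpl. ring. }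
  assert (R1 : Re (cis (- (PI / 2)) * (a, b)) = b).
  { unfold cis. rewrite cos_neg, sin_neg, cos_PI2, sin_PI2. unfold Re, Cmult. simpl. ring. }
  assert (R2 : Re (cis (- PI) * (a, b)) = - a).
  { unfold cis. rewrite cos_neg, sin_neg, cos_PI, sin_PI. unfold Re, Cmult. simpl. ring. }
  assert (R3 : Re (cis (- (3 * (PI / 2))) * (a, b)) = - b).
  { unfold cis. rewrite cos_neg, sin_neg, cos_3PI2, sin_3PI2. unfold Re, Cmult. simpl. ring. }
  destruct (Rtotal_order a 0) as [A|[A|A]].
  - exists (PI / INR n), (0 / INR n). rewrite !Ey, R0, R2.
    repeat split; try (apply Hy; lra); lra.
  - destruct (Rtotal_order b 0) as [B|[B|B]].
    + exists (3 * (PI / 2) / INR n), (PI / 2 / INR n). rewrite !Ey, R1, R3.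
      repeat split; try (apply Hy; lra); lra.
    + exfalso. apply Ht. now rewrite A, B.
    + exists (PI / 2 / INR n), (3 * (PI / 2) / INR n). rewrite !Ey, R1, R3.
      repeat split; try (apply Hy; lra); lra.
  - exists (0 / INR n), (PI / INR n). rewrite !Ey, R0, R2.
    repeat split; try (apply Hy; lra); lra.
Qed.

Lemma norm_contrast_der (a b c d : R -> R) (t a' b' c' d' : R) :
  is_derive a t a' -> is_derive b t b' -> is_derive c t c' -> is_derive d t d' ->
  0 < a t ^ 2 + b t ^ 2 + (c t ^ 2 + d t ^ 2) ->
  is_derive (fun x => ((c x ^ 2 + d x ^ 2) - (a x ^ 2 + b x ^ 2)) / (a x ^ 2 + b x ^ 2 + (c x ^ 2 + d x ^ 2))) t
    (4 * ((c t * c' + d t * d') * (a t ^ 2 + b t ^ 2) - (c t ^ 2 + d t ^ 2) * (a t * a' + b t * b')) /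
     (a t ^ 2 + b t ^ 2 + (c t ^ 2 + d t ^ 2)) ^ 2).
Proof.
  intros Ha Hb Hc Hd HN. simpl in HN. auto_derive.
  { repeat split; try (eexists; eassumption). lra. }
  rewrite (Derive_eta _ _ _ Ha), (Derive_eta _ _ _ Hb), (Derive_eta _ _ _ Hc), (Derive_eta _ _ _ Hd).
  field. lra.
Qed.

Section EssentialEnd.
Context (om th a b : CC -> CC) (tau : CC -> CC) (n : nat) (X : R).
Hypothesis Hn : (1 <= n)%nat.
Hypothesis Hom : forall w, Re w < X -> cder om w (om w * a w)%C.
Hypothesis Hth : forall w, Re w < X -> cder th w (th w * b w)%C.
Hypothesis Nom : forall w, Re w < X -> om w <> 0%C.
Hypothesis Nth : forall w, Re w < X -> th w <> 0%C.
Hypothesis Htau : forall w, Re w < X -> ((b w - a w) * cexp w ^ n = tau (cexp w))%C.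
Hypothesis Ctau : ccont tau 0.
Hypothesis Ntau : tau 0%C <> 0%C.

(** [b - a] is the logarithmic derivative of [th / om], with a pole of order [n] in z. In polar form
    the direction [y] alone decides the sign of its real part near the end, up to the continuity of
    [tau]. *)
Lemma log_ratio_der_xy (x y : R) : x < X ->
  (b (x, y) - a (x, y))%C = (exp (- (INR n * x)) * (cis (- (INR n * y)) * tau (cexp (x, y))))%C.
Proof.
  intros Hx. rewrite <- Htau, cexp_pow_xy by exact Hx.
  replace (exp (- (INR n * x)) * (cis (- (INR n * y)) * ((b (x, y) - a (x, y)) *
    (exp (INR n * x) * cis (INR n * y)))))%C with ((b (x, y) - a (x, y)) *
    (RtoC (exp (- (INR n * x))) * RtoC (exp (INR n * x))) * (cis (- (INR n * y)) * cis (INR n * y)))%C by ring.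
  rewrite <- RtoC_mult, <- exp_plus, cis_mult, !Rplus_opp_l, exp_0, cis_0. ring.
Qed.

Lemma exp_large (c : R) : 0 < c -> exists X', X' <= X /\ forall x, x < X' -> 1 <= exp (- (INR n * x)) * c.
Proof.
  intros Hc. exists (Rmin X (Rmin 0 (ln c))).
  split; [apply Rmin_l|]. intros x Hx.
  assert (Hx0 : x < 0) by (apply Rlt_le_trans with (1 := Hx), Rle_trans with (1 := Rmin_r _ _), Rmin_l).
  assert (Hxc : x < ln c) by (apply Rlt_le_trans with (1 := Hx), Rle_trans with (1 := Rmin_r _ _), Rmin_r).
  assert (Hn1 : 1 <= INR n) by (apply (le_INR 1 n Hn)).
  assert (H1 : - x <= - (INR n * x)).
  { assert ((INR n - 1) * (- x) >= 0) by (apply Rle_ge, Rmult_le_pos; lra). lra. }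
  assert (H2 : exp (- x) <= exp (- (INR n * x))).
  { destruct H1 as [H1| ->]; [left; now apply exp_increasing|lra]. }
  assert (H3 : exp x < c) by (rewrite <- (exp_ln c Hc); now apply exp_increasing).
  rewrite exp_Ropp in H2. pose proof (exp_pos x) as P.
  apply Rle_trans with (/ exp x * c).
  - apply Rmult_le_reg_l with (exp x); trivial. rewrite <- Rmult_assoc, Rinv_r by lra. lra.
  - apply Rmult_le_compat_r; lra.
Qed.

Lemma log_ratio_der_large : exists X', X' <= X /\ forall x y, x < X' ->
  1 <= Cmod (b (x, y) - a (x, y)).
Proof.
  pose proof Ntau as P. apply Cmod_gt_0 in P.
  destruct (ccont_end tau (Cmod (tau 0%C) / 2) Ctau) as [M HM]; [lra|].
  destruct (exp_large (Cmod (tau 0%C) / 2)) as [X' [HX' H]]; [lra|].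
  exists (Rmin X' M). split; [apply Rle_trans with (1 := Rmin_l _ _); trivial|].
  intros x y Hx. destruct (Rmin_Rgt_l _ _ _ Hx) as [H1 H2].
  rewrite log_ratio_der_xy by lra.
  rewrite !Cmod_mult, Cmod_cis, Rmult_1_l, Cmod_R, Rabs_pos_eq by (left; apply exp_pos).
  apply Rle_trans with (1 := H x H1). apply Rmult_le_compat_l; [left; apply exp_pos|].
  specialize (HM (x, y) H2). rewrite Cmod_sym in HM. pose proof (Cmod_sub_ge (tau 0%C) (tau (cexp (x, y)))).
  lra.
Qed.

(** Near the end [tau] is so close to its value at 0 that half of the real part survives, and the
    factor exp (-n x) raises it above 1. The sign [sgn] treats the growing and the decaying ray
    together. *)
Lemma log_ratio_der_ray (sgn y : R) : (sgn = 1 \/ sgn = - 1) ->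
  0 < sgn * Re (cis (- (INR n * y)) * tau 0%C) ->
  exists X', X' <= X /\ forall x, x < X' -> 1 <= sgn * Re (b (x, y) - a (x, y)).
Proof.
  intros Hsgn P. set (c := sgn * Re (cis (- (INR n * y)) * tau 0%C)) in *.
  destruct (ccont_end tau (c / 2) Ctau) as [M HM]; [lra|].
  destruct (exp_large (c / 2)) as [X' [HX' H]]; [lra|].
  exists (Rmin X' M). split; [apply Rle_trans with (1 := Rmin_l _ _); trivial|].
  intros x Hx. destruct (Rmin_Rgt_l _ _ _ Hx) as [H1 H2].
  rewrite log_ratio_der_xy by lra.
  specialize (HM (x, y) H2).
  set (q := (cis (- (INR n * y)) * tau (cexp (x, y)))%C).
  replace (sgn * Re (exp (- (INR n * x)) * q)) with (exp (- (INR n * x)) * (sgn * Re q)) by parts.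
  apply Rle_trans with (1 := H x H1). apply Rmult_le_compat_l; [left; apply exp_pos|].
  assert (Hq : Rabs (Re (q - cis (- (INR n * y)) * tau 0%C)) < c / 2).
  { apply Rle_lt_trans with (1 := re_le_Cmod _). unfold q.
    replace (cis (- (INR n * y)) * tau (cexp (x, y)) - cis (- (INR n * y)) * tau 0%C)%C
      with (cis (- (INR n * y)) * (tau (cexp (x, y)) - tau 0%C))%C by ring.
    now rewrite Cmod_mult, Cmod_cis, Rmult_1_l. }
  replace (Re (q - cis (- (INR n * y)) * tau 0%C)) with (Re q - Re (cis (- (INR n * y)) * tau 0%C)) in Hq by parts.
  apply Rabs_def2 in Hq. unfold c in *. destruct Hsgn; subst sgn; lra.
Qed.

(** With t = th / om this is (|t|^2 - 1) / (|t|^2 + 1), the height of t on the unit sphere under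
    stereographic projection. *)
Definition contrast (x y : R) : R :=
  ((Re (th (x, y)) ^ 2 + Im (th (x, y)) ^ 2) - (Re (om (x, y)) ^ 2 + Im (om (x, y)) ^ 2)) / lam om th x y.

(** Twice |t'|^2 / (1 + |t|^2)^2 for t = th / om, where t' = t (b - a). *)
Definition curv_density (x y : R) : R :=
  2 * (Cmod (om (x, y)) ^ 2 * Cmod (th (x, y)) ^ 2) * Cmod (b (x, y) - a (x, y)) ^ 2 / lam om th x y ^ 2.

Definition contrast_der (x y : R) : R :=
  - 4 * (Cmod (om (x, y)) ^ 2 * Cmod (th (x, y)) ^ 2) * Im (b (x, y) - a (x, y)) / lam om th x y ^ 2.

Lemma lam_pos (x y : R) : x < X -> 0 < lam om th x y.
Proof.
  intros Hx. unfold lam.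
  assert (P : 0 < Cmod (om (x, y))) by (apply Cmod_gt_0, Nom; exact Hx).
  pose proof (pow_lt _ 2 P). pose proof (pow2_ge_0 (Cmod (th (x, y)))). lra.
Qed.

Lemma abs_curv_density (x y : R) : x < X ->
  Rabs (gauss_curv om th x y) * lam om th x y = curv_density x y.
Proof.
  intros Hx. pose proof (lam_pos x y Hx) as P.
  rewrite (gauss_curv_formula om th (fun w => om w * a w)%C (fun w => th w * b w)%C X) by trivial.
  replace (om (x, y) * (th (x, y) * b (x, y)) - th (x, y) * (om (x, y) * a (x, y)))%C
    with (om (x, y) * th (x, y) * (b (x, y) - a (x, y)))%C by ring.
  rewrite !Cmod_mult, Rabs_Ropp, Rabs_pos_eq.
  - unfold curv_density. field. lra.
  - apply Rmult_le_pos; [apply Rmult_le_pos; [lra|apply pow2_ge_0]|].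
    left. apply Rinv_0_lt_compat. now apply pow_lt.
Qed.

Lemma contrast_is_derive (x y : R) : x < X -> is_derive (contrast x) y (contrast_der x y).
Proof.
  intros Hx. pose proof (lam_pos x y Hx) as P. rewrite lam_alt in P.
  pose proof (cder_y om x y _ (Hom (x, y) Hx)) as D1. pose proof (cder_y th x y _ (Hth (x, y) Hx)) as D2.
  apply is_derive_ext with (fun t => ((Re (th (x, t)) ^ 2 + Im (th (x, t)) ^ 2) -
    (Re (om (x, t)) ^ 2 + Im (om (x, t)) ^ 2)) /
    (Re (om (x, t)) ^ 2 + Im (om (x, t)) ^ 2 + (Re (th (x, t)) ^ 2 + Im (th (x, t)) ^ 2))).
  { intros t. unfold contrast. now rewrite lam_alt. }
  pose proof (norm_contrast_der (fun t => Re (om (x, t))) (fun t => Im (om (x, t)))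
    (fun t => Re (th (x, t))) (fun t => Im (th (x, t))) y _ _ _ _
    (rder_Re _ _ _ D1) (rder_Im _ _ _ D1) (rder_Re _ _ _ D2) (rder_Im _ _ _ D2) P) as H.
  cbv beta in H.
  match type of H with is_derive _ _ ?v => replace (contrast_der x y) with v; [exact H|] end.
  unfold contrast_der. rewrite lam_alt, !Cmod2_alt.
  destruct (om (x, y)) as [p1 p2], (th (x, y)) as [q1 q2], (a (x, y)) as [s1 s2], (b (x, y)) as [t1 t2].
  unfold Re, Im, Cminus, Cplus, Copp, Cmult, Ci in *. simpl fst in *. simpl snd in *.
  field. lra.
Qed.

(** [c] is f' / f, and f' is differentiable because [f] is holomorphic on a half plane. *)
Lemma log_der_cont (f c : CC -> CC) : (forall w, Re w < X -> f w <> 0%C) ->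
  (forall w, Re w < X -> cder f w (f w * c w)%C) -> forall w, Re w < X -> ccont c w.
Proof.
  intros Nf Hf w Hw.
  destruct (holo_derivative_at f (fun u => f u * c u)%C w (X - Re w)) as [l Hl]; [lra| |].
  { intros u Hu. apply Hf. now apply Re_near with w. }
  apply der_ctn in Hl. pose proof (der_ctn _ _ _ _ (Hf w Hw)) as Cf.
  pose proof (ctn_div idC _ _ w (Nf w Hw) Hl Cf) as H. cbv beta in H.
  intros eps He. destruct (H eps He) as [d [Hd B]].
  exists (Rmin d (X - Re w)). split; [apply Rmin_pos; lra|]. intros u Hu. unfold idC in *.
  destruct (Rmin_Rgt_l _ _ _ Hu) as [H1 H2].
  specialize (B u H1). pose proof (Nf u (Re_near _ _ _ H2)). pose proof (Nf w Hw).
  replace (c u - c w)%C with (f u * c u / f u - f w * c w / f w)%C by (field; auto). exact B.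
Qed.

Lemma y_cont (f : CC -> CC) (x y : R) : ccont f (x, y) -> rcont (fun t => f (x, t)) y.
Proof.
  intros H. apply (ctn_comp RtoC f (fun t : R => (x, t))); trivial. eapply der_ctn, path_y_der.
Qed.

Lemma curv_density_pieces_cont (x y : R) : x < X ->
  continuous (curv_density x) y /\ continuous (contrast_der x) y.
Proof.
  intros Hx. pose proof (lam_pos x y Hx) as P.
  assert (Com : rcont (fun t => om (x, t)) y) by (eapply y_cont, der_ctn, Hom; exact Hx).
  assert (Cth : rcont (fun t => th (x, t)) y) by (eapply y_cont, der_ctn, Hth; exact Hx).
  assert (Cb : rcont (fun t => b (x, t) - a (x, t))%C y).
  { apply ctn_minus; apply y_cont.
    - apply (log_der_cont th b); trivial.
    - apply (log_der_cont om a); trivial. }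
  assert (Sq : forall f, rcont f y -> continuous (fun t => Cmod (f t) ^ 2) y).
  { intros f Hf. apply (continuous_comp (fun t => Cmod (f t)) (fun u => u ^ 2)); [now apply rcont_Cmod|].
    apply (ex_derive_continuous (V := R_NormedModule)). auto_derive. trivial. }
  assert (CL : continuous (fun t => / lam om th x t ^ 2) y).
  { apply (continuous_comp (fun t => lam om th x t) (fun u => / u ^ 2)).
    - apply (continuous_plus (V := R_NormedModule)); [apply (Sq _ Com)|apply (Sq _ Cth)].
    - apply (ex_derive_continuous (V := R_NormedModule)). auto_derive.
      pose proof (pow_lt _ 2 P) as P2. simpl in P2. lra. }
  assert (Cot : continuous (fun t => Cmod (om (x, t)) ^ 2 * Cmod (th (x, t)) ^ 2) y)
    by (apply (continuous_mult (K := R_AbsRing)); [apply (Sq _ Com)|apply (Sq _ Cth)]).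
  split; apply (continuous_mult (K := R_AbsRing)); trivial; apply (continuous_mult (K := R_AbsRing)).
  - apply (continuous_mult (K := R_AbsRing)); trivial. apply continuous_const.
  - apply (Sq _ Cb).
  - apply (continuous_mult (K := R_AbsRing)); trivial. apply continuous_const.
  - now apply rcont_iff in Cb.
Qed.

(** The slope of the height is of first order in |b - a| and the density of second order with the
    same weight, so the assumption that |b - a| is at least 1 lets the density dominate. *)
Lemma curv_density_ge (x y : R) : x < X -> 1 <= Cmod (b (x, y) - a (x, y)) ->
  Rabs (contrast_der x y) <= 2 * curv_density x y.
Proof.
  intros Hx HT. pose proof (lam_pos x y Hx) as P. pose proof (pow_lt _ 2 P) as P2.
  unfold contrast_der, curv_density.
  set (A := Cmod (om (x, y)) ^ 2 * Cmod (th (x, y)) ^ 2).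
  assert (HA : 0 <= A) by (apply Rmult_le_pos; apply pow2_ge_0).
  unfold Rdiv. rewrite !Rabs_mult, (Rabs_pos_eq (/ _)) by (left; now apply Rinv_0_lt_compat).
  rewrite <- Rmult_assoc. apply Rmult_le_compat_r; [left; now apply Rinv_0_lt_compat|].
  replace (Rabs (- 4)) with 4 by (rewrite Rabs_left; lra). rewrite (Rabs_pos_eq A) by trivial.
  replace (2 * (2 * A * Cmod (b (x, y) - a (x, y)) ^ 2))
    with (4 * A * (Cmod (b (x, y) - a (x, y)) * Cmod (b (x, y) - a (x, y)))) by ring.
  apply Rmult_le_compat_l; [lra|].
  apply Rle_trans with (1 := im_le_Cmod _).
  rewrite <- (Rmult_1_l (Cmod (b (x, y) - a (x, y)))) at 1. apply Rmult_le_compat_r; lra.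
Qed.

(** The change of height along an arc is at most the integral of its slope; the density, being
    nonnegative, may then be integrated over the whole circle. *)
Lemma curv_density_integral (x lo hi : R) : x < X -> (forall y, 1 <= Cmod (b (x, y) - a (x, y))) ->
  0 <= lo <= hi -> hi <= 2 * PI ->
  Rabs (contrast x hi - contrast x lo) <= 2 * RInt (curv_density x) 0 (2 * PI).
Proof.
  intros Hx HT Hlo Hhi.
  assert (Cc : forall y, continuous (curv_density x) y) by (intros y; now apply curv_density_pieces_cont).
  assert (Cd : forall y, continuous (contrast_der x) y) by (intros y; now apply curv_density_pieces_cont).
  assert (Ec : forall u v, ex_RInt (curv_density x) u v)
    by (intros u v; apply (ex_RInt_continuous (V := R_CompleteNormedModule)); auto).
  assert (Pc : forall y, 0 <= curv_density x y).
  { intros y. pose proof (curv_density_ge x y Hx (HT y)). pose proof (Rabs_pos (contrast_der x y)). lra. }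
  assert (I1 : is_RInt (contrast_der x) lo hi (contrast x hi - contrast x lo)).
  { apply (is_RInt_derive (V := R_CompleteNormedModule) (contrast x) (contrast_der x)).
    - intros y _. now apply contrast_is_derive.
    - intros y _. apply Cd. }
  apply Rle_trans with (2 * RInt (curv_density x) lo hi).
  - apply (norm_RInt_le (V := R_NormedModule) (contrast_der x) (fun y => 2 * curv_density x y) lo hi); trivial; [lra| |].
    + intros y Hy. now apply curv_density_ge.
    + apply (is_RInt_scal (V := R_NormedModule)), (RInt_correct (V := R_CompleteNormedModule)), Ec.
  - apply Rmult_le_compat_l; [lra|].
    rewrite <- (RInt_Chasles (V := R_CompleteNormedModule) (curv_density x) 0 lo (2 * PI)) by apply Ec.
    rewrite <- (RInt_Chasles (V := R_CompleteNormedModule) (curv_density x) lo hi (2 * PI)) by apply Ec.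
    assert (0 <= RInt (curv_density x) 0 lo) by (apply RInt_ge_0; auto; lra).
    assert (0 <= RInt (curv_density x) hi (2 * PI)) by (apply RInt_ge_0; auto; lra).
    unfold plus. simpl. lra.
Qed.

(* On two rays [th / om] tends to infinity and to zero; so it sweeps out a fixed area between them on each circle, and this area is not summable over the circles. *)
Lemma essential_end_infinite_curvature : ~ finite_total_curv_at_0 om th.
Proof.
  intros [x0 [_ Hint]].
  destruct (rotation_signs n (tau 0%C) Hn Ntau) as (y1 & y2 & B1 & B2 & S1 & S2).
  destruct (log_ratio_der_ray 1 y1) as [X1 [HX1 R1]]; [now left|lra|].
  destruct (log_ratio_der_ray (-1) y2) as [X2 [HX2 R2]]; [now right|lra|].
  destruct log_ratio_der_large as [X3 [HX3 R3]].
  assert (Ray : forall f c : CC -> CC, (forall w, Re w < X -> cder f w (f w * c w)%C) ->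
    forall y x, x < X -> rder (fun s => f (s, y)) x (f (x, y) * c (x, y))%C)
    by (intros f c Hf y x Hx; apply cder_x, Hf, Hx).
  destruct (ray_growth (fun x => om (x, y1)) (fun x => th (x, y1)) (fun x => a (x, y1))
    (fun x => b (x, y1)) X1) as [X4 [HX4 G1]].
  { intros x Hx. apply (Ray om a); trivial. lra. }
  { intros x Hx. apply (Ray th b); trivial. lra. }
  { intros x Hx. apply Nom. simpl. lra. }
  { intros x Hx. apply Nth. simpl. lra. }
  { intros x Hx. specialize (R1 x Hx).
    replace (Re (a (x, y1) - b (x, y1))) with (- (1 * Re (b (x, y1) - a (x, y1)))) by parts. lra. }
  destruct (ray_growth (fun x => th (x, y2)) (fun x => om (x, y2)) (fun x => b (x, y2))
    (fun x => a (x, y2)) X2) as [X5 [HX5 G2]].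
  { intros x Hx. apply (Ray th b); trivial. lra. }
  { intros x Hx. apply (Ray om a); trivial. lra. }
  { intros x Hx. apply Nth. simpl. lra. }
  { intros x Hx. apply Nom. simpl. lra. }
  { intros x Hx. specialize (R2 x Hx). lra. }
  (* Between the two rays the height changes by at least 1, from at most -1/2 to at least 1/2; the
     factor 2 in the arc estimate leaves 1/2 for each circle. *)
  apply (not_ex_RInt_gen_m_infty _ (Rmin X3 (Rmin X4 X5)) x0 (1 / 2)) in Hint; trivial; [lra|].
  intros x Hx.
  pose proof (Rmin_l X3 (Rmin X4 X5)). pose proof (Rmin_r X3 (Rmin X4 X5)).
  pose proof (Rmin_l X4 X5). pose proof (Rmin_r X4 X5).
  assert (HxX : x < X) by lra.
  rewrite (RInt_ext _ (curv_density x)) by (intros y _; now apply abs_curv_density).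
  specialize (G1 x ltac:(lra)). specialize (G2 x ltac:(lra)).
  assert (T1 : contrast x y1 <= - (1 / 2)).
  { unfold contrast. rewrite <- !Cmod2_alt. pose proof (lam_pos x y1 HxX) as P. unfold lam in *.
    apply Rmult_le_reg_r with (1 := P). unfold Rdiv at 1. rewrite Rmult_assoc, Rinv_l by lra. lra. }
  assert (T2 : 1 / 2 <= contrast x y2).
  { unfold contrast. rewrite <- !Cmod2_alt. pose proof (lam_pos x y2 HxX) as P. unfold lam in *.
    apply Rmult_le_reg_r with (1 := P). unfold Rdiv at 2. rewrite Rmult_assoc, Rinv_l by lra. lra. }
  assert (HT : forall y, 1 <= Cmod (b (x, y) - a (x, y))) by (intros y; apply R3; lra).
  destruct (Rle_dec y1 y2) as [L|L].
  - pose proof (curv_density_integral x y1 y2 HxX HT ltac:(lra) ltac:(lra)) as B.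
    pose proof (Rle_abs (contrast x y2 - contrast x y1)). lra.
  - pose proof (curv_density_integral x y2 y1 HxX HT ltac:(lra) ltac:(lra)) as B.
    pose proof (Rle_abs (- (contrast x y1 - contrast x y2))) as B'. rewrite Rabs_Ropp in B'. lra.
Qed.

End EssentialEnd.

(** * The Gauss maps at the end *)

Section EndData.
Context (p s om th : CC -> CC) (g gs dg dgs : CC -> CC) (r X0 : R).
Hypothesis Hr : 0 < r.
Hypothesis HX0 : X0 <= 0.
Hypothesis HX0r : forall w, Re w < X0 -> Cmod (cexp w) < r.
Hypothesis Hdg : forall z, Cmod z < r -> cder g z (dg z).
Hypothesis Hdgs : forall z, Cmod z < r -> cder gs z (dgs z).
Hypothesis Hdet : forall w, Re w < X0 -> ((g (cexp w) - gs (cexp w)) * p w * s w = 1)%C.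
Hypothesis Hp : forall w, Re w < X0 ->
  cder p w (p w * (- (cexp w * dg (cexp w) / (g (cexp w) - gs (cexp w)))))%C.
Hypothesis Hs : forall w, Re w < X0 ->
  cder s w (s w * (cexp w * dgs (cexp w) / (g (cexp w) - gs (cexp w))))%C.
Hypothesis Hom : forall w, Re w < X0 -> om w = (- (cexp w * dg (cexp w) * (p w * p w)))%C.
Hypothesis Hth : forall w, Re w < X0 -> th w = (cexp w * dgs (cexp w) * (s w * s w))%C.

Lemma end_nonzero w : Re w < X0 ->
  (g (cexp w) - gs (cexp w))%C <> 0%C /\ p w <> 0%C /\ s w <> 0%C.
Proof.
  intros Hw. specialize (Hdet w Hw).
  assert (N1 : RtoC 1 <> 0%C) by (intros E; apply RtoC_inj in E; lra).
  repeat split; intros E; rewrite E in Hdet; apply N1; rewrite <- Hdet; ring.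
Qed.

Lemma dg_holo : holo_on r dg.
Proof. now apply holo_on_derivative with g. Qed.

Lemma dgs_holo : holo_on r dgs.
Proof. now apply holo_on_derivative with gs. Qed.

Lemma om_th_cont w : Re w < X0 -> ccont om w /\ ccont th w.
Proof.
  intros Hw.
  assert (Hc : forall f, holo_on r f -> ccont (fun w => f (cexp w)) w).
  { intros f Hf. apply (ctn_comp idC f cexp); [apply (holo_on_cont r); auto|].
    eapply der_ctn, cexp_der. }
  assert (Ce : ccont cexp w) by (eapply der_ctn, cexp_der).
  assert (Hloc : forall f h : CC -> CC, (forall u, Re u < X0 -> h u = f u) -> ccont f w -> ccont h w).
  { intros f h E Hf eps He. destruct (Hf eps He) as [d [Hd H]].
    exists (Rmin d (X0 - Re w)). split; [apply Rmin_pos; lra|]. intros u Hu. unfold idC in *.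
    pose proof (Rmin_Rgt_l _ _ _ Hu).
    rewrite !E; trivial; [|now apply Re_near with w]. now apply H. }
  assert (Cp : ccont p w) by (eapply der_ctn, Hp, Hw).
  assert (Cs : ccont s w) by (eapply der_ctn, Hs, Hw).
  split.
  - eapply Hloc; [exact Hom|]. apply ctn_opp.
    apply ctn_mult; [apply ctn_mult; trivial; apply Hc, dg_holo|now apply ctn_mult].
  - eapply Hloc; [exact Hth|].
    apply ctn_mult; [apply ctn_mult; trivial; apply Hc, dgs_holo|now apply ctn_mult].
Qed.

Lemma ccont_bound_end f : ccont f 0 -> exists C X, 0 < C /\ forall w, Re w < X -> Cmod (f (cexp w)) <= C.
Proof.
  intros H. destruct (ctn_bounded idC f 0 H) as [d [Hd B]]. unfold idC in B.
  exists (Cmod (f 0%C) + 1), (ln d). pose proof (Cmod_ge_0 (f 0%C)). split; [lra|].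
  intros w Hw. left. apply B. replace (cexp w - 0)%C with (cexp w) by ring. now apply cexp_small.
Qed.

(** If H does not vanish at 0, the logarithmic derivatives of [p] and [s] are z times bounded
    functions, hence integrable along the ray. [om] and [th] carry a further factor z, which
    provides the decay. *)
Lemma gauss_maps_agree : complete_at_0 om th -> g 0%C = gs 0%C.
Proof.
  intros Hcomp. apply NNPP. intros Hne.
  assert (H0 : (g 0%C - gs 0%C)%C <> 0%C) by now apply Cminus_eq_contra.
  assert (Cg : ccont g 0) by (eapply der_ctn, Hdg; now rewrite Cmod_0).
  assert (Cgs : ccont gs 0) by (eapply der_ctn, Hdgs; now rewrite Cmod_0).
  assert (Cdg : ccont dg 0) by (apply ccont_0_holo with r; trivial; apply dg_holo).
  assert (Cdgs : ccont dgs 0) by (apply ccont_0_holo with r; trivial; apply dgs_holo).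
  assert (Q1 : ccont (fun z => dg z / (g z - gs z))%C 0)
    by (apply ctn_div; trivial; now apply ctn_minus).
  assert (Q2 : ccont (fun z => dgs z / (g z - gs z))%C 0)
    by (apply ctn_div; trivial; now apply ctn_minus).
  destruct (ccont_bound_end _ Q1) as (C1 & X1 & HC1 & B1).
  destruct (ccont_bound_end _ Q2) as (C2 & X2 & HC2 & B2).
  destruct (ccont_bound_end _ Cdg) as (C3 & X3 & HC3 & B3).
  destruct (ccont_bound_end _ Cdgs) as (C4 & X4 & HC4 & B4).
  set (X := Rmin X0 (Rmin (Rmin X1 X2) (Rmin X3 X4))).
  assert (HX : X <= X0 /\ X <= X1 /\ X <= X2 /\ X <= X3 /\ X <= X4).
  { unfold X. min_bounds. lra. }
  clearbody X.
  assert (ReX : forall x y : R, Re (x, y) = x) by reflexivity.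
  destruct (bounded_on_ray (fun x => p (x, 0))
    (fun x => - (cexp (x, 0) * dg (cexp (x, 0)) / (g (cexp (x, 0)) - gs (cexp (x, 0)))))%C X C1 HC1) as [M1 HM1].
  { intros x Hx. apply (cder_x p), Hp. rewrite ReX. lra. }
  { intros x Hx. rewrite Cmod_opp. unfold Cdiv. rewrite <- Cmult_assoc, Cmod_mult, Cmod_cexp, ReX, Rmult_comm.
    apply Rmult_le_compat_r; [left; apply exp_pos|]. apply (B1 (x, 0)). rewrite ReX. lra. }
  destruct (bounded_on_ray (fun x => s (x, 0))
    (fun x => (cexp (x, 0) * dgs (cexp (x, 0)) / (g (cexp (x, 0)) - gs (cexp (x, 0)))))%C X C2 HC2) as [M2 HM2].
  { intros x Hx. apply (cder_x s), Hs. rewrite ReX. lra. }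
  { intros x Hx. unfold Cdiv. rewrite <- Cmult_assoc, Cmod_mult, Cmod_cexp, ReX, Rmult_comm.
    apply Rmult_le_compat_r; [left; apply exp_pos|]. apply (B2 (x, 0)). rewrite ReX. lra. }
  assert (P1 : 0 <= C3 * (M1 * M1)) by (apply Rmult_le_pos; [lra|]; apply Rle_0_sqr).
  assert (P2 : 0 <= C4 * (M2 * M2)) by (apply Rmult_le_pos; [lra|]; apply Rle_0_sqr).
  apply (incomplete_of_decay om th (X - 1) (C3 * (M1 * M1) + C4 * (M2 * M2) + 1)); trivial.
  - lra.
  - lra.
  - intros x Hx. apply (ctn_comp RtoC om (fun x : R => (x, 0))).
    + apply om_th_cont. rewrite ReX. lra.
    + eapply der_ctn, path_x_der.
  - intros x Hx. apply (ctn_comp RtoC th (fun x : R => (x, 0))).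
    + apply om_th_cont. rewrite ReX. lra.
    + eapply der_ctn, path_x_der.
  - intros x Hx.
    assert (Bsq : forall a M, 0 <= a -> a <= M -> a * a <= M * M) by (intros; apply Rmult_le_compat; lra).
    assert (Est : forall c d C M, Cmod c <= C -> Cmod d <= M ->
      Cmod (cexp (x, 0) * c * (d * d)) <= C * (M * M) * exp x).
    { intros c d C M Hc Hd. rewrite !Cmod_mult, Cmod_cexp, ReX.
      replace (C * (M * M) * exp x) with (exp x * C * (M * M)) by ring.
      pose proof (Cmod_ge_0 c). pose proof (Cmod_ge_0 d). pose proof (exp_pos x).
      apply Rmult_le_compat; try (apply Rmult_le_pos; lra); [|now apply Bsq].
      apply Rmult_le_compat_l; lra. }
    assert (O1 : Cmod (om (x, 0)) <= C3 * (M1 * M1) * exp x).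
    { rewrite Hom, Cmod_opp by (rewrite ReX; lra). apply Est; [apply B3; rewrite ReX; lra|apply HM1; lra]. }
    assert (O2 : Cmod (th (x, 0)) <= C4 * (M2 * M2) * exp x).
    { rewrite Hth by (rewrite ReX; lra). apply Est; [apply B4; rewrite ReX; lra|apply HM2; lra]. }
    unfold lam. pose proof (Cmod_ge_0 (om (x, 0))) as O3. pose proof (Cmod_ge_0 (th (x, 0))) as O4.
    pose proof (exp_pos x).
    rewrite <- (sqrt_square ((C3 * (M1 * M1) + C4 * (M2 * M2) + 1) * exp x))
      by (apply Rmult_le_pos; lra).
    apply sqrt_le_1_alt.
    set (a := Cmod (om (x, 0))) in *. set (b := Cmod (th (x, 0))) in *.
    apply Rle_trans with ((a + b) * (a + b)).
    + assert (0 <= a * b) by (apply Rmult_le_pos; lra). lra.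
    + apply Bsq; lra.
Qed.

Section UnitRatio.
Context (u v : CC -> CC) (m : nat).
Hypothesis Hm : (1 <= m)%nat.
Hypothesis Hu : holo_on r u.
Hypothesis Hv : holo_on r v.
Hypothesis Eu : forall z, Cmod z < r -> dg z = (z ^ (m - 1) * u z)%C.
Hypothesis Ev : forall z, Cmod z < r -> dgs z = (z ^ (m - 1) * v z)%C.
Hypothesis Hagree : g 0%C = gs 0%C.
Hypothesis Hu0 : u 0%C <> 0%C.
Hypothesis Huv : u 0%C = v 0%C.

(** G and G_* have difference quotients of order m with the same limit u(0)/m = v(0)/m, so H / z^m
    tends to 0. H is not identically zero near 0 because of H p s = 1. *)
Lemma excess_order : exists n h r1, (1 <= n)%nat /\ 0 < r1 <= r /\ holo_on r1 h /\ h 0%C <> 0%C /\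
  forall z, Cmod z < r1 -> (g z - gs z = z ^ (m + n) * h z)%C.
Proof.
  assert (HH : holo_on r (fun z => g z - gs z)%C).
  { intros z Hz. eexists. apply der_minus; [now apply Hdg|now apply Hdgs]. }
  destruct (holo_order_dichotomy _ r Hr HH) as [[r' [Hr' Z]]|(k & r' & h & Hr' & Hh & Hh0 & Eh)].
  - exfalso. set (x := Rmin (X0 - 1) (ln (r' / 2))).
    assert (Hx : x < X0) by (unfold x; pose proof (Rmin_l (X0 - 1) (ln (r' / 2))); lra).
    destruct (end_nonzero (x, 0)) as [N _]; [exact Hx|]. apply N, Z.
    rewrite Cmod_cexp. simpl. apply Rle_lt_trans with (exp (ln (r' / 2))).
    + destruct (Rmin_r (X0 - 1) (ln (r' / 2))) as [L|L]; [left; now apply exp_increasing|].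
      unfold x. rewrite L. apply Rle_refl.
    + rewrite exp_ln; lra.
  - assert (Hk : (m < k)%nat).
    { apply Nat.nle_gt. intros Hkm. apply Hh0.
      (* If k were at most m, then [h] would agree off 0 with [psi], which is continuous with value
         0 at 0, against [h 0 <> 0]. *)
      set (psi := fun z => (z ^ (m - k) * (quot_pow g u m z - quot_pow gs v m z))%C).
      assert (Cpsi : ccont psi 0).
      { apply ctn_mult; [apply ctn_pow, ctn_self|]. apply ctn_minus.
        - apply quot_pow_cont with dg r; trivial. apply ccont_0_holo with r; trivial.
        - apply quot_pow_cont with dgs r; trivial. apply ccont_0_holo with r; trivial. }
      rewrite (ccont_eq_punctured h psi (Rmin r r')); trivial.
      - unfold psi. rewrite !quot_pow_0, Huv. ring.
      - apply ccont_0_holo with r'; trivial.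
      - now apply Rmin_pos.
      - intros z Hz Hz0. unfold psi.
        pose proof (Rlt_le_trans _ _ _ Hz (Rmin_r _ _)) as Hz2.
        specialize (Eh z Hz2).
        rewrite (quot_pow_spec g u m z Hz0), (quot_pow_spec gs v m z Hz0), Hagree in Eh.
        replace m with (k + (m - k))%nat in Eh at 1 3 by lia.
        rewrite Cpow_add_r in Eh.
        pose proof (Cpow_nz z k Hz0) as Nk.
        assert (F : (z ^ k * (h z - z ^ (m - k) * (quot_pow g u m z - quot_pow gs v m z)) = 0)%C).
        { replace (z ^ k * (h z - z ^ (m - k) * (quot_pow g u m z - quot_pow gs v m z)))%C
            with (z ^ k * h z - (gs 0%C + z ^ k * z ^ (m - k) * quot_pow g u m z -
              (gs 0%C + z ^ k * z ^ (m - k) * quot_pow gs v m z)))%C by ring.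
          rewrite Eh. ring. }
        replace (h z) with ((z ^ k * (h z - z ^ (m - k) * (quot_pow g u m z - quot_pow gs v m z))) / z ^ k +
          z ^ (m - k) * (quot_pow g u m z - quot_pow gs v m z))%C by (field; trivial).
        rewrite F. field. trivial. }
    exists (k - m)%nat, h, (Rmin r r'). split; [lia|].
    pose proof (Rmin_l r r'). pose proof (Rmin_r r r').
    split; [split; [now apply Rmin_pos|trivial]|]. split; [apply holo_on_le with r'; trivial; lra|].
    split; trivial. intros z Hz. replace (m + (k - m))%nat with k by lia. apply Eh. lra.
Qed.

(** Since om = - z^m u p^2 and p'/p = - u / (z^n h), the logarithmic derivative of [om] has the
    principal term -2 u / (z^n h); that of [th] has +2 v / (z^n h). With u(0) = v(0) the two poles
    reinforce each other in the difference. *)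
Lemma unit_ratio_infinite_curvature : ~ finite_total_curv_at_0 om th.
Proof.
  destruct excess_order as (n & h & r1 & Hn & Hr1 & Hh & Hh0 & EH).
  destruct (holo_on_deriv_fun r u Hu) as [du Hdu]. destruct (holo_on_deriv_fun r v Hv) as [dv Hdv].
  assert (Cu : ccont u 0) by (apply ccont_0_holo with r; trivial).
  assert (Cv : ccont v 0) by (apply ccont_0_holo with r; trivial).
  assert (Ch : ccont h 0) by (apply ccont_0_holo with r1; trivial; lra).
  assert (Cdu : ccont du 0) by (apply ccont_0_holo with r; trivial; now apply holo_on_derivative with u).
  assert (Cdv : ccont dv 0) by (apply ccont_0_holo with r; trivial; now apply holo_on_derivative with v).
  assert (Hv0 : v 0%C <> 0%C) by now rewrite <- Huv.
  destruct (ccont_away u Cu Hu0) as [d1 [Hd1 N1]]. destruct (ccont_away v Cv Hv0) as [d2 [Hd2 N2]].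
  destruct (ccont_away h Ch Hh0) as [d3 [Hd3 N3]].
  set (r2 := Rmin (Rmin r1 d1) (Rmin d2 d3)).
  assert (Hr2 : 0 < r2) by (repeat apply Rmin_pos; lra).
  assert (Lr2 : r2 <= r1 /\ r2 <= d1 /\ r2 <= d2 /\ r2 <= d3).
  { unfold r2. min_bounds. lra. }
  clearbody r2. set (X := Rmin X0 (ln r2)).
  assert (HX : forall w, Re w < X -> Re w < X0 /\ Cmod (cexp w) < r2).
  { intros w Hw. split; [apply Rlt_le_trans with (1 := Hw), Rmin_l|].
    apply cexp_small; trivial. apply Rlt_le_trans with (1 := Hw), Rmin_r. }
  set (a := fun w => (RtoC (INR m) + cexp w * du (cexp w) / u (cexp w) -
    2 * u (cexp w) / (cexp w ^ n * h (cexp w)))%C).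
  set (b := fun w => (RtoC (INR m) + cexp w * dv (cexp w) / v (cexp w) +
    2 * v (cexp w) / (cexp w ^ n * h (cexp w)))%C).
  (* This is z^n times the difference of the logarithmic derivatives; its value at 0 is 4 u(0) /
     h(0). *)
  set (tau := fun z => (z ^ n * (z * dv z / v z - z * du z / u z) + 2 * (u z + v z) / h z)%C).
  assert (Pm : forall z : CC, (z ^ m = z * z ^ (m - 1))%C).
  { intros z. replace m with (S (m - 1)) at 1 by lia. apply Cpow_S. }
  assert (Dpow : forall w, cder (fun k => cexp k ^ m)%C w (RtoC (INR m) * cexp w ^ m)%C).
  { intros w. eapply der_eq; [|apply der_pow, cexp_der]. cbv beta. rewrite (Pm (cexp w)). ring. }
  apply (essential_end_infinite_curvature om th a b tau n X); trivial.
  - intros w Hw. destruct (HX w Hw) as [Hw0 Hz]. destruct (end_nonzero w Hw0) as (NH & Np & Ns).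
    pose proof (cexp_neq0 w) as Nz. pose proof (Cpow_nz _ n Nz) as Nzn. pose proof (Cpow_nz _ (m - 1) Nz) as Nzm.
    specialize (N1 (cexp w) ltac:(lra)). specialize (N3 (cexp w) ltac:(lra)).
    apply der_ext_loc with (f := fun k => (- (cexp k ^ m * u (cexp k) * (p k * p k)))%C) (d := X - Re w).
    + lra.
    + intros k Hk. apply Re_near in Hk. destruct (HX k Hk) as [Hk0 Hkz].
      rewrite Hom, Eu, Pm by (trivial; lra). ring.
    + eapply der_eq; [|apply der_opp, der_mult; [apply der_mult; [apply Dpow|apply der_comp_cexp, Hdu; lra]|
        apply der_mult; apply Hp, Hw0]].
      cbv beta. unfold a. rewrite Hom, Eu, EH, Cpow_add_r, Pm by (trivial; lra). field. auto.
  - intros w Hw. destruct (HX w Hw) as [Hw0 Hz]. destruct (end_nonzero w Hw0) as (NH & Np & Ns).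
    pose proof (cexp_neq0 w) as Nz. pose proof (Cpow_nz _ n Nz) as Nzn. pose proof (Cpow_nz _ (m - 1) Nz) as Nzm.
    specialize (N2 (cexp w) ltac:(lra)). specialize (N3 (cexp w) ltac:(lra)).
    apply der_ext_loc with (f := fun k => (cexp k ^ m * v (cexp k) * (s k * s k))%C) (d := X - Re w).
    + lra.
    + intros k Hk. apply Re_near in Hk. destruct (HX k Hk) as [Hk0 Hkz].
      rewrite Hth, Ev, Pm by (trivial; lra). ring.
    + eapply der_eq; [|apply der_mult; [apply der_mult; [apply Dpow|apply der_comp_cexp, Hdv; lra]|
        apply der_mult; apply Hs, Hw0]].
      cbv beta. unfold b. rewrite Hth, Ev, EH, Cpow_add_r, Pm by (trivial; lra). field. auto.
  - intros w Hw. destruct (HX w Hw) as [Hw0 Hz]. destruct (end_nonzero w Hw0) as (NH & Np & Ns).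
    rewrite Hom, Eu by (trivial; lra). intros E. apply (Cmult_neq_0 (cexp w * (cexp w ^ (m - 1) * u (cexp w))) (p w * p w))%C.
    + repeat apply Cmult_neq_0; try apply Cpow_nz; try apply cexp_neq0. apply N1. lra.
    + now apply Cmult_neq_0.
    + match goal with |- ?x = _ => replace x with (- - x)%C by ring end. rewrite E. ring.
  - intros w Hw. destruct (HX w Hw) as [Hw0 Hz]. destruct (end_nonzero w Hw0) as (NH & Np & Ns).
    rewrite Hth, Ev by (trivial; lra). repeat apply Cmult_neq_0; trivial; try apply Cpow_nz; try apply cexp_neq0.
    apply N2. lra.
  - intros w Hw. destruct (HX w Hw) as [Hw0 Hz].
    pose proof (cexp_neq0 w) as Nz. pose proof (Cpow_nz _ n Nz) as Nzn.
    specialize (N1 (cexp w) ltac:(lra)). specialize (N2 (cexp w) ltac:(lra)). specialize (N3 (cexp w) ltac:(lra)).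
    unfold a, b, tau. field. auto.
  - unfold tau. assert (CI : ccont (fun z : CC => z) 0) by apply (ctn_self idC).
    apply ctn_plus; [apply ctn_mult; [now apply ctn_pow|apply ctn_minus]|].
    + apply ctn_div; trivial. now apply ctn_mult.
    + apply ctn_div; trivial. now apply ctn_mult.
    + apply ctn_div; trivial. apply ctn_mult; [apply ctn_const|now apply ctn_plus].
  - unfold tau. rewrite <- Huv.
    replace ((0 ^ n)%C) with (RtoC 0) by (destruct n; [lia|simpl; ring]).
    match goal with |- ?x <> _ => replace x with (4 * (u 0%C / h 0%C))%C by (field; auto) end.
    apply Cmult_neq_0; [intros E; apply RtoC_inj in E; lra|].
    unfold Cdiv. apply Cmult_neq_0; trivial. intros E. apply Hh0.
    replace (h 0%C) with (h 0%C * h 0%C * / h 0%C)%C by (field; trivial). rewrite E. ring.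
Qed.

End UnitRatio.
End EndData.

(** * The flux matrix *)

(** For the converse [(b, mu - a)] is an eigenvector unless b = 0; the triangular cases are treated
    by hand. *)
Lemma eigenvalue_iff (A : M2) (mu : CC) :
  is_eigenvalue A mu <-> ((e11 A - mu) * (e22 A - mu) - e12 A * e21 A = 0)%C.
Proof.
  destruct A as [a b c d]. unfold is_eigenvalue. simpl. split.
  - intros (v1 & v2 & Hv & H1 & H2).
    assert (K1 : ((a - mu) * v1 + b * v2 = 0)%C)
      by (replace ((a - mu) * v1 + b * v2)%C with (a * v1 + b * v2 - mu * v1)%C by ring; rewrite H1; ring).
    assert (K2 : (c * v1 + (d - mu) * v2 = 0)%C)
      by (replace (c * v1 + (d - mu) * v2)%C with (c * v1 + d * v2 - mu * v2)%C by ring; rewrite H2; ring).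
    set (D := ((a - mu) * (d - mu) - b * c)%C).
    assert (D1 : (D * v1 = 0)%C).
    { replace (D * v1)%C with ((d - mu) * ((a - mu) * v1 + b * v2) - b * (c * v1 + (d - mu) * v2))%C
        by (unfold D; ring). rewrite K1, K2. ring. }
    assert (D2 : (D * v2 = 0)%C).
    { replace (D * v2)%C with ((a - mu) * (c * v1 + (d - mu) * v2) - c * ((a - mu) * v1 + b * v2))%C
        by (unfold D; ring). rewrite K1, K2. ring. }
    apply NNPP. intros Nd. destruct Hv as [Hv|Hv]; [apply (Cmult_neq_0 D v1)|apply (Cmult_neq_0 D v2)]; trivial.
  - intros HD.
    destruct (Ceq_dec b 0) as [Eb|Nb].
    + destruct (Ceq_dec (a - mu) 0) as [Ea|Na].
      * assert (Ea' : a = mu) by (replace a with (a - mu + mu)%C by ring; rewrite Ea; ring).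
        destruct (Ceq_dec (d - mu) 0) as [Ed|Nd].
        -- assert (Ed' : d = mu) by (replace d with (d - mu + mu)%C by ring; rewrite Ed; ring).
           exists 0%C, 1%C. split; [right; intros E; apply RtoC_inj in E; lra|].
           subst. split; ring.
        -- exists (d - mu)%C, (- c)%C. split; [now left|]. subst. split; ring.
      * exists (RtoC 0), (a - mu)%C. split; [now right|]. subst b. split; [ring|].
        assert (K : ((a - mu) * (d - mu) = 0)%C) by (rewrite <- HD; ring).
        replace (c * 0 + d * (a - mu))%C with ((a - mu) * (d - mu) + mu * (a - mu))%C by ring.
        rewrite K. ring.
    + exists b, (mu - a)%C. split; [now left|]. split; [ring|].
      replace (c * b + d * (mu - a))%C
        with (mu * (mu - a) - ((a - mu) * (d - mu) - b * c))%C by ring.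
      rewrite HD. ring.
Qed.

Lemma diagonalizable_of_distinct (A : M2) (m1 m2 : CC) :
  is_eigenvalue A m1 -> is_eigenvalue A m2 -> m1 <> m2 -> diagonalizable A.
Proof.
  intros (v1 & v2 & Hv & V1 & V2) (w1 & w2 & Hw & W1 & W2) Hne.
  exists (mkM2 v1 w1 v2 w2), m1, m2. split.
  - unfold mdet. simpl. intros HD.
    assert (Par : exists c, (v1 = c * w1)%C /\ (v2 = c * w2)%C).
    { destruct Hw as [N|N].
      - exists (v1 / w1)%C. split; [field; trivial|].
        replace v2 with (((v1 * w2 - w1 * v2) * - 1 + v1 * w2) / w1)%C by (field; trivial).
        rewrite HD. field. trivial.
      - exists (v2 / w2)%C. split; [|field; trivial].
        replace v1 with (((v1 * w2 - w1 * v2) + w1 * v2) / w2)%C by (field; trivial).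
        rewrite HD. field. trivial. }
    destruct Par as [c [P1 P2]].
    assert (Hd : (m1 - m2)%C <> 0%C) by now apply Cminus_eq_contra.
    assert (Z1 : ((m1 - m2) * v1 = 0)%C).
    { replace ((m1 - m2) * v1)%C with (m1 * v1 - c * (m2 * w1))%C by (rewrite P1; ring).
      rewrite <- V1, <- W1, P1, P2. ring. }
    assert (Z2 : ((m1 - m2) * v2 = 0)%C).
    { replace ((m1 - m2) * v2)%C with (m1 * v2 - c * (m2 * w2))%C by (rewrite P2; ring).
      rewrite <- V2, <- W2, P1, P2. ring. }
    destruct Hv as [N|N]; [apply (Cmult_neq_0 _ _ Hd N Z1)|apply (Cmult_neq_0 _ _ Hd N Z2)].
  - unfold mmul, mdiag. simpl. rewrite V1, V2, W1, W2. f_equal; ring.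
Qed.

(** The inverse of a matrix of determinant 1, written without division, so that conjugation has
    polynomial entries. *)
Definition madjugate (A : M2) : M2 := mkM2 (e22 A) (- e12 A)%C (- e21 A)%C (e11 A).

Definition mconj (a A : M2) : M2 := mmul (mmul a A) (madjugate a).

(** Trace and determinant are invariant under conjugation; as the upper right entry vanishes, the
    lower left one, about which nothing is assumed, does not enter. *)
Lemma mconj_triangular_charpoly (a A : M2) (l mu : CC) : mdet a = 1%C ->
  e11 (mconj a A) = l -> e12 (mconj a A) = 0%C -> e22 (mconj a A) = (- l)%C ->
  ((e11 A - mu) * (e22 A - mu) - e12 A * e21 A = (mu - l) * (mu + l))%C.
Proof.
  intros Hd H1 H2 H3.
  set (T := mconj a A) in *.
  assert (Tr : ((e11 A + e22 A) * mdet a = e11 T + e22 T)%C)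
    by (unfold T, mconj, mmul, madjugate, mdet; simpl; ring).
  assert (Dt : ((e11 A * e22 A - e12 A * e21 A) * (mdet a * mdet a) = e11 T * e22 T - e12 T * e21 T)%C)
    by (unfold T, mconj, mmul, madjugate, mdet; simpl; ring).
  rewrite Hd, H1, H3 in Tr. rewrite Hd, H1, H2, H3 in Dt.
  replace ((e11 A - mu) * (e22 A - mu) - e12 A * e21 A)%C
    with ((e11 A * e22 A - e12 A * e21 A) * (1 * 1) - mu * ((e11 A + e22 A) * 1) + mu * mu)%C by ring.
  rewrite Tr, Dt. ring.
Qed.

(** * The (1,0)-derivative and integrals over a period *)

Lemma rderC_eq f t v : rder f t v -> rderC f t = v.
Proof.
  intros H. apply rder_iff in H. destruct H as [H1 H2], v as [v1 v2].
  unfold rderC. f_equal; now apply is_derive_unique.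
Qed.

Lemma rder_conj f t v : rder f t v -> rder (fun s => Cconj (f s)) t (Cconj v).
Proof.
  intros H. apply rder_iff in H. destruct H as [H1 H2]. apply rder_iff. split; simpl; trivial.
  now apply (is_derive_opp (V := R_NormedModule)).
Qed.

(* Conjugate factors are antiholomorphic, so the (1,0)-derivative does not see them. *)
Lemma dw_hermitian_pairing (f1 f2 g1 g2 : CC -> CC) (x y : R) (df1 df2 dg1 dg2 : CC) :
  cder f1 (x, y) df1 -> cder f2 (x, y) df2 -> cder g1 (x, y) dg1 -> cder g2 (x, y) dg2 ->
  (/ 2 * (rderC (fun s => f1 (s, y) * Cconj (g1 (s, y)) + f2 (s, y) * Cconj (g2 (s, y)))%C x -
     Ci * rderC (fun s => f1 (x, s) * Cconj (g1 (x, s)) + f2 (x, s) * Cconj (g2 (x, s)))%C y) =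
   df1 * Cconj (g1 (x, y)) + df2 * Cconj (g2 (x, y)))%C.
Proof.
  intros F1 F2 G1 G2.
  erewrite (rderC_eq (fun s => f1 (s, y) * Cconj (g1 (s, y)) + f2 (s, y) * Cconj (g2 (s, y)))%C x).
  2: { apply der_plus; apply der_mult; try (apply cder_x; eassumption); apply rder_conj, cder_x; eassumption. }
  erewrite (rderC_eq (fun s => f1 (x, s) * Cconj (g1 (x, s)) + f2 (x, s) * Cconj (g2 (x, s)))%C y).
  2: { apply der_plus; apply der_mult; try (apply cder_y; eassumption); apply rder_conj, cder_y; eassumption. }
  rewrite !Cmult_conj.
  replace (Cconj Ci) with (- Ci)%C by (unfold Cconj, Ci, Copp; simpl; f_equal; ring).
  transitivity (df1 * Cconj (g1 (x, y)) + df2 * Cconj (g2 (x, y)) - (Ci * Ci + 1) * / 2 *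
    (df1 * Cconj (g1 (x, y)) + df2 * Cconj (g2 (x, y)) - f1 (x, y) * Cconj dg1 - f2 (x, y) * Cconj dg2))%C.
  - field.
  - replace (Ci * Ci + 1)%C with (RtoC 0) by (unfold Ci, Cmult, Cplus, RtoC; simpl; f_equal; ring). ring.
Qed.

Lemma rderC_ext_lt f g X t : t < X -> (forall s, s < X -> f s = g s) -> rderC f t = rderC g t.
Proof.
  intros Ht E. unfold rderC.
  f_equal; apply Derive_ext_loc, locally_lt with (1 := Ht); intros s Hs; now rewrite E.
Qed.

Lemma rderC_periodic f T t : (forall s, f (s + T) = f s) -> rderC f (t + T) = rderC f t.
Proof.
  intros E. unfold rderC, Derive.
  f_equal; f_equal; apply Lim_ext; intros h; replace (t + T + h) with (t + h + T) by ring; now rewrite !E.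
Qed.

(* On a strip of width one period the vertical sides of the contour cancel. *)
Lemma period_integral_const (q : CC -> CC) (X x1 x2 : R) :
  (forall w, Re w < X -> exists l, cder q w l) ->
  (forall x y, x < X -> q (x, y + 2 * PI) = q (x, y)) -> x1 <= x2 < X ->
  RIntC (fun y => q (x1, y)) 0 (2 * PI) = RIntC (fun y => q (x2, y)) 0 (2 * PI).
Proof.
  intros Hq Hper Hx. pose proof two_pi_pos as P2.
  assert (L : loop_int q (fun x y => (x, y)) (fun _ _ => 1%C) (fun _ _ => Ci) x1 x2 0 (2 * PI) = 0%C).
  { apply goursat with (K := 1); try lra.
    - intros s t. apply path_x_der.
    - intros s t. apply path_y_der.
    - intros s t. apply (ctn_const RtoC).
    - intros s t. apply (ctn_const RtoC).
    - intros s t _ _. rewrite Cmod_1. lra.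
    - intros s t _ _. rewrite Cmod_Ci. lra.
    - intros s t Hs _. apply Hq. simpl. lra. }
  assert (Ic : forall x, x < X -> icont (fun y => q (x, y)) 0 (2 * PI)).
  { intros x Hx'. apply icont_global. intros y. destruct (Hq (x, y) Hx') as [l Hl].
    apply y_cont. eapply der_ctn, Hl. }
  unfold loop_int in L.
  rewrite (RIntC_ext (fun x => q (x, (2 * PI)%R) * 1)%C (fun x => q (x, 0) * 1)%C) in L.
  2: { intros t Ht. rewrite Rmax_right in Ht by lra. rewrite <- (Hper t 0) by lra. now rewrite Rplus_0_l. }
  assert (E : forall x, x < X -> RIntC (fun y => q (x, y) * Ci)%C 0 (2 * PI) =
    (Ci * RIntC (fun y => q (x, y)) 0 (2 * PI))%C).
  { intros x Hx'. rewrite <- RIntC_scal by auto. apply RIntC_ext. intros. ring. }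
  rewrite !E in L by lra.
  match type of L with (?c + Ci * ?A2 - ?c - Ci * ?A1)%C = _ =>
    replace A1 with (A2 + Ci * (c + Ci * A2 - c - Ci * A1) + (Ci * Ci + 1) * (A1 - A2))%C by ring end.
  rewrite L.
  replace (Ci * Ci + 1)%C with (RtoC 0) by (unfold Ci, Cmult, Cplus, RtoC; simpl; f_equal; ring). ring.
Qed.

(** The integral does not depend on x, so it may be computed arbitrarily far towards the end, where
    the integrand is uniformly close to [f 0]. It is the residue of f(z) / z, and continuity of [f]
    at 0 suffices for the limit. *)
Lemma period_integral_residue (q f : CC -> CC) (X x : R) :
  (forall w, Re w < 0 -> exists l, cder q w l) ->
  (forall x y, x < 0 -> q (x, y + 2 * PI) = q (x, y)) ->
  (forall w, Re w < X -> q w = f (cexp w)) -> ccont f 0 -> x < 0 ->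
  RIntC (fun y => q (x, y)) 0 (2 * PI) = (RtoC (2 * PI) * f 0%C)%C.
Proof.
  intros Hq Hper Hqf Hf Hx. pose proof two_pi_pos as P2.
  apply C_eq_eps with (2 * PI); trivial. intros e He.
  destruct (ccont_end f e Hf He) as [M HM].
  set (x1 := Rmin x (Rmin X M) - 1).
  pose proof (Rmin_l x (Rmin X M)). pose proof (Rmin_r x (Rmin X M)).
  pose proof (Rmin_l X M). pose proof (Rmin_r X M).
  rewrite <- (period_integral_const q 0 x1 x) by (trivial; unfold x1; lra).
  assert (Ic : icont (fun y => q (x1, y)) 0 (2 * PI)).
  { apply icont_global. intros y. destruct (Hq (x1, y)) as [l Hl]; [simpl; unfold x1; lra|].
    apply y_cont. eapply der_ctn, Hl. }
  replace (RtoC (2 * PI)) with (RtoC (2 * PI - 0)) by (f_equal; ring).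
  rewrite <- RIntC_const, <- RIntC_minus; trivial.
  2: apply icont_global; intros; apply ctn_const.
  replace (e * (2 * PI)) with (e * (2 * PI - 0)) by ring. apply RIntC_bound; [lra| |].
  - intros t Ht. apply ctn_minus; [now apply Ic|apply ctn_const].
  - intros t Ht. left. rewrite Hqf by (simpl; unfold x1; lra). apply HM. simpl. unfold x1. lra.
Qed.

Lemma RIntC_lincomb4 (c1 c2 c3 c4 : CC) (f1 f2 f3 f4 : R -> CC) (a b : R) :
  icont f1 a b -> icont f2 a b -> icont f3 a b -> icont f4 a b ->
  RIntC (fun t => c1 * f1 t + c2 * f2 t + (c3 * f3 t + c4 * f4 t))%C a b =
  (c1 * RIntC f1 a b + c2 * RIntC f2 a b + (c3 * RIntC f3 a b + c4 * RIntC f4 a b))%C.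
Proof.
  intros H1 H2 H3 H4.
  assert (S : forall c f, icont f a b -> icont (fun t => c * f t)%C a b)
    by (intros c f Hf t Ht; apply ctn_mult; [apply ctn_const|auto]).
  assert (P : forall f g, icont f a b -> icont g a b -> icont (fun t => f t + g t)%C a b)
    by (intros f g Hf Hg t Ht; apply ctn_plus; auto).
  rewrite (RIntC_plus (fun t => c1 * f1 t + c2 * f2 t)%C (fun t => c3 * f3 t + c4 * f4 t)%C) by auto.
  rewrite (RIntC_plus (fun t => c1 * f1 t)%C), (RIntC_plus (fun t => c3 * f3 t)%C) by auto.
  now rewrite !RIntC_scal by trivial.
Qed.

Section Flux.
Context (E : CC -> M2) (om th : CC -> CC).
Hypothesis Hfront : flat_front_data E om th.

Definition coframe (w : CC) : M2 := mmul (E w) (mkM2 0%C (th w) (om w) 0%C).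

(* The right-invariant form [dE E^-1], which is the integrand of the flux matrix. *)
Definition log_derivative (w : CC) : M2 := mmul (coframe w) (madjugate (E w)).

Lemma frame_det w : Re w < 0 -> mdet (E w) = 1%C.
Proof. intros Hw. apply (proj1 Hfront w Hw). Qed.

Lemma frame_der w : Re w < 0 ->
  cder (fun u => e11 (E u)) w (e11 (coframe w)) /\ cder (fun u => e12 (E u)) w (e12 (coframe w)) /\
  cder (fun u => e21 (E u)) w (e21 (coframe w)) /\ cder (fun u => e22 (E u)) w (e22 (coframe w)).
Proof.
  intros Hw. destruct (proj1 Hfront w Hw) as (H1 & H2 & H3 & H4 & _).
  repeat split; now apply cder_iff.
Qed.

Lemma front_period x y : x < 0 -> front E (x, y + 2 * PI) = front E (x, y).
Proof.
  intros Hx. rewrite <- (proj2 Hfront (x, y) Hx). f_equal. unfold Cplus. simpl. f_equal; ring.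
Qed.

Lemma dw_front_eq (x y : R) : x < 0 ->
  dw_front E (x, y) = mmul (coframe (x, y)) (madj (E (x, y))).
Proof.
  intros Hx. destruct (frame_der (x, y) Hx) as (H1 & H2 & H3 & H4).
  unfold dw_front, mscal, msub, mrder. simpl e11. simpl e12. simpl e21. simpl e22.
  change (Re (x, y)) with x. change (Im (x, y)) with y.
  unfold mmul at 1, madj at 5 6 7 8. simpl.
  f_equal.
  - apply (dw_hermitian_pairing (fun w => e11 (E w)) (fun w => e12 (E w)) (fun w => e11 (E w)) (fun w => e12 (E w)) x y _ _ _ _ H1 H2 H1 H2).
  - apply (dw_hermitian_pairing (fun w => e11 (E w)) (fun w => e12 (E w)) (fun w => e21 (E w)) (fun w => e22 (E w)) x y _ _ _ _ H1 H2 H3 H4).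
  - apply (dw_hermitian_pairing (fun w => e21 (E w)) (fun w => e22 (E w)) (fun w => e11 (E w)) (fun w => e12 (E w)) x y _ _ _ _ H3 H4 H1 H2).
  - apply (dw_hermitian_pairing (fun w => e21 (E w)) (fun w => e22 (E w)) (fun w => e21 (E w)) (fun w => e22 (E w)) x y _ _ _ _ H3 H4 H3 H4).
Qed.

Lemma dw_front_period (x y : R) : x < 0 -> dw_front E (x, y + 2 * PI) = dw_front E (x, y).
Proof.
  intros Hx. unfold dw_front.
  change (Re (x, y + 2 * PI)) with x. change (Im (x, y + 2 * PI)) with (y + 2 * PI).
  change (Re (x, y)) with x. change (Im (x, y)) with y.
  assert (A1 : forall k : M2 -> CC, rderC (fun s => k (front E (s, y + 2 * PI))) x = rderC (fun s => k (front E (s, y))) x).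
  { intros k. apply rderC_ext_lt with 0; trivial. intros s Hs. now rewrite front_period. }
  assert (A2 : forall k : M2 -> CC, rderC (fun s => k (front E (x, s))) (y + 2 * PI) = rderC (fun s => k (front E (x, s))) y).
  { intros k. apply (rderC_periodic (fun s => k (front E (x, s)))). intros s. now rewrite front_period. }
  unfold mrder. now rewrite !A1, !A2.
Qed.

Lemma flux_integrand_eq (x y : R) : x < 0 ->
  mmul (dw_front E (x, y)) (minv (front E (x, y))) = log_derivative (x, y).
Proof.
  intros Hx. rewrite dw_front_eq by trivial. pose proof (frame_det (x, y) Hx) as D.
  unfold log_derivative. generalize (coframe (x, y)). intros [k1 k2 k3 k4].
  unfold front. destruct (E (x, y)) as [a b c d]. unfold mdet in D. simpl in D.
  assert (Dc : (Cconj a * Cconj d - Cconj b * Cconj c = 1)%C).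
  { replace (RtoC 1) with (Cconj 1) by (unfold Cconj, RtoC; simpl; f_equal; ring).
    rewrite <- D. now rewrite Cminus_conj, !Cmult_conj. }
  assert (D2 : mdet (mmul (mkM2 a b c d) (madj (mkM2 a b c d))) = 1%C).
  { unfold mdet, mmul, madj. simpl.
    transitivity ((a * d - b * c) * (Cconj a * Cconj d - Cconj b * Cconj c))%C; [ring|].
    rewrite D, Dc. ring. }
  unfold minv. rewrite D2.
  assert (D1 : forall z : CC, (z / 1 = z)%C) by (intros; field; intros E0; apply RtoC_inj in E0; lra).
  rewrite !D1. unfold mmul, madj, madjugate. simpl.
  assert (Fin : forall X Y : CC, (X = Y * (Cconj a * Cconj d - Cconj b * Cconj c))%C -> X = Y)
    by (intros X Y ->; rewrite Dc; ring).
  f_equal; apply Fin; ring.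
Qed.

(** Periodicity is inherited from the front, since the frame itself may be multiplied by a unitary
    matrix under the deck transformation. *)
Lemma log_derivative_period (x y : R) : x < 0 -> log_derivative (x, y + 2 * PI) = log_derivative (x, y).
Proof.
  intros Hx. rewrite <- !flux_integrand_eq by trivial.
  now rewrite dw_front_period, front_period.
Qed.

(** The entries of [coframe] are the derivatives of those of [E], and derivatives of holomorphic
    functions are holomorphic; so no regularity of [om] and [th] is presupposed. *)
Lemma log_derivative_holo w : Re w < 0 ->
  (exists l, cder (fun u => e11 (log_derivative u)) w l) /\ (exists l, cder (fun u => e12 (log_derivative u)) w l) /\
  (exists l, cder (fun u => e21 (log_derivative u)) w l) /\ (exists l, cder (fun u => e22 (log_derivative u)) w l).
Proof.
  intros Hw.
  destruct (frame_der w Hw) as (H1 & H2 & H3 & H4).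
  assert (Second : forall f df, (forall u, Re u < 0 -> cder f u (df u)) -> exists l, cder df w l).
  { intros f df Hf. apply holo_derivative_at with f (0 - Re w); [lra|].
    intros u Hu. apply Hf. now apply Re_near with w. }
  destruct (Second _ _ (fun u Hu => proj1 (frame_der u Hu))) as [l1 K1].
  destruct (Second _ _ (fun u Hu => proj1 (proj2 (frame_der u Hu)))) as [l2 K2].
  destruct (Second _ _ (fun u Hu => proj1 (proj2 (proj2 (frame_der u Hu))))) as [l3 K3].
  destruct (Second _ _ (fun u Hu => proj2 (proj2 (proj2 (frame_der u Hu))))) as [l4 K4].
  assert (Prod2 : forall f1 f2 g1 g2 k1 k2 l1 l2, cder f1 w k1 -> cder f2 w k2 -> cder g1 w l1 -> cder g2 w l2 ->
    exists l, cder (fun u => f1 u * g1 u + f2 u * g2 u)%C w l)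
    by (intros; eexists; apply der_plus; apply der_mult; eassumption).
  cbn [log_derivative mmul madjugate e11 e12 e21 e22].
  repeat split.
  - apply (Prod2 (fun u => e11 (coframe u)) (fun u => e12 (coframe u)) (fun u => e22 (E u)) (fun u => - e21 (E u))%C _ _ _ _ K1 K2 H4 (der_opp _ _ _ _ H3)).
  - apply (Prod2 (fun u => e11 (coframe u)) (fun u => e12 (coframe u)) (fun u => - e12 (E u))%C (fun u => e11 (E u)) _ _ _ _ K1 K2 (der_opp _ _ _ _ H2) H1).
  - apply (Prod2 (fun u => e21 (coframe u)) (fun u => e22 (coframe u)) (fun u => e22 (E u)) (fun u => - e21 (E u))%C _ _ _ _ K3 K4 H4 (der_opp _ _ _ _ H3)).
  - apply (Prod2 (fun u => e21 (coframe u)) (fun u => e22 (coframe u)) (fun u => - e12 (E u))%C (fun u => e11 (E u)) _ _ _ _ K3 K4 (der_opp _ _ _ _ H2) H1).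
Qed.

Lemma log_derivative_icont (x : R) : x < 0 ->
  icont (fun y => e11 (log_derivative (x, y))) 0 (2 * PI) /\ icont (fun y => e12 (log_derivative (x, y))) 0 (2 * PI) /\
  icont (fun y => e21 (log_derivative (x, y))) 0 (2 * PI) /\ icont (fun y => e22 (log_derivative (x, y))) 0 (2 * PI).
Proof.
  intros Hx.
  assert (K : forall k : M2 -> CC, (forall w, Re w < 0 -> exists l, cder (fun u => k (log_derivative u)) w l) ->
    icont (fun y => k (log_derivative (x, y))) 0 (2 * PI)).
  { intros k Hk. apply icont_global. intros y. destruct (Hk (x, y) Hx) as [l Hl].
    apply (y_cont (fun u => k (log_derivative u))). eapply der_ctn, Hl. }
  split; [|split; [|split]]; apply K; intros w Hw; apply log_derivative_holo; trivial.
Qed.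

(** The factor i in front of the flux and the i of dw = i dt combine to -1. *)
Lemma flux_eq (x : R) : x < 0 ->
  flux E x = mscal (- / RtoC (2 * PI))%C (mRInt (fun y => log_derivative (x, y)) 0 (2 * PI)).
Proof.
  intros Hx. pose proof RtoC_2PI_neq0 as N.
  destruct (log_derivative_icont x Hx) as (I1 & I2 & I3 & I4).
  assert (Key : forall f g, icont f 0 (2 * PI) -> (forall t, g t = Ci * f t)%C ->
    (Ci / RtoC (2 * PI) * RIntC g 0 (2 * PI) = - / RtoC (2 * PI) * RIntC f 0 (2 * PI))%C).
  { intros f g Hf Eg. rewrite (RIntC_ext g (fun t => Ci * f t)%C) by (intros; apply Eg).
    rewrite RIntC_scal by trivial.
    replace (Ci / RtoC (2 * PI) * (Ci * RIntC f 0 (2 * PI)))%C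
      with ((Ci * Ci + 1) * / RtoC (2 * PI) * RIntC f 0 (2 * PI) - / RtoC (2 * PI) * RIntC f 0 (2 * PI))%C by (field; trivial).
    replace (Ci * Ci + 1)%C with (RtoC 0) by (unfold Ci, Cmult, Cplus, RtoC; simpl; f_equal; ring). ring. }
  unfold flux, mscal, mRInt. cbn [e11 e12 e21 e22].
  f_equal; apply Key; trivial; intros t; rewrite <- flux_integrand_eq by trivial; reflexivity.
Qed.

(** Single entries of the integrand may be unbounded at the end, whereas suitable linear
    combinations converge. The coefficients [c1], ..., [c4] witness the linearity that carries [k]
    through the integral. *)
Lemma flux_functional (k : M2 -> CC) (c1 c2 c3 c4 : CC) (f : CC -> CC) (X x : R) :
  (forall A, k A = c1 * e11 A + c2 * e12 A + (c3 * e21 A + c4 * e22 A))%C ->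
  (forall w, Re w < X -> k (log_derivative w) = f (cexp w)) -> ccont f 0 -> x < 0 ->
  k (flux E x) = (- f 0%C)%C.
Proof.
  intros Hk Hf Cf Hx. rewrite flux_eq by trivial.
  destruct (log_derivative_icont x Hx) as (I1 & I2 & I3 & I4).
  pose proof RtoC_2PI_neq0 as N.
  assert (R : RIntC (fun y => k (log_derivative (x, y))) 0 (2 * PI) = (RtoC (2 * PI) * f 0%C)%C).
  { apply (period_integral_residue (fun w => k (log_derivative w)) f X x); trivial.
    - intros w Hw. destruct (log_derivative_holo w Hw) as ([l1 K1] & [l2 K2] & [l3 K3] & [l4 K4]).
      eexists. eapply der_ext; [intros s; symmetry; apply Hk|].
      apply der_plus; apply der_plus; (apply der_mult; [apply der_const|eassumption]).
    - intros x' y Hx'. now rewrite log_derivative_period. }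
  rewrite (RIntC_ext _ (fun y => c1 * e11 (log_derivative (x, y)) + c2 * e12 (log_derivative (x, y)) +
    (c3 * e21 (log_derivative (x, y)) + c4 * e22 (log_derivative (x, y))))%C) in R by (intros; apply Hk).
  rewrite RIntC_lincomb4 in R by trivial.
  rewrite Hk. unfold mscal, mRInt. cbn [e11 e12 e21 e22].
  match goal with |- (c1 * (?c * ?J1) + c2 * (?c * ?J2) + (c3 * (?c * ?J3) + c4 * (?c * ?J4)))%C = _ =>
    replace (c1 * (c * J1) + c2 * (c * J2) + (c3 * (c * J3) + c4 * (c * J4)))%C
      with (c * (c1 * J1 + c2 * J2 + (c3 * J3 + c4 * J4)))%C by ring end.
  rewrite R. field. trivial.
Qed.

End Flux.

(** * The moved frame and the theorem *)

Section MovedFrame.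
Context (E : CC -> M2) (om th : CC -> CC).
Hypothesis Hfront : flat_front_data E om th.
Context (a : M2) (r X0 : R) (g gs dg dgs : CC -> CC).
Hypothesis Ha : mdet a = 1%C.
Hypothesis HX0 : X0 <= 0.
Hypothesis HX0r : forall w, Re w < X0 -> Cmod (cexp w) < r.
Hypothesis Hdg : forall z, Cmod z < r -> cder g z (dg z).
Hypothesis Hdgs : forall z, Cmod z < r -> cder gs z (dgs z).
Hypothesis HG : forall w, Re w < X0 -> e11 (mmul a (E w)) = (g (cexp w) * e21 (mmul a (E w)))%C.
Hypothesis HGs : forall w, Re w < X0 -> e12 (mmul a (E w)) = (gs (cexp w) * e22 (mmul a (E w)))%C.

Definition moved21 (w : CC) : CC := e21 (mmul a (E w)).
Definition moved22 (w : CC) : CC := e22 (mmul a (E w)).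

Lemma mmul_entry_der (c1 c2 : CC) (f1 f2 : CC -> CC) w l1 l2 : cder f1 w l1 -> cder f2 w l2 ->
  cder (fun u => c1 * f1 u + c2 * f2 u)%C w (c1 * l1 + c2 * l2)%C.
Proof.
  intros H1 H2. eapply der_eq; [|apply der_plus; apply der_mult;
    [apply der_const|exact H1|apply der_const|exact H2]]. cbv beta. ring.
Qed.

Lemma moved_der w : Re w < 0 ->
  cder (fun u => e11 (mmul a (E u))) w (e12 (mmul a (E w)) * om w)%C /\
  cder (fun u => e12 (mmul a (E u))) w (e11 (mmul a (E w)) * th w)%C /\
  cder moved21 w (moved22 w * om w)%C /\ cder moved22 w (moved21 w * th w)%C.
Proof.
  intros Hw. destruct (frame_der E om th Hfront w Hw) as (H1 & H2 & H3 & H4).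
  unfold moved21, moved22, coframe in *. cbn [mmul e11 e12 e21 e22] in *.
  repeat split.
  - eapply der_eq; [|apply mmul_entry_der; [exact H1|exact H3]]. ring.
  - eapply der_eq; [|apply mmul_entry_der; [exact H2|exact H4]]. ring.
  - eapply der_eq; [|apply mmul_entry_der; [exact H1|exact H3]]. ring.
  - eapply der_eq; [|apply mmul_entry_der; [exact H2|exact H4]]. ring.
Qed.

Lemma moved_det w : Re w < X0 -> ((g (cexp w) - gs (cexp w)) * moved21 w * moved22 w = 1)%C.
Proof.
  intros Hw. pose proof (frame_det E om th Hfront w ltac:(lra)) as D.
  assert (Dm : (e11 (mmul a (E w)) * moved22 w - e12 (mmul a (E w)) * moved21 w = mdet a * mdet (E w))%C)
    by (unfold moved21, moved22, mdet, mmul; simpl; ring).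
  rewrite Ha, D, HG, HGs in Dm by trivial. fold (moved21 w) (moved22 w) in Dm.
  transitivity (g (cexp w) * moved21 w * moved22 w - gs (cexp w) * moved22 w * moved21 w)%C; [ring|].
  rewrite Dm. ring.
Qed.

(* Differentiate [E11 = G E21] and [E12 = Gs E22] and eliminate with [det = 1]. *)
Lemma om_formula w : Re w < X0 -> om w = (- (cexp w * dg (cexp w) * (moved21 w * moved21 w)))%C.
Proof.
  intros Hw. destruct (moved_der w ltac:(lra)) as (D1 & D2 & D3 & D4).
  assert (K : (e12 (mmul a (E w)) * om w =
    cexp w * dg (cexp w) * moved21 w + g (cexp w) * (moved22 w * om w))%C).
  { apply cder_unique with (1 := D1).
    apply der_ext_loc with (f := fun u => (g (cexp u) * moved21 u)%C) (d := X0 - Re w); [lra| |].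
    - intros u Hu. symmetry. apply HG. now apply Re_near with w.
    - apply (der_mult idC (fun u => g (cexp u)) moved21); trivial. apply der_comp_cexp, Hdg; auto. }
  rewrite HGs in K by trivial. fold (moved22 w) in K. pose proof (moved_det w Hw) as D.
  transitivity ((g (cexp w) - gs (cexp w)) * moved21 w * moved22 w * om w)%C; [rewrite D; ring|].
  transitivity (- moved21 w * (gs (cexp w) * moved22 w * om w) + moved21 w * (g (cexp w) * (moved22 w * om w)))%C; [ring|].
  rewrite K. ring.
Qed.

Lemma th_formula w : Re w < X0 -> th w = (cexp w * dgs (cexp w) * (moved22 w * moved22 w))%C.
Proof.
  intros Hw. destruct (moved_der w ltac:(lra)) as (D1 & D2 & D3 & D4).
  assert (K : (e11 (mmul a (E w)) * th w =
    cexp w * dgs (cexp w) * moved22 w + gs (cexp w) * (moved21 w * th w))%C).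
  { apply cder_unique with (1 := D2).
    apply der_ext_loc with (f := fun u => (gs (cexp u) * moved22 u)%C) (d := X0 - Re w); [lra| |].
    - intros u Hu. symmetry. apply HGs. now apply Re_near with w.
    - apply (der_mult idC (fun u => gs (cexp u)) moved22); trivial. apply der_comp_cexp, Hdgs; auto. }
  rewrite HG in K by trivial. fold (moved21 w) in K. pose proof (moved_det w Hw) as D.
  transitivity ((g (cexp w) - gs (cexp w)) * moved21 w * moved22 w * th w)%C; [rewrite D; ring|].
  transitivity (moved22 w * (g (cexp w) * moved21 w * th w) - moved22 w * (gs (cexp w) * (moved21 w * th w)))%C; [ring|].
  rewrite K. ring.
Qed.

Lemma gauss_diff_neq0 w : Re w < X0 -> (g (cexp w) - gs (cexp w))%C <> 0%C.
Proof.
  intros Hw E0. pose proof (moved_det w Hw) as D. rewrite E0 in D.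
  assert (RtoC 1 = RtoC 0) as E1 by (rewrite <- D; ring). apply RtoC_inj in E1. lra.
Qed.

Lemma moved_prod w : Re w < X0 -> (moved21 w * moved22 w)%C = (/ (g (cexp w) - gs (cexp w)))%C.
Proof.
  intros Hw. pose proof (gauss_diff_neq0 w Hw) as N. pose proof (moved_det w Hw) as D.
  transitivity ((g (cexp w) - gs (cexp w)) * moved21 w * moved22 w * / (g (cexp w) - gs (cexp w)))%C.
  - field. trivial.
  - rewrite D. ring.
Qed.

Lemma moved21_der w : Re w < X0 ->
  cder moved21 w (moved21 w * (- (cexp w * dg (cexp w) / (g (cexp w) - gs (cexp w)))))%C.
Proof.
  intros Hw. destruct (moved_der w ltac:(lra)) as (_ & _ & D3 & _).
  eapply der_eq; [|exact D3]. rewrite om_formula by trivial. unfold Cdiv. rewrite <- moved_prod by trivial. ring.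
Qed.

Lemma moved22_der w : Re w < X0 ->
  cder moved22 w (moved22 w * (cexp w * dgs (cexp w) / (g (cexp w) - gs (cexp w))))%C.
Proof.
  intros Hw. destruct (moved_der w ltac:(lra)) as (_ & _ & _ & D4).
  eapply der_eq; [|exact D4]. rewrite th_formula by trivial. unfold Cdiv. rewrite <- moved_prod by trivial. ring.
Qed.

Lemma hopf_formula w : Re w < X0 -> (om w * th w)%C =
  (- (cexp w * dg (cexp w) * (cexp w * dgs (cexp w))) /
   ((g (cexp w) - gs (cexp w)) * (g (cexp w) - gs (cexp w))))%C.
Proof.
  intros Hw. pose proof (gauss_diff_neq0 w Hw) as N.
  rewrite om_formula, th_formula by trivial.
  transitivity (- (cexp w * dg (cexp w) * (cexp w * dgs (cexp w))) *
    ((moved21 w * moved22 w) * (moved21 w * moved22 w)))%C; [ring|].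
  rewrite moved_prod by trivial. field. trivial.
Qed.

(* The isometry [a] followed by the translation that moves the common value [c] of the Gauss maps to [0]. *)
Definition centered (c : CC) : M2 :=
  mkM2 (e11 a - c * e21 a)%C (e12 a - c * e22 a)%C (e21 a) (e22 a).

Lemma centered_det c : mdet (centered c) = 1%C.
Proof. rewrite <- Ha. unfold mdet, centered. simpl. ring. Qed.

(** Conjugation turns dE E^-1 into dF F^-1 for the centred frame F = [[G p, Gs s], [p, s]] with
    shifted Gauss maps. Every entry is then a polynomial in the Gauss data times (p s)^2 = 1 /
    H^2. *)
Lemma mconj_log_derivative c w : Re w < X0 ->
  let G := (g (cexp w) - c)%C in let Gs := (gs (cexp w) - c)%C in
  let H2 := ((g (cexp w) - gs (cexp w)) * (g (cexp w) - gs (cexp w)))%C in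
  let dG := (cexp w * dg (cexp w))%C in let dGs := (cexp w * dgs (cexp w))%C in
  let V := mconj (centered c) (log_derivative E om th w) in
  e11 V = (- (Gs * dG + G * dGs) / H2)%C /\
  e12 V = ((Gs * Gs * dG + G * G * dGs) / H2)%C /\
  e22 V = ((Gs * dG + G * dGs) / H2)%C.
Proof.
  intros Hw G Gs H2 dG dGs V.
  assert (F11 : e11 (mmul (centered c) (E w)) = (G * moved21 w)%C).
  { transitivity (e11 (mmul a (E w)) - c * moved21 w)%C; [unfold moved21, mmul, centered; simpl; ring|].
    rewrite HG by trivial. fold (moved21 w). unfold G. ring. }
  assert (F12 : e12 (mmul (centered c) (E w)) = (Gs * moved22 w)%C).
  { transitivity (e12 (mmul a (E w)) - c * moved22 w)%C; [unfold moved22, mmul, centered; simpl; ring|].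
    rewrite HGs by trivial. fold (moved22 w). unfold Gs. ring. }
  assert (F21 : e21 (mmul (centered c) (E w)) = moved21 w) by reflexivity.
  assert (F22 : e22 (mmul (centered c) (E w)) = moved22 w) by reflexivity.
  assert (EV : V = mmul (mmul (mmul (centered c) (E w)) (mkM2 0%C (th w) (om w) 0%C))
    (madjugate (mmul (centered c) (E w)))).
  { unfold V, mconj, log_derivative, coframe, madjugate, mmul. simpl. f_equal; ring. }
  pose proof (gauss_diff_neq0 w Hw) as N.
  set (F := mmul (centered c) (E w)) in *.
  rewrite EV. unfold mmul, madjugate. cbn [e11 e12 e21 e22].
  rewrite F11, F12, F21, F22, om_formula, th_formula by trivial. fold dG dGs.
  set (P := (moved21 w * moved22 w)%C).
  assert (EP : forall k, (k / H2 = k * (P * P))%C).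
  { intros k. unfold P. rewrite moved_prod by trivial. unfold H2. field. trivial. }
  rewrite !EP. unfold P. repeat split; ring.
Qed.

End MovedFrame.

(** Put G - c = z^m times its quotient, likewise for G_*, and z G' = z^m u, z G_*' = z^m v. The
    first and third numerators then carry z^(2m) and the second z^(3m), while H^2 carries z^(2m);
    what remains is continuous at 0, and the surplus z^m makes the second limit 0. *)
Lemma leading_limits (g gs dg dgs u v : CC -> CC) (r : R) (m : nat) (c : CC) : 0 < r -> (1 <= m)%nat ->
  (forall z, Cmod z < r -> cder g z (dg z)) -> (forall z, Cmod z < r -> cder gs z (dgs z)) ->
  holo_on r u -> holo_on r v ->
  (forall z, Cmod z < r -> dg z = (z ^ (m - 1) * u z)%C) ->
  (forall z, Cmod z < r -> dgs z = (z ^ (m - 1) * v z)%C) ->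
  g 0%C = c -> gs 0%C = c -> u 0%C <> v 0%C ->
  exists f11 f12 fq : CC -> CC, ccont f11 0 /\ ccont f12 0 /\ ccont fq 0 /\
    f11 0%C = (- (2 * RtoC (INR m) * u 0%C * v 0%C / ((u 0%C - v 0%C) * (u 0%C - v 0%C))))%C /\
    f12 0%C = 0%C /\
    fq 0%C = (- (RtoC (INR m) * RtoC (INR m) * u 0%C * v 0%C / ((u 0%C - v 0%C) * (u 0%C - v 0%C))))%C /\
    forall z, Cmod z < r -> z <> 0%C -> (g z - gs z)%C <> 0%C ->
      ((gs z - c) * (z * dg z) + (g z - c) * (z * dgs z))%C = (- f11 z * ((g z - gs z) * (g z - gs z)))%C /\
      ((gs z - c) * (gs z - c) * (z * dg z) + (g z - c) * (g z - c) * (z * dgs z))%C =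
        (f12 z * ((g z - gs z) * (g z - gs z)))%C /\
      (- (z * dg z * (z * dgs z)))%C = (fq z * ((g z - gs z) * (g z - gs z)))%C.
Proof.
  intros Hr Hm Hdg Hdgs Hu Hv Eu Ev Hg0 Hgs0 Huv. pose proof (INR_C_neq0 m Hm) as Nm.
  assert (Nuv : (u 0%C - v 0%C)%C <> 0%C) by now apply Cminus_eq_contra.
  set (G := quot_pow g u m). set (Gs := quot_pow gs v m).
  assert (Cu : ccont u 0) by (apply ccont_0_holo with r; trivial).
  assert (Cv : ccont v 0) by (apply ccont_0_holo with r; trivial).
  assert (CG : ccont G 0) by (apply quot_pow_cont with dg r; trivial).
  assert (CGs : ccont Gs 0) by (apply quot_pow_cont with dgs r; trivial).
  assert (G0 : G 0%C = (u 0%C / RtoC (INR m))%C) by apply quot_pow_0.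
  assert (Gs0 : Gs 0%C = (v 0%C / RtoC (INR m))%C) by apply quot_pow_0.
  set (h2 := fun z => ((G z - Gs z) * (G z - Gs z))%C).
  assert (Ch2 : ccont h2 0) by (apply ctn_mult; now apply ctn_minus).
  assert (Eh0 : h2 0%C = ((u 0%C - v 0%C) * (u 0%C - v 0%C) / (RtoC (INR m) * RtoC (INR m)))%C)
    by (unfold h2; rewrite G0, Gs0; field; trivial).
  assert (Nh0 : h2 0%C <> 0%C).
  { rewrite Eh0. unfold Cdiv. apply Cmult_neq_0; [now apply Cmult_neq_0|].
    apply Cmod_neq0. rewrite Cmod_inv by now apply Cmult_neq_0.
    apply Rinv_0_lt_compat. apply Cmod_gt_0. now apply Cmult_neq_0. }
  exists (fun z => (- ((Gs z * u z + G z * v z) / h2 z))%C),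
    (fun z => (z ^ m * (Gs z * Gs z * u z + G z * G z * v z) / h2 z)%C),
    (fun z => (- (u z * v z / h2 z))%C).
  split; [|split; [|split; [|split; [|split; [|split]]]]].
  - apply ctn_opp, ctn_div; trivial. apply ctn_plus; now apply ctn_mult.
  - apply ctn_div; trivial. apply ctn_mult; [apply ctn_pow, (ctn_self idC)|].
    apply ctn_plus; (apply ctn_mult; [now apply ctn_mult|trivial]).
  - apply ctn_opp, ctn_div; trivial. now apply ctn_mult.
  - rewrite Eh0, G0, Gs0. field. auto.
  - replace (0 ^ m)%C with (RtoC 0) by (destruct m; [lia|simpl; ring]). field. trivial.
  - rewrite Eh0. field. auto.
  - intros z Hz Nz Hne. rewrite Eu, Ev by trivial.
    assert (Pm : (z * z ^ (m - 1) = z ^ m)%C).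
    { replace m with (S (m - 1)) at 2 by lia. symmetry. apply Cpow_S. }
    assert (E1 : (g z - c = z ^ m * G z)%C) by (rewrite (quot_pow_spec g u m z Nz), Hg0; fold (G z); unfold G; ring).
    assert (E2 : (gs z - c = z ^ m * Gs z)%C) by (rewrite (quot_pow_spec gs v m z Nz), Hgs0; unfold Gs; ring).
    assert (E3 : (g z - gs z = z ^ m * (G z - Gs z))%C).
    { transitivity ((g z - c) - (gs z - c))%C; [ring|]. rewrite E1, E2. ring. }
    assert (Nd : (G z - Gs z)%C <> 0%C) by (intros E0; apply Hne; rewrite E3, E0; ring).
    rewrite E1, E2, E3, !(Cmult_assoc z (z ^ (m - 1))), Pm. unfold h2.
    repeat split; field; trivial.
Qed.

(** The conclusion includes [alpha <> 1], so that [lambda0] is a genuine quotient. The eigenvalues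
    are characterized as a set, for the circle of every radius [exp x0]. *)
Theorem theorem2p4
  (E : CC -> M2) (om th : CC -> CC)
  (Hfront : flat_front_data E om th)
  (HWCF : WCF_end om th)
  (Hreg : regular_end E)
  (* an isometry a in SL(2,C) after which G(0) <> oo:  G and G_* of the
     moved front a f a^* = (aE)(aE)^* are holomorphic functions g, gs of z
     near 0, with derivatives dg, dgs *)
  (a : M2) (Ha : mdet a = 1%C)
  (r : R) (g gs dg dgs : CC -> CC)
  (Hr : (0 < r)%R)
  (Hdg : forall z, disk r z -> cderiv_at g z (dg z))
  (Hdgs : forall z, disk r z -> cderiv_at gs z (dgs z))
  (HG : forall w : CC, (Re w < ln r)%R -> (Re w < 0)%R ->
          e11 (mmul a (E w)) = (g (cexp w) * e21 (mmul a (E w)))%C)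
  (HGs : forall w : CC, (Re w < ln r)%R -> (Re w < 0)%R ->
          e12 (mmul a (E w)) = (gs (cexp w) * e22 (mmul a (E w)))%C)
  (m : nat) (Hm : is_multiplicity dg dgs m)
  (alpha : CC) (Halpha : is_gauss_ratio dg dgs alpha)
  (q : CC) (Hq : hopf_top_coeff om th q)
  (x0 : R) (Hx0 : (x0 < 0)%R) :
  let lambda0 := (2 * RtoC (INR m) * alpha / ((1 - alpha) * (1 - alpha)))%C in
  alpha <> 1%C /\
  (forall mu : CC, is_eigenvalue (flux E x0) mu <-> (mu = lambda0 \/ mu = - lambda0)%C) /\
  lambda0 = (- (2 * q / RtoC (INR m)))%C /\
  (alpha <> 0%C -> diagonalizable (flux E x0)).
Proof.
  assert (Dg0 : forall z, Cmod z < r -> cder g z (dg z)) by (intros; now apply cder_iff, Hdg).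
  assert (Dgs0 : forall z, Cmod z < r -> cder gs z (dgs z)) by (intros; now apply cder_iff, Hdgs).
  destruct (gauss_ratio_orders g gs dg dgs r m alpha Hr Dg0 Dgs0 Hm Halpha)
    as (r' & u & v & Hr' & Hu & Hv & Eu & Ev & Hcase).
  assert (Dg : forall z, Cmod z < r' -> cder g z (dg z)) by (intros; apply Dg0; lra).
  assert (Dgs : forall z, Cmod z < r' -> cder gs z (dgs z)) by (intros; apply Dgs0; lra).
  assert (Hm1 : (1 <= m)%nat) by apply Hm. pose proof (INR_C_neq0 m Hm1) as Nm.
  set (X0 := Rmin 0 (ln r')).
  assert (HX0 : X0 <= 0) by apply Rmin_l.
  assert (HX0r : forall w, Re w < X0 -> Cmod (cexp w) < r').
  { intros w Hw. apply cexp_small; [lra|]. apply Rlt_le_trans with (1 := Hw), Rmin_r. }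
  assert (HX0ln : forall w, Re w < X0 -> Re w < ln r).
  { intros w Hw. apply Rlt_le_trans with (1 := Hw), Rle_trans with (1 := Rmin_r _ _), ln_le; lra. }
  assert (HG' : forall w, Re w < X0 -> e11 (mmul a (E w)) = (g (cexp w) * e21 (mmul a (E w)))%C)
    by (intros w Hw; apply HG; auto; lra).
  assert (HGs' : forall w, Re w < X0 -> e12 (mmul a (E w)) = (gs (cexp w) * e22 (mmul a (E w)))%C)
    by (intros w Hw; apply HGs; auto; lra).
  clearbody X0.
  assert (Hdet : forall w, Re w < X0 -> ((g (cexp w) - gs (cexp w)) * moved21 E a w * moved22 E a w = 1)%C)
    by (intros; eapply moved_det; eassumption).
  assert (Hp : forall w, Re w < X0 -> cder (moved21 E a) w
    (moved21 E a w * (- (cexp w * dg (cexp w) / (g (cexp w) - gs (cexp w)))))%C)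
    by (intros; eapply moved21_der; eassumption).
  assert (Hs : forall w, Re w < X0 -> cder (moved22 E a) w
    (moved22 E a w * (cexp w * dgs (cexp w) / (g (cexp w) - gs (cexp w))))%C)
    by (intros; eapply moved22_der; eassumption).
  assert (Hom : forall w, Re w < X0 -> om w = (- (cexp w * dg (cexp w) * (moved21 E a w * moved21 E a w)))%C)
    by (intros; eapply om_formula; eassumption).
  assert (Hth : forall w, Re w < X0 -> th w = (cexp w * dgs (cexp w) * (moved22 E a w * moved22 E a w))%C)
    by (intros; eapply th_formula; eassumption).
  assert (Hg0 : g 0%C = gs 0%C).
  { eapply (gauss_maps_agree (moved21 E a) (moved22 E a) om th g gs dg dgs r' X0); trivial; [lra|].
    apply HWCF. }
  assert (Huv : u 0%C <> v 0%C).
  { intros Huv.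
    assert (Nu : u 0%C <> 0%C) by (destruct Hcase as [[N _]|[N _]]; congruence).
    apply (unit_ratio_infinite_curvature (moved21 E a) (moved22 E a) om th g gs dg dgs r' X0) with u v m;
      trivial; [lra|]. apply HWCF. }
  assert (Ha1 : alpha <> 1%C).
  { intros ->. apply Huv. destruct Hcase as [[_ ->]|[_ ->]]; ring. }
  assert (Na : (1 - alpha)%C <> 0%C) by (apply Cminus_eq_contra; congruence).
  destruct (leading_limits g gs dg dgs u v r' m (g 0%C)) as (f11 & f12 & fq & C11 & C12 & Cq & V11 & V12 & Vq & Rel);
    trivial; try lra; try congruence.
  intros lambda0.
  (* The expression is symmetric and homogeneous of degree 0 in u(0) and v(0), so both forms of the
     ratio give the same value. *)
  assert (L0 : lambda0 = (2 * RtoC (INR m) * u 0%C * v 0%C / ((u 0%C - v 0%C) * (u 0%C - v 0%C)))%C).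
  { assert (Nuv : (u 0%C - v 0%C)%C <> 0%C) by now apply Cminus_eq_contra.
    unfold lambda0. destruct Hcase as [[N Ev0]|[N Eu0]].
    - rewrite Ev0 in *. field. split; trivial.
    - rewrite Eu0 in *. field. split; trivial. }
  assert (W : forall w, Re w < X0 -> (g (cexp w) - gs (cexp w))%C <> 0%C)
    by (intros; eapply gauss_diff_neq0; eassumption).
  assert (Entry : forall w, Re w < X0 ->
    e11 (mconj (centered a (g 0%C)) (log_derivative E om th w)) = f11 (cexp w) /\
    e12 (mconj (centered a (g 0%C)) (log_derivative E om th w)) = f12 (cexp w) /\
    e22 (mconj (centered a (g 0%C)) (log_derivative E om th w)) = (- f11 (cexp w))%C).
  { intros w Hw.
    destruct (mconj_log_derivative E om th Hfront a r' X0 g gs dg dgs Ha HX0 HX0r Dg Dgs HG' HGs' (g 0%C) w Hw)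
      as (M11 & M12 & M22).
    destruct (Rel (cexp w)) as (R1 & R2 & _); auto using cexp_neq0.
    rewrite M11, M12, M22, R1, R2. specialize (W w Hw). repeat split; field; trivial. }
  (* These formulas display the entries of the conjugate as linear functionals of [A], from which
     [flux_functional] reads off its coefficients. *)
  assert (Lin : forall A c, (e11 (mconj c A) = e11 c * e22 c * e11 A + - (e11 c * e21 c) * e12 A +
      (e12 c * e22 c * e21 A + - (e12 c * e21 c) * e22 A) /\
    e12 (mconj c A) = - (e11 c * e12 c) * e11 A + e11 c * e11 c * e12 A +
      (- (e12 c * e12 c) * e21 A + e12 c * e11 c * e22 A) /\
    e22 (mconj c A) = - (e21 c * e12 c) * e11 A + e21 c * e11 c * e12 A +
      (- (e22 c * e12 c) * e21 A + e22 c * e11 c * e22 A))%C).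
  { intros A c. unfold mconj, madjugate, mmul. simpl. repeat split; ring. }
  set (c0 := centered a (g 0%C)) in *.
  assert (T11 : e11 (mconj c0 (flux E x0)) = lambda0).
  { rewrite (flux_functional E om th Hfront (fun A => e11 (mconj c0 A)) _ _ _ _ f11 X0 x0
      (fun A => proj1 (Lin A c0))); trivial.
    - rewrite V11, L0. ring.
    - intros w Hw. now apply Entry. }
  assert (T12 : e12 (mconj c0 (flux E x0)) = 0%C).
  { rewrite (flux_functional E om th Hfront (fun A => e12 (mconj c0 A)) _ _ _ _ f12 X0 x0
      (fun A => proj1 (proj2 (Lin A c0)))); trivial.
    - rewrite V12. ring.
    - intros w Hw. now apply Entry. }
  assert (T22 : e22 (mconj c0 (flux E x0)) = (- lambda0)%C).
  { rewrite (flux_functional E om th Hfront (fun A => e22 (mconj c0 A)) _ _ _ _ (fun z => - f11 z)%C X0 x0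
      (fun A => proj2 (proj2 (Lin A c0)))); trivial.
    - rewrite V11, L0. ring.
    - intros w Hw. now apply Entry.
    - now apply ctn_opp. }
  assert (Eig : forall mu : CC, is_eigenvalue (flux E x0) mu <-> (mu = lambda0 \/ mu = - lambda0)%C).
  { intros mu. rewrite eigenvalue_iff.
    rewrite (mconj_triangular_charpoly c0 (flux E x0) lambda0 mu); trivial.
    2: now apply centered_det.
    split.
    - intros Z. apply NNPP. intros N. apply not_or_and in N. destruct N as [N1 N2].
      apply (Cmult_neq_0 (mu - lambda0) (mu + lambda0))%C; trivial.
      + now apply Cminus_eq_contra.
      + intros E0. apply N2. replace mu with (mu + lambda0 - lambda0)%C by ring. rewrite E0. ring.
    - intros [-> | ->]; ring. }
  split; trivial. split; trivial. split.
  (* The Hopf coefficient - z^2 G' G_*' / H^2 has the limit [fq 0] at the end, and limits are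
     unique. One point w far enough to the left compares both. *)
  - assert (Eq : q = fq 0%C).
    { apply C_eq_eps with 2; [lra|]. intros e He.
      destruct (Hq e He) as [M1 HM1]. destruct (ccont_end fq e Cq He) as [M2 HM2].
      set (x := Rmin X0 (Rmin M1 M2) - 1).
      pose proof (Rmin_l X0 (Rmin M1 M2)). pose proof (Rmin_r X0 (Rmin M1 M2)).
      pose proof (Rmin_l M1 M2). pose proof (Rmin_r M1 M2).
      assert (Hx : x < X0 /\ x < M1 /\ x < M2) by (unfold x; lra). clearbody x.
      specialize (HM1 (x, 0)). specialize (HM2 (x, 0)). simpl Re in *.
      specialize (HM1 ltac:(lra) ltac:(lra)). specialize (HM2 ltac:(lra)).
      assert (Hxw : Re (x, 0) < X0) by (simpl; lra).
      rewrite (hopf_formula E om th Hfront a r' X0 g gs dg dgs Ha HX0 HX0r Dg Dgs HG' HGs' (x, 0) Hxw) in HM1.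
      destruct (Rel (cexp (x, 0))) as (_ & _ & R3); auto using cexp_neq0.
      rewrite R3 in HM1. specialize (W (x, 0) Hxw).
      match type of HM1 with Cmod (?A * ?B / ?B - q) < e =>
        replace (A * B / B)%C with A in HM1 by (field; trivial) end.
      replace (q - fq 0%C)%C with ((fq (cexp (x, 0)) - fq 0%C) - (fq (cexp (x, 0)) - q))%C by ring.
      eapply Rle_trans; [apply Cmod_tri_sub|]. lra. }
    assert (Nuv : (u 0%C - v 0%C)%C <> 0%C) by now apply Cminus_eq_contra.
    rewrite Eq, Vq, L0. field. auto.
  (* For alpha different from 0 the eigenvalue [lambda0] is nonzero, hence distinct from its
     opposite. *)
  - intros Na0. apply diagonalizable_of_distinct with lambda0 (- lambda0)%C; try (apply Eig; auto).
    intros E0.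
    assert (Z : (2 * lambda0)%C = 0%C) by (transitivity (lambda0 - - lambda0)%C; [ring|rewrite <- E0; ring]).
    assert (N2 : RtoC 2 <> 0%C) by (intros E2; apply RtoC_inj in E2; lra).
    apply (Cmult_neq_0 2 lambda0)%C; trivial.
    unfold lambda0, Cdiv. repeat apply Cmult_neq_0; trivial.
    apply Cmod_neq0. rewrite Cmod_inv by now apply Cmult_neq_0.
    apply Rinv_0_lt_compat. apply Cmod_gt_0. now apply Cmult_neq_0.
Qed.
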